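(* Let $R$ be a two-dimensional regular local ring and let $f\in R$, $f\neq 0$, be a non-unit. Let $$(\mathrm{In}(f))=p_1^{n_{p_1}(f)}\cdot p_2^{n_{p_2}(f)}\cdots p_s^{n_{p_s}(f)}$$ be the factorisation of the principal homogeneous ideal $(\mathrm{In}(f))$ in $\mathrm{gr}_{\mathfrak m_R}(R)$, with $p_i\in\mathbb P_R$ and $p_i\neq p_j$ if $i\neq j$, for $1\le i,j\le s$. Let $d_i:=[S_{p_i}:R]=\deg(p_i)$ for $1\le i\le s$, where $S_{p_i}$ is the quadratic transform of $R$ at $p_i$, and denote by $(\mathrm{qS})_j$ the quadratic sequence determined by $p_j$, $1\le j\le s$. Then: (1) $\displaystyle \mathrm{ord}_R(f)=\sum_{j=1}^{s} d_j\sum_{S\in\{T\in N(S_{p_j})\,\mid\, T\in(\mathrm{qS})_j\}}\mathrm{ord}_S\big((fR)^S\big)$. (2) For every $j\in\{1,\dots,s\}$, $\displaystyle n_{p_j}(f)=\sum_{S\in\{T\in N(S_{p_j})\,\mid\, T\in(\mathrm{qS})_j\}}\mathrm{ord}_S\big((fR)^S\big)$.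
   Context: $R$ is a two-dimensional regular local ring with maximal ideal $\mathfrak m_R$, residue field $k_R$ and quotient field $\mathcal K$. Order: for $0\ne f\in R$, $\mathrm{ord}_R(f)=m$ if $f\in\mathfrak m_R^m\setminus\mathfrak m_R^{m+1}$; $\mathrm{In}(f)$ is the class of $f$ in $\mathfrak m_R^m/\mathfrak m_R^{m+1}$. For a non-zero ideal $\mathfrak a$, $\mathrm{ord}_R(\mathfrak a)=\min\{\mathrm{ord}_R(a)\mid a\in\mathfrak a\}$ (so the unit ideal has order $0$). $\mathrm{ord}_R$ extends to a discrete rank one valuation of $\mathcal K$ with valuation ring $V_R$. Quadratic transforms: $\mathrm{gr}_{\mathfrak m_R}(R)=\bigoplus_{n\ge0}\mathfrak m_R^n/\mathfrak m_R^{n+1}=k_R[\overline x,\overline y]$ is a polynomial ring, where $\{x,y\}$ is a regular system of parameters of $R$. $\mathbb P_R$ is the set of homogeneous prime ideals of height $1$ of $\mathrm{gr}_{\mathfrak m_R}(R)$; each $p\in\mathbb P_R$ is generated by an irreducible homogeneous polynomial $\overline h$, and $\deg(p):=\deg(\overline h)$. If $m=\deg(\overline h)$, $h\in\mathfrak m_R^m$ has class $\overline h$, and (without loss of generality) $\overline x\nmid\overline h$, the quadratic transform of $R$ at $p$ is $S_p:=R[y/x]_{(x,\,h/x^m)}$, a two-dimensional regular local ring with quotient field $\mathcal K$. $N_0(R)=\{R\}$, $N_1(R)=\{S_p\mid p\in\mathbb P_R\}$, $N_i(R)$ ($i>1$) is the set of quadratic transforms of the rings in $N_{i-1}(R)$,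 and $N(R)=\bigcup_{i\ge0}N_i(R)$. For $S\in N(R)$, $[S:R]:=[k_S:k_R]$. Quadratic sequence determined by $p\in\mathbb P_R$: the unique infinite sequence $R=R_0\subset R_1=S_p\subset R_2\subset\cdots\subset V_R$ in which $R_{i+1}$ is a quadratic transform of $R_i$ for every $i\geq 0$ and all $R_i$ are contained in $V_R$. Strict transform: for $S\in N(R)$ and a principal ideal $fR\ne0$, $(fR)^S$ is obtained step by step along the unique chain of quadratic transforms from $R$ to $S$; for a single quadratic transform $R\subset S_p$ with $\mathfrak m_RS_p=xS_p$ one has $(fR)^{S_p}=x^{-\mathrm{ord}_R(f)}fS_p$. *)

(* Defs.v *)
From HB Require Import structures.
From mathcomp Require Import all_boot all_order all_algebra.
From mathcomp Require Import generic_quotient ring_quotient.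
From mathcomp Require Import boolp classical_sets cardinality fsbigop.

Set Implicit Arguments.
Unset Strict Implicit.
Unset Printing Implicit Defensive.

Import GRing.Theory.
Local Open Scope classical_set_scope.
Local Open Scope ring_scope.

Section Ideals.
Variable T : comNzRingType.
Implicit Types (I J P M : set T) (A : set T).

Definition is_ideal I : Prop :=
  [/\ I 0, forall a b, I a -> I b -> I (a + b) & forall a b, I b -> I (a * b)].

Definition ideal_gen A : set T := smallest is_ideal A.

Definition principal (a : T) : set T := [set a * b | b in setT].

Definition ideal_mul I J : set T :=
  ideal_gen [set z | exists a b, [/\ I a, J b & z = a * b]].

Definition ideal_exp I (n : nat) : set T := iter n (ideal_mul I) setT.

Definition is_prime P : Prop :=
  [/\ is_ideal P, ~ P 1 & forall a b, P (a * b) -> P a \/ P b].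

Definition is_maximal M : Prop :=
  [/\ is_ideal M, ~ M 1 & forall J, is_ideal J -> ~ J 1 -> M `<=` J -> J = M].

Definition is_unit (a : T) : Prop := exists b, a * b = 1.

Definition prime_chain (n : nat) (P : nat -> set T) : Prop :=
  (forall i, (i <= n)%N -> is_prime (P i)) /\
  (forall i, (i < n)%N -> P i `<` P i.+1).

Definition has_height P (n : nat) : Prop :=
  (exists2 Q, prime_chain n Q & Q n = P) /\
  (forall m Q, prime_chain m Q -> Q m = P -> (m <= n)%N).

End Ideals.

Definition has_krull_dim (T : comNzRingType) (n : nat) : Prop :=
  (exists Q : nat -> set T, prime_chain n Q) /\
  (forall m (Q : nat -> set T), prime_chain m Q -> (m <= n)%N).

Definition is_noetherian (T : comNzRingType) : Prop :=
  forall I : set T, is_ideal I -> exists s : seq T, I = ideal_gen [set` s].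

Definition is_local (T : comNzRingType) : Prop :=
  exists! M : set T, is_maximal M.

(* The maximal ideal of a local ring.  For an arbitrary T this is some maximal
   ideal, or 0; in all cases it is a proper ideal, so that gr T below is a ring
   without any assumption on T. *)
Definition max_ideal (T : comNzRingType) : set T :=
  xget [set 0] [set M | is_maximal M].
Arguments max_ideal T : clear implicits.

Definition regular_parameters (T : comNzRingType) (x y : T) : Prop :=
  max_ideal T = ideal_gen [set x; y].

Definition regular_local_ring2 (T : comNzRingType) : Prop :=
  [/\ is_local T, is_noetherian T, has_krull_dim T 2 &
      exists x y : T, regular_parameters x y].

Section IdealTheory.
Variable T : comNzRingType.
Implicit Types (I J A : set T).

Lemma ideal_gen_ideal A : is_ideal (ideal_gen A).
Proof.
split=> [|a b Aa Ab|a b Ab] J [Jid AJ]; first by case: Jid.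
- by case: (Jid) => _ + _; apply; [exact: Aa|exact: Ab].
- by case: (Jid) => _ _; apply; exact: Ab.
Qed.

Lemma ideal_exp_ideal I n : is_ideal (ideal_exp I n).
Proof. by case: n => [|n]; [split|exact: ideal_gen_ideal]. Qed.

Lemma ideal_expD I m n a b :
  ideal_exp I m a -> ideal_exp I n b -> ideal_exp I (m + n) (a * b).
Proof.
elim: m a b => [|m IHm] a b Ia Ib.
  by case: (ideal_exp_ideal I n) => _ _; apply.
apply: (Ia [set z | ideal_exp I (m.+1 + n) (z * b)]).
have [J0 JD JM] := ideal_exp_ideal I (m.+1 + n).
split=> [|_ [c [d [Ic Id ->]]]].
  split=> /= [|c d|c d]; first by rewrite mul0r.
  - by rewrite mulrDl; exact: JD.
  - by rewrite -mulrA; exact: JM.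
rewrite /= -mulrA => K [_]; apply; exists c, (d * b); split=> //.
exact: IHm.
Qed.

Lemma max_ideal_proper : is_ideal (max_ideal T) /\ ~ max_ideal T 1.
Proof.
rewrite /max_ideal; case: xgetP => [M _ [? ? _] //|_]; split.
  split=> //= [a b -> ->|a b ->]; first by rewrite addr0.
  by rewrite mulr0.
by move/eqP; rewrite oner_eq0.
Qed.

End IdealTheory.

(* gr T is the direct sum of the m^n / m^(n+1), realized as the quotient of the
   Rees algebra (the polynomials over T whose n-th coefficient is in m^n) by
   the ideal of the polynomials whose n-th coefficient is in m^(n+1). *)

Section AssociatedGraded.
Variable T : comNzRingType.
Local Notation m := (max_ideal T).

Definition rees_pred : {pred {poly T}} :=
  fun p => `[< forall n, ideal_exp m n p`_n >].

Lemma rees_subring : subring_closed rees_pred.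
Proof.
split=> [|p q /asboolP hp /asboolP hq|p q /asboolP hp /asboolP hq];
  apply/asboolP=> n.
- by rewrite coef1; case: n => [|n] //=; case: (ideal_exp_ideal m n.+1).
- have [_ JD JM] := ideal_exp_ideal m n.
  by rewrite coefB -mulN1r; apply: JD => //; exact: JM.
- rewrite coefM; have [J0 JD _] := ideal_exp_ideal m n.
  apply: (big_ind (ideal_exp m n) J0 JD) => i _.
  by have := ideal_expD (hp i) (hq (n - i)%N); rewrite subnKC// -ltnS.
Qed.

HB.instance Definition _ :=
  GRing.isSubringClosed.Build {poly T} rees_pred rees_subring.

Record rees := Rees { rees_val : {poly T}; _ : rees_val \in rees_pred }.
HB.instance Definition _ := [isSub for rees_val].
HB.instance Definition _ := [Choice of rees by <:].
HB.instance Definition _ := [SubChoice_isSubComNzRing of rees by <:].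

Definition rees_plus : {pred rees} :=
  fun p => `[< forall n, ideal_exp m n.+1 (val p)`_n >].

Lemma rees_plus_ideal : idealr_closed rees_plus.
Proof.
split=> [||a p q /asboolP hp /asboolP hq].
- by apply/asboolP=> n; rewrite raddf0 coef0; case: (ideal_exp_ideal m n.+1).
- apply/negP => /asboolP /(_ 0%N); rewrite rmorph1 coef1 /= => h1.
  have [[m0 mD mM] m1] := max_ideal_proper T; apply: m1.
  apply: h1; split=> // _ [c [d [mc _ ->]]].
  by rewrite mulrC; exact: mM.
apply/asboolP=> n; have [J0 JD _] := ideal_exp_ideal m n.+1.
rewrite rmorphD rmorphM coefD; apply: (JD) => //.
have /asboolP ha : rees_pred (val a) by exact: (valP a).
rewrite coefM; apply: (big_ind (ideal_exp m n.+1) J0 JD) => i _.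
by have := ideal_expD (ha i) (hp (n - i)%N); rewrite addnS subnKC// -ltnS.
Qed.

HB.instance Definition _ := isIdealr.Build rees rees_plus rees_plus_ideal.

Definition gr : comNzRingType := {ideal_quot rees_plus}.

(* meaningful only for a in m^n: its class in m^n / m^(n+1) *)
Definition gr_class (n : nat) (a : T) : gr :=
  \pi_gr%qT (insubd (0 : rees) (a *: 'X^n)).

Definition gr_component (n : nat) (z : gr) : gr :=
  gr_class n (val (repr z : rees))`_n.

Definition is_homogeneous_ideal (I : set gr) : Prop :=
  forall n z, I z -> I (gr_component n z).

Definition hom_primes : set (set gr) :=
  [set p | [/\ is_prime p, is_homogeneous_ideal p & has_height p 1]].

Definition deg (p : set gr) : nat :=
  xget 0%N [set n | exists2 h, ideal_exp m n h & p = principal (gr_class n h)].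

Definition ord (f : T) : nat :=
  xget 0%N [set n | ideal_exp m n f /\ ~ ideal_exp m n.+1 f].

Definition initial_form (f : T) : gr := gr_class (ord f) f.

Definition ord_ideal (I : set T) : nat :=
  xget 0%N [set n | (exists a, [/\ I a, a <> 0 & ord a = n]) /\
                    (forall a, I a -> a <> 0 -> (n <= ord a)%N)].

End AssociatedGraded.

Arguments gr T : clear implicits.
Arguments hom_primes T : clear implicits.

Section Subrings.
Variable K : fieldType.

Record subring := Subring {
  subring_set : set K;
  subring_setP :
    [/\ subring_set 1,
        forall a b, subring_set a -> subring_set b -> subring_set (a - b) &
        forall a b, subring_set a -> subring_set b -> subring_set (a * b)] }.

HB.instance Definition _ := gen_eqMixin subring.
HB.instance Definition _ := gen_choiceMixin subring.

Lemma subring_inj : injective subring_set.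
Proof.
by case=> A hA [B hB] /= eAB; case: _ / eAB in hB *; rewrite (Prop_irrelevance hA hB).
Qed.

Section Elements.
Variable S : subring.

Definition subring_pred : {pred K} := fun a => `[< subring_set S a >].

Lemma subring_predP : subring_closed subring_pred.
Proof.
have [S1 SB SM] := subring_setP S.
split=> [|a b /asboolP ha /asboolP hb|a b /asboolP ha /asboolP hb];
  by apply/asboolP; auto.
Qed.

HB.instance Definition _ :=
  GRing.isSubringClosed.Build K subring_pred subring_predP.

Record subring_elt := SubringElt {
  subring_val : K; _ : subring_val \in subring_pred }.
HB.instance Definition _ := [isSub for subring_val].
HB.instance Definition _ := [Choice of subring_elt by <:].
HB.instance Definition _ := [SubChoice_isSubComNzRing of subring_elt by <:].

End Elements.

End Subrings.

Coercion subring_elt : subring >-> Sortclass.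

Section QuadraticTransforms.
Variable K : fieldType.
Implicit Types (R S T : subring K).

Definition has_quotient_field R : Prop :=
  forall z : K, exists a b : R, b <> 0 /\ z = val a / val b.

(* the valuation ring of the extension of ord_R to the quotient field *)
Definition order_valuation_ring R : set K :=
  [set z | z = 0 \/ exists a b : R,
     [/\ a <> 0, b <> 0, z = val a / val b & (ord b <= ord a)%N]].

Definition adjoin R (z : K) : set K :=
  [set (map_poly val q).[z] | q in [set: {poly R}]].

(* A_(u, v), the localization of A at the prime ideal (u, v) *)
Definition localize_at (A : set K) (u v : K) : set K :=
  [set z | exists a b, [/\ A a, A b,
     ~ (exists c e, [/\ A c, A e & b = u * c + v * e]) & z = a / b]].

Definition is_quadratic_transform R (p : set (gr R)) S : Prop :=
  exists (x y h : R) (m : nat),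
    [/\ regular_parameters x y, ideal_exp (max_ideal R) m h,
        p = principal (gr_class m h),
        ~ principal (gr_class 1 x) (gr_class m h) &
        subring_set S =
          localize_at (adjoin R (val y / val x)) (val x) (val h / val x ^+ m)].

(* S_p; the choice of x, y and h does not matter *)
Definition quadratic_transform R (p : set (gr R)) : subring K :=
  xget R [set S | is_quadratic_transform p S].

Definition quadratic_step R S : Prop :=
  exists2 p, hom_primes R p & S = quadratic_transform p.

Fixpoint neighbourhood R (i : nat) : set (subring K) :=
  if i is i'.+1 then
    [set T | exists2 S, neighbourhood R i' S & quadratic_step S T]
  else [set R].

Definition infinitely_near R : set (subring K) :=
  \bigcup_i neighbourhood R i.

Definition is_quadratic_sequence R (p : set (gr R)) (u : nat -> subring K) :=
  [/\ u 0%N = R, u 1%N = quadratic_transform p,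
      forall i, quadratic_step (u i) (u i.+1),
      forall i, subring_set (u i) `<=` subring_set (u i.+1) &
      forall i, subring_set (u i) `<=` order_valuation_ring R].

Definition quadratic_sequence R (p : set (gr R)) : set (subring K) :=
  [set T | exists u i, is_quadratic_sequence p u /\ T = u i].

(* The dimension [k_S : k_R]: the classes of the b i form a basis of the
   residue field of S over that of R, their linear combinations being computed
   on representatives in the field K. *)
Definition residue_basis R S (d : nat) (b : 'I_d -> S) : Prop :=
  (forall z : S, exists (a : 'I_d -> R) (t : S),
     max_ideal S t /\ val z = \sum_(i < d) val (a i) * val (b i) + val t) /\
  (forall (a : 'I_d -> R) (t : S), max_ideal S t ->
     val t = \sum_(i < d) val (a i) * val (b i) ->
     forall i, max_ideal R (a i)).

Definition residue_degree R S : nat :=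
  xget 0%N [set d | exists b : 'I_d -> S, residue_basis R b].

(* Ideals are handled as subsets of K here, so that those of different rings
   R, S, T can be compared. *)
Definition fractional_principal S (g : K) : set K :=
  [set g * val t | t in [set: S]].

(* I T, for I an ideal of S and S a subring of T *)
Definition ideal_extension S T (I : set S) : set T :=
  ideal_gen [set t : T | exists2 a, I a & val t = val a].
Arguments ideal_extension {S} T I.

(* the ideal x^(- ord_S g) g T, for J = gS and m_S T = xT *)
Definition strict_transform_step S T (J : set K) : set K :=
  [set z | exists (g : S) (x : T),
     [/\ J = fractional_principal S (val g),
         ideal_extension T (max_ideal S) = principal x &
         fractional_principal T (val x ^- ord g * val g) z]].

Inductive strict_transform_chain R (J : set K) : subring K -> set K -> Prop :=
| StrictTransformRefl : strict_transform_chain R J R J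
| StrictTransformStep S T J' :
    strict_transform_chain R J S J' -> quadratic_step S T ->
    strict_transform_chain R J T (strict_transform_step S T J').

(* (fR)^S, computed along the unique chain of quadratic transforms from R to S *)
Definition strict_transform R (f : R) S : set K :=
  xget set0 [set J |
    strict_transform_chain R (fractional_principal R (val f)) S J].

(* ord_S of an ideal of S given as a subset of K *)
Definition ord_at S (J : set K) : nat := ord_ideal [set a : S | J (val a)].

End QuadraticTransforms.

(* Main.v *)
Require Import Defs.
From HB Require Import structures.
From mathcomp Require Import all_boot all_order all_algebra.
From mathcomp Require Import generic_quotient ring_quotient.
From mathcomp Require Import boolp classical_sets cardinality fsbigop.
From mathcomp Require Import ring zify.

Set Implicit Arguments.
Unset Strict Implicit.
Unset Printing Implicit Defensive.

Import GRing.Theory.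
Local Open Scope classical_set_scope.
Local Open Scope ring_scope.

(* Write T_p for the quadratic transform at p of a two-dimensional regular local
   ring T.  The quasi-regularity of a system of parameters x, y (a form in
   x, y of degree n lies in m^(n+1) only if its coefficients lie in m) makes
   gr T a polynomial ring over the residue field, and T_p is intrinsically
   the set of the fractions a/b with a, b in m^n and the class of b outside p.
   If p is generated by the class of h in m^d and x is not in p, then
   (x, h/x^d) is again a quasi-regular system of parameters of T_p.

   The rings of the quadratic sequence determined by p are R_1 = R_p,
   R_2, ..., where R_i has parameters (X/W^(i-1), W); here X = x is an
   equation of the exceptional curve and W = h/x^d: a transform of R_i in any
   other direction contains W^i/X, which is not in V_R.
   If In f = h^c g with g outside p, then f/x^(ord f) = u W^c + X r in R_1 with
   u a unit.  Dividing by W^o, where o is the order of the strict transform,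
   replaces c by c - o and X by X/W, and o > 0 as long as c > 0; hence the
   orders add up to c.  Comparing degrees in In f gives the first formula. *)

(** * Ideals and forms *)

(** The property carried along the chains is [regular2], in place of [regular_local_ring2]. The
    Noetherian property and the Krull dimension are exploited once, at R, to get quasi-regular
    parameters and separation; a transform inherits these by computing with fractions, whereas the
    chain conditions would have to be re-established by other means. A second obstacle is choice:
    [quadratic_transform], [strict_transform], [deg] and [residue_degree] are picked by [xget], so
    each needs a uniqueness statement. For the transform it is the description by fractions, which
    mentions no parameters; for the strict transform it is the uniqueness of the chain, which holds
    because two distinct transforms of a ring are never dominated by the same ring. Finally the sums
    range over rings, not over indices: the rings of the sequence must be distinct and almost all
    orders zero. Since the recursion retains only the exponent c of W, and c drops at every step
    until it is 0, the first c rings of the sequence after R carry the whole sum. *)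

Section IdealFacts.
Variable T : comNzRingType.
Implicit Types (I J N : set T) (a b c x y : T).

Lemma ideal0 I : is_ideal I -> I 0. Proof. by case. Qed.
Lemma idealD I a b : is_ideal I -> I a -> I b -> I (a + b).
Proof. by case=> _ + _; apply. Qed.
Lemma ideal_mull I a b : is_ideal I -> I b -> I (a * b).
Proof. by case=> _ _; apply. Qed.
Lemma ideal_mulr I a b : is_ideal I -> I a -> I (a * b).
Proof. by rewrite mulrC; exact: ideal_mull. Qed.
Lemma idealN I a : is_ideal I -> I a -> I (- a).
Proof. by rewrite -mulN1r; exact: ideal_mull. Qed.
Lemma idealB I a b : is_ideal I -> I a -> I b -> I (a - b).
Proof. by move=> hI ha hb; apply: idealD => //; exact: idealN. Qed.
Lemma idealBr I a b : is_ideal I -> I (a - b) -> I b -> I a.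
Proof. by move=> hI ha hb; rewrite -(subrK b a); exact: idealD. Qed.
Lemma idealDr I a b : is_ideal I -> I (a + b) -> I b -> I a.
Proof. by move=> hI ha hb; rewrite -(addrK b a); exact: idealB. Qed.
Lemma ideal_sum I (r : Type) (s : seq r) (P : pred r) (F : r -> T) :
  is_ideal I -> (forall i, P i -> I (F i)) -> I (\sum_(i <- s | P i) F i).
Proof.
by move=> hI hF; apply: big_ind => //; [exact: ideal0|move=> *; exact: idealD].
Qed.

Lemma sub_ideal_gen (A : set T) : A `<=` ideal_gen A.
Proof. by move=> a Aa J [_ AJ]; exact: AJ. Qed.

Lemma ideal_gen_min (J A : set T) : is_ideal J -> A `<=` J -> ideal_gen A `<=` J.
Proof. by move=> hJ AJ a; apply. Qed.

Lemma principal_ideal a : is_ideal (principal a).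
Proof.
split; first by exists 0 => //; rewrite mulr0.
- by move=> _ _ [b _ <-] [c _ <-]; exists (b + c) => //; rewrite mulrDr.
- by move=> b _ [c _ <-]; exists (b * c) => //; rewrite mulrCA.
Qed.

Lemma principal_self a : principal a a.
Proof. by exists 1 => //; rewrite mulr1. Qed.

Lemma principal_sub I a : is_ideal I -> I a -> principal a `<=` I.
Proof. by move=> hI ha _ [b _ <-]; exact: ideal_mulr. Qed.

Lemma ideal_gen2P x y a :
  ideal_gen [set x; y] a <-> exists b c, a = b * x + c * y.
Proof.
split=> [|[b [c ->]]]; last first.
  have hI := ideal_gen_ideal [set x; y].
  by apply: (idealD hI); apply: (ideal_mull _ hI); apply: sub_ideal_gen; [left|right].
apply: (@ideal_gen_min [set a | exists b c, a = b * x + c * y]); last first.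
  move=> _ [->|->]; first by exists 1, 0; rewrite mul1r mul0r addr0.
  by exists 0, 1; rewrite mul1r mul0r add0r.
split; first by exists 0, 0; rewrite !mul0r addr0.
- by move=> _ _ [b [c ->]] [d [e ->]]; exists (b + d), (c + e); ring.
- by move=> e _ [b [c ->]]; exists (e * b), (e * c); ring.
Qed.

Lemma ideal_exp0 I a : ideal_exp I 0 a. Proof. exact: Logic.I. Qed.

Lemma ideal_expW I n a : ideal_exp I n.+1 a -> ideal_exp I n a.
Proof.
apply: (@ideal_gen_min (ideal_exp I n)); first exact: ideal_exp_ideal.
by move=> _ [b [c [_ hc ->]]]; apply: ideal_mull => //; exact: ideal_exp_ideal.
Qed.

Lemma ideal_exp_le I m n a : (m <= n)%N -> ideal_exp I n a -> ideal_exp I m a.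
Proof.
move=> /subnK <-; elim: (n - m)%N => // k IH; rewrite addSn => h.
by apply: IH; exact: ideal_expW.
Qed.

Lemma ideal_exp1 I a : is_ideal I -> ideal_exp I 1 a <-> I a.
Proof.
move=> hI; split=> [|Ia]; last first.
  by apply: sub_ideal_gen; exists a, 1; rewrite mulr1.
by apply: (@ideal_gen_min I) => // _ [b [c [hb _ ->]]]; exact: ideal_mulr.
Qed.

Lemma ideal_expMS I n a b : I a -> ideal_exp I n b -> ideal_exp I n.+1 (a * b).
Proof. by move=> ha hb; apply: sub_ideal_gen; exists a, b. Qed.

Lemma ideal_expX I n k a : ideal_exp I n a -> ideal_exp I (n * k) (a ^+ k).
Proof.
move=> ha; elim: k => [|k IH]; first by rewrite muln0; exact: ideal_exp0.
by rewrite mulnS exprS; exact: ideal_expD.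
Qed.

Lemma ideal_exp_X I k a : I a -> ideal_exp I k (a ^+ k).
Proof.
move=> ha; elim: k => [|k IH]; first exact: ideal_exp0.
by rewrite exprS; exact: ideal_expMS.
Qed.

Lemma ideal_unit I a : is_ideal I -> I a -> is_unit a -> I 1.
Proof. by move=> hI Ia [b <-]; exact: ideal_mulr. Qed.

End IdealFacts.

Section Forms.
Variable T : comNzRingType.
Implicit Types (x y : T) (c d : nat -> T).

(** The coefficients are a function on all of [nat], ignored past n, so that shifting or truncating
    them needs no dependent index. *)
Definition binform x y n c : T := \sum_(i < n.+1) c i * (x ^+ (n - i) * y ^+ i).

Lemma formS_l x y n c :
  binform x y n.+1 c = x * binform x y n c + c n.+1 * y ^+ n.+1.
Proof.
rewrite /binform big_ord_recr /= subnn expr0 mul1r mulr_sumr; congr (_ + _).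
apply: eq_bigr => i _; rewrite subSn -1?ltnS// exprS; ring.
Qed.

Lemma form_rev x y n c : binform x y n c = binform y x n (fun i => c (n - i)%N).
Proof.
rewrite /binform (reindex_inj rev_ord_inj) /=; apply: eq_bigr => i _.
by rewrite subSS subKn -1?ltnS// [y ^+ _ * _]mulrC.
Qed.

Lemma formD x y n c d :
  binform x y n c + binform x y n d = binform x y n (fun i => c i + d i).
Proof. by rewrite -big_split; apply: eq_bigr => i _; rewrite mulrDl. Qed.

Lemma formZ x y n a c : a * binform x y n c = binform x y n (fun i => a * c i).
Proof. by rewrite mulr_sumr; apply: eq_bigr => i _; rewrite mulrA. Qed.

Lemma form_last x y n a :
  binform x y n (fun i => if i == n then a else 0) = a * y ^+ n.
Proof.
rewrite /binform big_ord_recr /= eqxx subnn mul1r big1 ?add0r// => i _.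
by rewrite ltn_eqF ?mul0r.
Qed.

Lemma eq_form x y n c d :
  (forall i, (i <= n)%N -> c i = d i) -> binform x y n c = binform x y n d.
Proof. by move=> h; apply: eq_bigr => i _; rewrite h // -ltnS. Qed.

Lemma formMx x y n c :
  x * binform x y n c = binform x y n.+1 (fun i => if (i <= n)%N then c i else 0).
Proof.
rewrite formS_l ltnn mul0r addr0; congr (_ * _).
by apply: eq_form => i ->.
Qed.

Lemma formMy x y n c :
  y * binform x y n c = binform x y n.+1 (fun i => if i is j.+1 then c j else 0).
Proof.
rewrite form_rev formMx [RHS]form_rev; apply: eq_form => i hi.
case: ifP => h; first by rewrite subSn.
by have -> : (n.+1 - i)%N = 0%N by lia.
Qed.

Lemma mul_form x y a b n c : exists d,
  (a * x + b * y) * binform x y n c = binform x y n.+1 d.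
Proof.
rewrite mulrDl -!mulrA formMx formMy !formZ formD.
by eexists.
Qed.

Lemma ideal_exp_formP (I : set T) x y n a : I = ideal_gen [set x; y] ->
  ideal_exp I n a <-> exists c, a = binform x y n c.
Proof.
move=> hI; have Ii : is_ideal I by rewrite hI; exact: ideal_gen_ideal.
have Ix : I x by rewrite hI; apply: sub_ideal_gen; left.
have Iy : I y by rewrite hI; apply: sub_ideal_gen; right.
split=> [|[c ->]]; last first.
  apply: ideal_sum => [|i _]; first exact: ideal_exp_ideal.
  apply: ideal_mull; first exact: ideal_exp_ideal.
  rewrite -{1}(@subnK i n) -1?ltnS//.
  by apply: ideal_expD; exact: ideal_exp_X.
elim: n a => [|n IH] a.
  by exists (fun=> a); rewrite /binform big_ord1 !expr0 !mulr1.
apply: (@ideal_gen_min _ [set a | exists c, a = binform x y n.+1 c]).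
  split; first by exists (fun=> 0); rewrite /binform big1 // => i _; rewrite mul0r.
  - by move=> _ _ [c ->] [d ->]; rewrite formD; eexists.
  - by move=> b _ [c ->]; rewrite formZ; eexists.
move=> _ [b [c [hb /IH [d ->] ->]]].
move: hb; rewrite hI => /ideal_gen2P [e [f ->]].
by have [g ->] := mul_form x y e f n d; exists g.
Qed.

(** A form of degree n in the next power is also a form of degree n+1. One factor of each monomial
    of the latter moves into its coefficient, x whenever possible and y for the pure power of y;
    subtracting leaves a form of degree n that is exactly zero. *)
Lemma form_absorb (I : set T) x y n c : I = ideal_gen [set x; y] ->
  ideal_exp I n.+1 (binform x y n c) ->
  exists2 d, binform x y n d = 0 & forall i, I (c i - d i).
Proof.
move=> hI; have Ii : is_ideal I by rewrite hI; exact: ideal_gen_ideal.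
have Ix : I x by rewrite hI; apply: sub_ideal_gen; left.
have Iy : I y by rewrite hI; apply: sub_ideal_gen; right.
move/(ideal_exp_formP _ _ hI) => [d hd].
exists (fun i => c i - (d i * x + (if i == n then d n.+1 * y else 0))).
  rewrite (@eq_form _ _ _ _ (fun i => c i + -1 *
    (d i * x + (if i == n then d n.+1 * y else 0)))) => [|i _]; last by rewrite mulN1r.
  rewrite -formD -formZ -formD form_last hd formS_l mulN1r exprS.
  rewrite (_ : binform x y n (fun i => d i * x) = x * binform x y n d); last first.
    by rewrite formZ; apply: eq_form => i _; rewrite mulrC.
  by rewrite mulrA subrr.
move=> i; rewrite opprB addrC subrK; apply: idealD => //; first exact: ideal_mull.
by case: eqP => _; [exact: ideal_mull|exact: ideal0].
Qed.

Definition quasi_regular (I : set T) x y :=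
  forall n c, ideal_exp I n.+1 (binform x y n c) -> forall i, (i <= n)%N -> I (c i).

Lemma quasi_regularC (I : set T) x y :
  quasi_regular I x y -> quasi_regular I y x.
Proof.
move=> h n c hc i hi; move: hc; rewrite form_rev => /h /(_ (n - i)%N (leq_subr _ _)).
by rewrite subKn.
Qed.

Lemma form_mem (I : set T) x y n c : I = ideal_gen [set x; y] ->
  (forall i, (i <= n)%N -> I (c i)) -> ideal_exp I n.+1 (binform x y n c).
Proof.
move=> hI hc; apply: ideal_sum => [|i _]; first exact: ideal_exp_ideal.
apply: ideal_expMS; first by apply: hc; rewrite -ltnS.
have hi : (i <= n)%N by rewrite -ltnS.
rewrite -{1}(subnK hi); apply: ideal_expD; apply: ideal_exp_X; rewrite hI.
  by apply: sub_ideal_gen; left.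
by apply: sub_ideal_gen; right.
Qed.

(** The class of x is a non-zero-divisor of the graded ring: multiplying a form by x only appends a
    zero coefficient, so quasi-regularity applied to x b puts the coefficients of b in I. *)
Lemma quasi_regular_mulx (I : set T) x y n b : I = ideal_gen [set x; y] ->
  quasi_regular I x y -> ideal_exp I n.+1 (x * b) -> ideal_exp I n b.
Proof.
move=> hI qr; elim: n => [|n IH] hb; first exact: ideal_exp0.
have [c ec] := (ideal_exp_formP n b hI).1 (IH (ideal_expW hb)).
rewrite ec; apply: form_mem => // i hi.
by move: hb; rewrite ec formMx => /qr /(_ i (leqW hi)); rewrite hi.
Qed.

(** Bounds orders from above: u y^n + x r has order at most n when u is outside I. For n > 0,
    cancelling x makes r a form of degree n-1, and then u is the last coefficient of a form of
    degree n. *)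
Lemma quasi_regular_last (I : set T) x y n u r : I = ideal_gen [set x; y] ->
  quasi_regular I x y -> ideal_exp I n.+1 (u * y ^+ n + x * r) -> I u.
Proof.
move=> hI qr; have Ii : is_ideal I by rewrite hI; exact: ideal_gen_ideal.
have Ix : I x by rewrite hI; apply: sub_ideal_gen; left.
have Iy : I y by rewrite hI; apply: sub_ideal_gen; right.
case: n => [|n h].
  by move/(ideal_exp1 _ Ii); rewrite mulr1 => /(idealDr Ii); apply; exact: ideal_mulr.
have eI := ideal_exp_ideal I n.+1.
have /(quasi_regular_mulx hI qr) : ideal_exp I n.+1 (x * r).
  rewrite -[x * r](addKr (u * y ^+ n.+1)); apply: (idealD eI); last exact: ideal_expW.
  by apply: (idealN eI); apply: (ideal_mull _ eI); exact: ideal_exp_X.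
move=> /(ideal_exp_formP _ _ hI) [e er]; move: h; rewrite er addrC => h.
pose e' i := if (i <= n)%N then e i else u.
have := qr n.+1 e' _ n.+1 (leqnn _); rewrite /e' ltnn; apply.
rewrite formS_l ltnn; rewrite (@eq_form _ _ _ _ e) // => i ->.
by [].
Qed.

(** [form_absorb] reduces to forms that vanish. There x divides the coefficient of the pure power of
    y; its quotient by x is merged into the preceding coefficient, and cancelling x lowers the
    degree. *)
Lemma regular_sequence_quasi_regular (I : set T) x y :
  I = ideal_gen [set x; y] ->
  (forall z, x * z = 0 -> z = 0) ->
  (forall z, principal x (y * z) -> principal x z) ->
  quasi_regular I x y.
Proof.
move=> hI hx hy n c; have Ii : is_ideal I by rewrite hI; exact: ideal_gen_ideal.
have Ix : I x by rewrite hI; apply: sub_ideal_gen; left.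
have Iy : I y by rewrite hI; apply: sub_ideal_gen; right.
move/(form_absorb hI) => [d hd cd] i hi.
apply: (idealBr Ii (cd i)) => {c cd}.
have hyk k z : principal x (y ^+ k * z) -> principal x z.
  elim: k z => [|k IH] z; first by rewrite mul1r.
  by rewrite exprS -mulrA => /hy /IH.
elim: n d hd i hi => [|n IH] d.
  rewrite /binform big_ord1 !mulr1 => d0 [|//] _; rewrite d0; exact: ideal0.
rewrite formS_l => hd.
have [e _ he] : principal x (d n.+1).
  apply: (hyk n.+1); exists (- binform x y n d) => //.
  by apply/eqP; rewrite mulrN eq_sym -addr_eq0 addrC [_ ^+ _ * _]mulrC hd.
have h0 : binform x y n (fun i => d i + (if i == n then e * y else 0)) = 0.
  apply: hx; rewrite -formD mulrDr -[RHS]hd; congr (_ + _).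
  by rewrite form_last exprS -he; ring.
move=> i; rewrite leq_eqVlt => /orP [/eqP ->|]; first by rewrite -he; exact: ideal_mulr.
rewrite ltnS => hi; have /= := IH _ h0 i hi.
move=> /idealDr; apply => //.
by case: eqP => _; [exact: ideal_mull|exact: ideal0].
Qed.

End Forms.

(** * The associated graded ring *)

Section AssociatedGradedRing.
Variable T : comNzRingType.
Local Notation m := (max_ideal T).
Local Notation mexp := (ideal_exp (max_ideal T)).
Local Notation cl := (@gr_class T).
Implicit Types (a b : T) (n k : nat) (z : gr T).

Lemma max_ideal_ideal : is_ideal m. Proof. by case: (max_ideal_proper T). Qed.
Lemma max_ideal_not1 : ~ m 1. Proof. by case: (max_ideal_proper T). Qed.
Lemma mexp_ideal n : is_ideal (mexp n). Proof. exact: ideal_exp_ideal. Qed.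
Hint Resolve max_ideal_ideal mexp_ideal : core.
Lemma mexp1 a : mexp 1 a <-> m a. Proof. exact: ideal_exp1. Qed.

Lemma gr_piP (P Q : rees T) : \pi_(gr T)%qT P = \pi_(gr T)%qT Q <->
  forall n, mexp n.+1 ((val P)`_n - (val Q)`_n).
Proof.
split=> [/eqP|h].
  rewrite -Quotient.idealrBE => /asboolP h n; have := h n.
  by rewrite rmorphB coefB.
apply/eqP; rewrite -Quotient.idealrBE; apply/asboolP => n.
by rewrite rmorphB coefB.
Qed.

Lemma rees_coef (P : rees T) n : mexp n (val P)`_n.
Proof. by have /asboolP := valP P; apply. Qed.

Lemma rees_monomial n a : mexp n a -> a *: 'X^n \in @rees_pred T.
Proof.
move=> ha; apply/asboolP => i; rewrite coefZ coefXn.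
by case: eqP => [->|_]; [rewrite mulr1|rewrite mulr0; exact: ideal0].
Qed.

Lemma gr_classE n a (ha : mexp n a) : cl n a = \pi_(gr T)%qT (Rees (rees_monomial ha)).
Proof.
congr (\pi_ _ _)%qT; apply: val_inj.
by rewrite /= insubdK //; exact: rees_monomial.
Qed.

Lemma gr_class_val n a : mexp n a ->
  exists2 P : rees T, cl n a = \pi_(gr T)%qT P & val P = a *: 'X^n.
Proof. by move=> ha; exists (Rees (rees_monomial ha)) => //; exact: gr_classE. Qed.

Lemma gr_class_eq n a b : mexp n a -> mexp n b ->
  cl n a = cl n b <-> mexp n.+1 (a - b).
Proof.
move=> /gr_class_val [P -> hP] /gr_class_val [Q -> hQ]; rewrite gr_piP hP hQ.
split=> [/(_ n)|h k]; first by rewrite !coefZ coefXn eqxx !mulr1.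
rewrite !coefZ coefXn; case: eqP => [->|_]; first by rewrite !mulr1.
by rewrite !mulr0 subr0; exact: ideal0.
Qed.

Lemma gr_class0 n : cl n 0 = 0.
Proof.
have [P -> hP] := gr_class_val (ideal0 (mexp_ideal n)).
have <- : \pi_(gr T)%qT (0 : rees T) = 0 by exact: rmorph0.
rewrite gr_piP hP scale0r => k.
by rewrite raddf0 coef0 subr0; exact: ideal0.
Qed.

Lemma gr_class_eq0 n a : mexp n a -> cl n a = 0 <-> mexp n.+1 a.
Proof.
by move=> ha; rewrite -(gr_class0 n) gr_class_eq ?subr0//; exact: ideal0.
Qed.

Lemma gr_classD n a b : mexp n a -> mexp n b -> cl n (a + b) = cl n a + cl n b.
Proof.
move=> ha hb; have [P -> hP] := gr_class_val (idealD (mexp_ideal n) ha hb).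
move: ha hb => /gr_class_val [Q -> hQ] /gr_class_val [U -> hU].
rewrite -rmorphD; congr (\pi_ _ _)%qT; apply: val_inj.
by rewrite rmorphD /= hP hQ hU scalerDl.
Qed.

Lemma gr_classN n a : mexp n a -> cl n (- a) = - cl n a.
Proof.
move=> ha; apply/eqP; rewrite -addr_eq0 -gr_classD ?addNr ?gr_class0//.
exact: idealN.
Qed.

Lemma gr_classB n a b : mexp n a -> mexp n b -> cl n (a - b) = cl n a - cl n b.
Proof. by move=> ha hb; rewrite gr_classD ?gr_classN//; exact: idealN. Qed.

Lemma gr_classM n k a b : mexp n a -> mexp k b ->
  cl (n + k) (a * b) = cl n a * cl k b.
Proof.
move=> ha hb; have [P -> hP] := gr_class_val (ideal_expD ha hb).
move: ha hb => /gr_class_val [Q -> hQ] /gr_class_val [U -> hU].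
rewrite -rmorphM; congr (\pi_ _ _)%qT; apply: val_inj.
by rewrite rmorphM /= hP hQ hU -scalerAl -scalerAr scalerA exprD.
Qed.

Lemma gr_class1 : cl 0 1 = 1.
Proof.
have [P -> hP] := gr_class_val (ideal_exp0 m 1).
have <- : \pi_(gr T)%qT (1 : rees T) = 1 by exact: rmorph1.
congr (\pi_ _ _)%qT; apply: val_inj.
by rewrite hP rmorph1 scale1r.
Qed.

Lemma gr_classX n k a : mexp n a -> cl (n * k) (a ^+ k) = cl n a ^+ k.
Proof.
move=> ha; elim: k => [|k IH]; first by rewrite muln0 !expr0 gr_class1.
by rewrite mulnS !exprS gr_classM ?IH//; exact: ideal_expX.
Qed.

(** Depends on the representative chosen by [repr]; only its class modulo the next power is
    meaningful, by [gr_component_pi]. *)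
Definition gr_coef n z : T := (val (repr z : rees T))`_n.

Lemma gr_coefP n z : mexp n (gr_coef n z).
Proof. exact: rees_coef. Qed.

Lemma gr_componentE n z : gr_component n z = cl n (gr_coef n z).
Proof. by []. Qed.

Lemma gr_component_pi n (P : rees T) :
  gr_component n (\pi_(gr T)%qT P) = cl n (val P)`_n.
Proof.
have := reprK (\pi_(gr T)%qT P) => /gr_piP h.
by apply/gr_class_eq => //; exact: rees_coef.
Qed.

Lemma gr_componentD n z z' :
  gr_component n (z + z') = gr_component n z + gr_component n z'.
Proof.
rewrite -[z]reprK -[z']reprK -rmorphD !gr_component_pi rmorphD /= coefD.
by rewrite gr_classD //; exact: rees_coef.
Qed.

Lemma gr_component_class n k a : mexp k a ->
  gr_component n (cl k a) = if n == k then cl k a else 0.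
Proof.
move=> ha; have [P e hP] := gr_class_val ha.
rewrite {1}e gr_component_pi hP coefZ coefXn; case: eqP => [->|_].
  by rewrite mulr1.
by rewrite mulr0 gr_class0.
Qed.

Lemma gr_component0 n : gr_component n (0 : gr T) = 0.
Proof.
have := gr_component_class n (ideal0 (mexp_ideal 0)).
by rewrite gr_class0 if_same.
Qed.

Lemma gr_component_mul n k a z : mexp k a ->
  gr_component n (cl k a * z) =
    if (k <= n)%N then cl k a * gr_component (n - k) z else 0.
Proof.
move=> ha; have [P e hP] := gr_class_val ha.
rewrite {1}e -{1}[z]reprK -rmorphM gr_component_pi rmorphM /= hP.
rewrite -scalerAl coefZ coefXnM; case: ltnP => h.
  by rewrite mulr0 gr_class0.
by have <- := gr_classM ha (gr_coefP (n - k) z); rewrite subnKC.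
Qed.

Lemma gr_component_ext z z' :
  (forall n, gr_component n z = gr_component n z') -> z = z'.
Proof.
move=> h; rewrite -[z]reprK -[z']reprK; apply/gr_piP => n.
by apply/gr_class_eq; [exact: rees_coef|exact: rees_coef|exact: h].
Qed.

Lemma gr_sum z : z =
  \sum_(i < size (val (repr z : rees T))) gr_component i z.
Proof.
apply: gr_component_ext => n.
have hs (N : nat) : gr_component n (\sum_(i < N) gr_component i z) =
    if (n < N)%N then gr_component n z else 0.
  elim: N => [|N IH].
    by rewrite big_ord0 gr_component0.
  rewrite big_ord_recr /= gr_componentD IH (gr_component_class _ (gr_coefP _ _)) ltnS.
  by case: ltngtP => [h|h|->]; rewrite ?addr0 ?add0r.
rewrite hs; case: ltnP => // h.
by rewrite gr_componentE /gr_coef nth_default // gr_class0.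
Qed.

Lemma homogeneous_ideal_mem (I : set (gr T)) z : is_ideal I ->
  (forall n, I (gr_component n z)) -> I z.
Proof. by move=> hI h; rewrite [z]gr_sum; apply: ideal_sum. Qed.

(* The top-degree components of z and z' outside I multiply to a component of
   z * z' modulo I. *)
Lemma homogeneous_prime (I : set (gr T)) : is_ideal I -> is_homogeneous_ideal I ->
  ~ I 1 ->
  (forall n k a b, mexp n a -> mexp k b -> I (cl (n + k) (a * b)) ->
     I (cl n a) \/ I (cl k b)) -> is_prime I.
Proof.
move=> hI homI I1 h; split=> // z z' Izz'.
have top y : ~ I y -> exists2 n, ~ I (gr_component n y) &
    forall k, (n < k)%N -> I (gr_component k y).
  move=> Iy; pose s := size (val (repr y : rees T)).
  have big k : (s <= k)%N -> I (gr_component k y).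
    by move=> hk; rewrite gr_componentE /gr_coef nth_default// gr_class0; exact: ideal0.
  have [n hn] : exists n, ~ I (gr_component n y).
    apply: contrapT => hn; apply: Iy; apply: homogeneous_ideal_mem => // n.
    by apply: contrapT => h'; apply: hn; exists n.
  have ex : exists n, `[< ~ I (gr_component n y) >] by exists n; apply/asboolP.
  have ub i : `[< ~ I (gr_component i y) >] -> (i <= s)%N.
    by move/asboolP => hi; rewrite leqNgt; apply/negP => /ltnW /big.
  case: (ex_maxnP ex ub) => i /asboolP hi hmax; exists i => // k ik.
  by apply: contrapT => /asboolP /hmax; rewrite leqNgt ik.
apply: contrapT => /not_orP [/top [n hn nmax] /top [k hk kmax]].
suff : I (cl (n + k) (gr_coef n z * gr_coef k z')).
  by move=> /h; case => //; exact: gr_coefP.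
have e : gr_component (n + k) (z * z') =
    \sum_(i < (n + k).+1) gr_component i z * gr_component (n + k - i) z'.
  rewrite -[z]reprK -[z']reprK -rmorphM gr_component_pi rmorphM /= coefM.
  rewrite !reprK.
  have : forall P : pred 'I_(n + k).+1,
      mexp (n + k) (\sum_(i < (n + k).+1 | P i) gr_coef i z * gr_coef (n + k - i) z') /\
      cl (n + k) (\sum_(i < (n + k).+1 | P i) gr_coef i z * gr_coef (n + k - i) z') =
      \sum_(i < (n + k).+1 | P i) gr_component i z * gr_component (n + k - i) z'.
    move=> P; apply: (big_rec2 (fun u v => mexp (n + k) u /\ cl (n + k) u = v)).
      by rewrite gr_class0; split=> //; exact: ideal0.
    move=> i u v _ [hu <-].
    have hi : (i <= n + k)%N by rewrite -ltnS.
    have e : mexp (n + k) (gr_coef i z * gr_coef (n + k - i) z').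
      by rewrite -{1}(subnKC hi); apply: ideal_expD; exact: gr_coefP.
    split; first exact: idealD.
    rewrite gr_classD //; congr (_ + _).
    by rewrite -{1}(subnKC hi) gr_classM //; exact: gr_coefP.
  by move=> /(_ predT) [_].
have /homI := Izz' => /(_ (n + k)%N); rewrite e.
have lt : (n < (n + k).+1)%N by rewrite ltnS leq_addr.
(* Only the term i = n can stay outside I: for i > n its first factor is in I, for i < n its second
   one is. *)
rewrite (bigD1 (Ordinal lt)) //= addKn => /idealDr; rewrite gr_classM; try exact: gr_coefP.
apply=> //; apply: ideal_sum => // i ni.
have {}ni : (i : nat) != n by apply: contra ni => /eqP ni; apply/eqP/val_inj.
case: (ltngtP i n) ni => // hi _.
  by apply: (ideal_mull _ hI); apply: kmax; lia.
by apply: (ideal_mulr _ hI); exact: nmax.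
Qed.

(** Turns divisibility in the graded ring into a congruence in the ring. The disjunction covers d >
    n, where the truncated difference n - d carries no information and the homogeneous multiple is
    0. *)
Lemma principal_class d n h a : mexp d h -> mexp n a ->
  principal (cl d h) (cl n a) ->
  exists e, [/\ (d <= n)%N \/ e = 0, mexp (n - d) e & mexp n.+1 (a - h * e)].
Proof.
move=> hh ha [z _ ez]; have := gr_component_class n ha; rewrite eqxx -ez.
rewrite gr_component_mul //; case: leqP => [dn|_].
  rewrite gr_componentE -gr_classM //; last exact: gr_coefP.
  rewrite subnKC // ez => e; exists (gr_coef (n - d) z).
  split; [by left|exact: gr_coefP|]; apply/gr_class_eq => //.
  by rewrite -{1}(subnKC dn); apply: ideal_expD => //; exact: gr_coefP.
rewrite ez => /esym /(gr_class_eq0 ha) h1; exists 0.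
by split; [by right|exact: ideal0|rewrite mulr0 subr0].
Qed.

Lemma principal_degree_le d n h a : mexp d h -> mexp n a -> cl n a <> 0 ->
  principal (cl d h) (cl n a) -> (d <= n)%N.
Proof.
move=> hh ha a0 /(principal_class hh ha) [e [[//|->] _]].
by rewrite mulr0 subr0 => /(gr_class_eq0 ha).
Qed.

Lemma principal_classM d n h e : mexp d h -> mexp n e ->
  principal (cl d h) (cl (d + n) (h * e)).
Proof. by move=> hh he; exists (cl n e) => //; rewrite gr_classM. Qed.

Lemma principal_homogeneous d h : mexp d h ->
  is_homogeneous_ideal (principal (cl d h)).
Proof.
move=> hh n _ [z _ <-]; rewrite gr_component_mul //; case: leqP => _.
  by exists (gr_component (n - d) z).
exact: (ideal0 (principal_ideal _)).
Qed.

Lemma zero_homogeneous : is_homogeneous_ideal [set 0 : gr T].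
Proof. by move=> n _ /= ->; exact: gr_component0. Qed.

Lemma set0_ideal (A : comNzRingType) : is_ideal [set 0 : A].
Proof.
split=> //= [a b -> ->|a b ->]; first by rewrite addr0.
by rewrite mulr0.
Qed.

(** A multiple of the (n+1)-st power of a class of degree d > 0 has no component of degree n. *)
Lemma powers_principal_eq0 d h z : (0 < d)%N -> mexp d h ->
  (forall n, principal (cl d h ^+ n) z) -> z = 0.
Proof.
move=> d0 hh hz; apply: gr_component_ext => n; rewrite gr_component0.
have [w _ <-] := hz n.+1; rewrite -gr_classX // gr_component_mul; last exact: ideal_expX.
by rewrite leqNgt leq_pmull.
Qed.

(* A prime ideal strictly inside a principal one is stable under division by
   the generator. *)
Lemma prime_sub_principal (P : set (gr T)) d h : (0 < d)%N -> mexp d h ->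
  is_prime P -> P `<` principal (cl d h) -> P `<=` [set 0].
Proof.
move=> d0 hh [PI P1 PP] [sP nP] z Pz; apply: (powers_principal_eq0 d0 hh) => n.
have nh : ~ P (cl d h) by move=> Ph; apply: nP; exact: principal_sub.
suff [w Pw ->] : exists2 w, P w & z = cl d h ^+ n * w by exists w.
elim: n => [|n [w Pw ->]]; first by exists z; rewrite ?expr0 ?mul1r.
have [v _ ev] := sP _ Pw; exists v; last by rewrite exprSr -mulrA ev.
by move: Pw; rewrite -ev => /PP [].
Qed.

End AssociatedGradedRing.

(** * Local and regular rings *)

Section LocalRings.
Variable T : comNzRingType.
Local Notation m := (max_ideal T).

Lemma nonunit_sub_maximal (a : T) : ~ is_unit a ->
  exists2 M, is_maximal M & M a.
Proof.
move=> na.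
(* Zorn's lemma also asks for the union of the empty chain, so the empty set must satisfy [P]: hence
   neither 0 nor a is required to be in J, and j = 0 is allowed separately. The last clause says
   that J + aT is proper. *)
pose P (J : set T) := [/\ forall b c, J b -> J c -> J (b + c),
  forall b c, J c -> J (b * c) & forall j r, J j \/ j = 0 -> j + r * a <> 1].
have [F FP tot|A [[AD AM A1] Amax]] := @Zorn_bigcup T P.
  split=> [b c [X FX Xb] [Y FY Yc]|b c [X FX Xc]|j r [[X FX Xj]|->]].
  - have [XY|YX] := tot _ _ FX FY.
      by exists Y => //; have [YD _ _] := FP _ FY; apply: YD => //; exact: XY.
    by exists X => //; have [XD _ _] := FP _ FX; apply: XD => //; exact: YX.
  - by exists X => //; have [_ XM _] := FP _ FX; exact: XM.
  - by have [_ _ X1] := FP _ FX; apply: X1; left.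
  - by rewrite add0r => e; apply: na; exists r; rewrite mulrC.
(* Adding the multiples of a preserves [P], so maximality gives A' = A; this is what puts 0 and a in
   A. *)
pose A' : set T := [set z | exists j r, (A j \/ j = 0) /\ z = j + r * a].
have AA' : A `<=` A' by move=> j Aj; exists j, 0; split; [left|rewrite mul0r addr0].
have A0D j j' : A j \/ j = 0 -> A j' \/ j' = 0 -> A (j + j') \/ j + j' = 0.
  move=> [hj|->] [hj'|->]; rewrite ?add0r ?addr0; try by [left|right].
  by left; exact: AD.
have A0M b j : A j \/ j = 0 -> A (b * j) \/ b * j = 0.
  by move=> [hj|->]; [left; exact: AM|right; rewrite mulr0].
have PA' : P A'.
  split=> [_ _ [j [r [hj ->]]] [j' [r' [hj' ->]]]|b _ [j [r [hj ->]]]|z r].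
  - by exists (j + j'), (r + r'); split; [exact: A0D|ring].
  - by exists (b * j), (b * r); split; [exact: A0M|ring].
  - move=> [[j [r' [hj ->]]]|->].
      by rewrite -addrA -mulrDl; exact: A1.
    by apply: A1; right.
have A'A : A' `<=` A.
  by apply: contrapT => nA; apply: (Amax A').
have Aid : is_ideal A.
  split=> //; apply: A'A; exists 0, 0; split; first by right.
  by rewrite mul0r addr0.
exists A; last by apply: A'A; exists 0, 1; split; [right|rewrite mul1r add0r].
split=> // [A1'|B Bid B1 AB].
  by apply: (A1 1 0); [left|rewrite mul0r addr0].
apply/seteqP; split=> //; apply: contrapT => nBA; apply: (Amax B) => //.
have Ba : B a by apply: AB; apply: A'A; exists 0, 1; split; [right|rewrite mul1r add0r].
case: (Bid) => B0 BD BM; split=> // j r hj e; apply: B1; rewrite -e.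
by apply: BD; [case: hj => [|->]|exact: BM].
Qed.

Definition nonmax_unit := forall a : T, ~ m a -> is_unit a.

Lemma local_nonmax_unit : is_local T -> nonmax_unit.
Proof.
move=> [M [hM uM]] a ma; apply: contrapT => /nonunit_sub_maximal [N hN Na].
apply: ma; rewrite /max_ideal; case: xgetP => [M' _ hM'|/(_ M)//].
by rewrite -(uM _ hM') (uM _ hN).
Qed.

Lemma max_idealE (M : set T) : is_ideal M -> ~ M 1 ->
  (forall a, ~ M a -> is_unit a) -> m = M.
Proof.
move=> hM M1 hu.
have sub J : is_ideal J -> ~ J 1 -> J `<=` M.
  by move=> hJ J1 a Ja; apply: contrapT => /hu /(ideal_unit hJ Ja).
rewrite /max_ideal; apply: xget_unique.
  by split=> // J hJ J1 MJ; apply/seteqP; split=> //; exact: sub.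
by move=> N [hN N1 Nmax]; symmetry; apply: Nmax => //; exact: sub.
Qed.

Lemma unit1B (a b : T) : nonmax_unit -> m a -> is_unit (1 - a * b).
Proof.
move=> hu ma; apply: hu => h; apply: (@max_ideal_not1 T).
have hm := max_ideal_ideal T.
by rewrite -(subrK (a * b) 1); apply: (idealD hm h); exact: ideal_mulr.
Qed.

Lemma nonunit_max (a : T) : m a -> ~ is_unit a.
Proof. by move=> ma /(ideal_unit (max_ideal_ideal T) ma); exact: max_ideal_not1. Qed.

End LocalRings.

(** * Nakayama's lemma and ascending chains *)

Section Noetherian.
Variable T : comNzRingType.
Local Notation m := (max_ideal T).

Lemma ideal_gen_cons (a : T) (s : seq T) b : ideal_gen [set` (a :: s)] b ->
  exists c d, ideal_gen [set` s] d /\ b = c * a + d.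
Proof.
have hI := ideal_gen_ideal [set` s].
apply: (@ideal_gen_min _ [set b | exists c d, ideal_gen [set` s] d /\ b = c * a + d]).
  split; first by exists 0, 0; split; [exact: ideal0|rewrite mul0r addr0].
  - move=> _ _ [c [d [hd ->]]] [c' [d' [hd' ->]]]; exists (c + c'), (d + d').
    by split; [exact: (idealD hI)|ring].
  - move=> e _ [c [d [hd ->]]]; exists (e * c), (e * d).
    by split; [exact: (ideal_mull _ hI)|ring].
move=> z; rewrite /= inE => /orP [/eqP ->|zs].
  by exists 1, 0; split; [exact: ideal0|rewrite mul1r addr0].
by exists 0, z; split; [exact: sub_ideal_gen|rewrite mul0r add0r].
Qed.

(** The hypothesis reads: J is contained in N + xJ. Generators of J are removed one at a time:
    modulo N and the remaining ones, the first generator a is killed by some 1 - xc, which is a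
    unit. *)
Lemma nakayama (J N : set T) (x : T) : nonmax_unit T -> is_noetherian T ->
  is_ideal J -> is_ideal N -> m x ->
  (forall a, J a -> exists n j, [/\ N n, J j & a = n + x * j]) -> J `<=` N.
Proof.
move=> hu hn hJ hN mx h.
have [s hs] := hn J hJ.
have : (forall a, a \in s -> J a) by move=> a sa; rewrite hs; exact: sub_ideal_gen.
have : (forall a, J a -> exists n j, [/\ N n, ideal_gen [set` s] j & a = n + j]).
  by move=> a; rewrite hs => sa; exists 0, a; split; [exact: ideal0| |rewrite add0r].
move=> {hs}; elim: s => [|a s IH] hs sJ.
  move=> a /hs [n [j [Nn hj ->]]]; apply: (idealD hN) => //.
  have -> : j = 0; last exact: ideal0.
  apply: (@ideal_gen_min _ [set 0]) hj; last by [].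
  split=> //= [b c -> ->|b c ->]; first by rewrite addr0.
  by rewrite mulr0.
have gI := ideal_gen_ideal [set` s].
suff [n' [d' [Nn' hd' ea]]] : exists n j, [/\ N n, ideal_gen [set` s] j & a = n + j].
  apply: IH => [b /hs [n [_ [Nn /ideal_gen_cons [c [d [hd ->]]] ->]]]|b sb]; last first.
    by apply: sJ; rewrite inE sb orbT.
  exists (n + c * n'), (c * d' + d); split; last by rewrite ea; ring.
    by apply: (idealD hN) => //; exact: ideal_mull.
  by apply: (idealD gI) => //; exact: (ideal_mull _ gI).
have [|n [j [Nn Jj ea]]] := h a; first by apply: sJ; rewrite mem_head.
have [n' [_ [Nn' /ideal_gen_cons [c [d [hd ->]]] ej]]] := hs j Jj.
have [u hu1] : is_unit (1 - x * c) by exact: unit1B.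
exists (u * (n + x * n')), (u * x * d); split.
- by apply: (ideal_mull _ hN); apply: (idealD hN) => //; exact: ideal_mull.
- exact: (ideal_mull _ gI).
- have e : (1 - x * c) * a = n + x * n' + x * d by rewrite mulrBl mul1r {1}ea {1}ej; ring.
  have -> : a = u * ((1 - x * c) * a) by rewrite mulrA [u * _]mulrC hu1 mul1r.
  by rewrite e; ring.
Qed.

Lemma noetherian_stable (A : nat -> set T) : is_noetherian T ->
  (forall n, is_ideal (A n)) -> (forall n, A n `<=` A n.+1) ->
  exists n, forall k, A k `<=` A n.
Proof.
move=> hn hA hS.
have le i j : (i <= j)%N -> A i `<=` A j.
  move=> /subnK <-; elim: (j - i)%N => // k IH; rewrite addSn.
  exact: (subset_trans IH).
have hU : is_ideal (\bigcup_n A n).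
  split; first by exists 0%N => //; exact: ideal0.
  - move=> a b [i _ ha] [j _ hb]; exists (maxn i j) => //.
    by apply: idealD => //; [apply: le ha|apply: le hb]; rewrite leq_max leqnn ?orbT.
  - by move=> a b [i _ hb]; exists i => //; exact: ideal_mull.
have [s hs] := hn _ hU.
have [n hsn] : exists n, forall a, a \in s -> A n a.
  have : forall a, a \in s -> (\bigcup_n A n) a by move=> a sa; rewrite hs; exact: sub_ideal_gen.
  elim: s {hs} => [|a s IH] h; first by exists 0%N.
  have [|n hs] := IH; first by move=> b sb; apply: h; rewrite inE sb orbT.
  have [i _ ha] := h a (mem_head _ _).
  exists (maxn i n) => b; rewrite inE => /orP [/eqP ->|/hs].
    by apply: le ha; rewrite leq_maxl.
  by apply: le; rewrite leq_maxr.
exists n => k a ka; have : (\bigcup_n A n) a by exists k.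
by rewrite hs; apply: (@ideal_gen_min _ (A n)).
Qed.

End Noetherian.

(** * Parameters of a two-dimensional regular local ring *)

Section RegularLocalRing2.
Variable T : comNzRingType.
Local Notation m := (max_ideal T).
Hypotheses (domT : forall a b : T, a * b = 0 -> a = 0 \/ b = 0).
Hypotheses (hu : nonmax_unit T) (hn : is_noetherian T).
Variables x y : T.
Hypothesis hxy : m = ideal_gen [set x; y].

Let mI := max_ideal_ideal T.
Let mx : m x. Proof. by rewrite hxy; apply: sub_ideal_gen; left. Qed.
Let my : m y. Proof. by rewrite hxy; apply: sub_ideal_gen; right. Qed.

(* Krull's principal ideal theorem for x: otherwise T/xT is artinian, so the
   symbolic powers J i of q at Q stabilize modulo x, hence stabilize. *)
Lemma power_notin_principal k (Q : set T) (q : T) : is_prime Q -> Q q -> q <> 0 ->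
  ~ (m `<=` Q) -> ~ principal x (y ^+ k).
Proof.
move=> [QI Q1 QP] Qq q0 mQ xyk.
have QX z i : Q (z ^+ i) -> Q z.
  by elim: i => [|i IH]; rewrite ?expr0 ?exprS => // /QP [].
have Qx : ~ Q x.
  move=> Qx; apply: mQ => z; rewrite hxy => /ideal_gen2P [a [b ->]].
  apply: (idealD QI); apply: (ideal_mull _ QI) => //.
  by apply: (QX _ k); case: xyk => c _ <-; exact: ideal_mulr.
(* [J i] is the contraction of the ideal generated by q^i in the localization at Q, written with
   denominators s outside Q. *)
pose J i : set T := [set a | exists s r, ~ Q s /\ s * a = q ^+ i * r].
have JI i : is_ideal (J i).
  split; first by exists 1, 0; rewrite !mulr0.
  - move=> a b [s [r [hs e]]] [s' [r' [hs' e']]]; exists (s * s'), (s' * r + s * r').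
    split; first by case/QP.
    by rewrite mulrDr mulrAC e -mulrA e'; ring.
  - by move=> a b [s [r [hs e]]]; exists s, (a * r); split=> //; rewrite mulrCA e; ring.
have JS i : J i.+1 `<=` J i.
  by move=> a [s [r [hs e]]]; exists s, (q * r); split=> //; rewrite e exprS; ring.
have Jle i j : (i <= j)%N -> J j `<=` J i.
  move=> /subnK <-; elim: (j - i)%N => // l IH; rewrite addSn.
  by move=> a /JS /IH.
(* Passing from T/(x, y^l) to T/(x, y^(l+1)) adds a layer of length at most one. Either every [J i]
   meets that layer, and then an element of [J i.+1] clears the y^l term, or some [J i1] misses it
   and so do all later ones. *)
have dcc l : exists i0, forall i a, (i0 <= i)%N -> J i a ->
    exists b c d, J i.+1 b /\ a = b + x * c + y ^+ l * d.
  elim: l => [|l [i0 IH]].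
    by exists 0%N => i a _ _; exists 0, 0, a; split; [exact: ideal0|ring].
  have [h|/existsNP [i1 h]] := pselect (forall i, exists c,
      [/\ J i c, exists d e, c = x * d + y ^+ l * e &
        ~ exists d e, c = x * d + y ^+ l.+1 * e]).
    exists i0 => i a hi /(IH _ _ hi) [b [c [d [Jb ->]]]].
    have [z [Jz [f [g ez]] nz]] := h i.+1.
    have [u gu] : is_unit g.
      apply: hu => mg; apply: nz; move: mg; rewrite hxy => /ideal_gen2P [g1 [g2 eg]].
      by exists (f + y ^+ l * g1), g2; rewrite ez eg exprS; ring.
    exists (b + d * u * z), (c - d * u * f), 0; split.
      by apply: (idealD (JI _)) => //; exact: ideal_mull.
    have -> : y ^+ l * d = d * u * z - d * u * f * x.
      by rewrite ez -[LHS]mulr1 -gu; ring.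
    by ring.
  exists (maxn i0 i1) => i a; rewrite geq_max => /andP [h0 h1] Ja.
  have [b [c [d [Jb ea]]]] := IH _ _ h0 Ja.
  have hz : J i1 (x * c + y ^+ l * d).
    have -> : x * c + y ^+ l * d = a - b by rewrite ea; ring.
    by apply: (idealB (JI _)); [exact: Jle Ja|apply: Jle (JS _ _ Jb)].
  have [f [g efg]] : exists d' e, x * c + y ^+ l * d = x * d' + y ^+ l.+1 * e.
    by apply: contrapT => nh; apply: h; exists (x * c + y ^+ l * d); split=> //; exists c, d.
  by exists b, f, g; rewrite -addrA -efg addrA.
have [i0 hi0] := dcc k.
(* Since y^k is in (x), [J i0] is contained in [J i0.+1] + (x); as x is outside Q, the cofactor of x
   is again in [J i0], and Nakayama's lemma applies. *)
have sub : J i0 `<=` J i0.+1.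
  apply: (@nakayama _ _ _ x) => // a Ja.
  have [b [c [d [Jb ea]]]] := hi0 i0 a (leqnn _) Ja.
  have [w _ ew] := xyk; exists b, (c + w * d); split=> //; last by rewrite ea -ew; ring.
  have : J i0 (x * (c + w * d)).
    have -> : x * (c + w * d) = a - b by rewrite ea -ew; ring.
    by apply: (idealB (JI _)) => //; exact: JS.
  move=> [s [r [hs e]]]; exists (s * x), r; split; first by case/QP.
  by rewrite -mulrA.
(* For q^i0 itself the inclusion gives s q^i0 = q^(i0+1) r with s outside Q, whereas cancelling q^i0
   gives s = q r in Q. *)
have [|s [r [hs e]]] := sub (q ^+ i0).
  by exists 1, 1; split=> //; rewrite mulrC.
have q0' j : q ^+ j <> 0.
  elim: j => [|j IH]; first by apply/eqP; exact: oner_neq0.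
  by rewrite exprS => /domT [].
have : q ^+ i0 * (s - q * r) = 0.
  by rewrite mulrBr mulrC e exprS; ring.
case/domT => [/q0' //|/eqP]; rewrite subr_eq0 => /eqP es.
by apply: hs; rewrite es; exact: ideal_mulr.
Qed.

(* Krull's intersection theorem modulo x *)
Lemma principal_closed a :
  (forall n, exists b c, a = x * b + y ^+ n * c) -> principal x a.
Proof.
pose N : set T := [set a | forall n, exists b c, a = x * b + y ^+ n * c].
have NI : is_ideal N.
  split=> [n|b c hb hc n|b c hc n]; first by exists 0, 0; rewrite !mulr0 addr0.
    have [[b1 [b2 ->]] [c1 [c2 ->]]] := (hb n, hc n).
    by exists (b1 + c1), (b2 + c2); ring.
  by have [c1 [c2 ->]] := hc n; exists (b * c1), (b * c2); ring.
have pI := principal_ideal x.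
suff : N `<=` principal x by apply.
apply: (@nakayama _ _ _ y) => // {}a Na.
(* The colon ideals (x : y^n) increase, hence stop at some n. For a = x b + y^(n+1) c in N,
   comparing with the expansions of a at all higher powers of y shows that y^n c is in N; so N is
   contained in (x) + yN. *)
pose A n : set T := [set b | principal x (y ^+ n * b)].
have [n hA] : exists n, forall k, A k `<=` A n.
  apply: noetherian_stable => // n.
    split; rewrite /A /=; first by rewrite mulr0; exact: ideal0.
    - by move=> b c hb hc; rewrite mulrDr; exact: idealD.
    - by move=> b c hc; rewrite mulrCA; exact: ideal_mull.
  by move=> b; rewrite /A /= exprS -mulrA; exact: ideal_mull.
have [b [c ea]] := Na n.+1.
exists (x * b), (y ^+ n * c); split.
- by exists b.
- move=> k; have [b' [c' ea']] := Na (n.+1 + k)%N.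
  have : A n.+1 (c - y ^+ k * c').
    exists (b' - b) => //.
    apply/eqP; rewrite -subr_eq0; apply/eqP.
    have -> : x * (b' - b) - y ^+ n.+1 * (c - y ^+ k * c') =
      (x * b' + y ^+ (n.+1 + k) * c') - (x * b + y ^+ n.+1 * c) by rewrite exprD; ring.
    by rewrite -ea -ea' subrr.
  move=> /hA [d _ ed]; exists d, (y ^+ n * c').
  by rewrite ed; ring.
- by rewrite ea exprS; ring.
Qed.

Lemma principal_decomp z : ~ principal x z ->
  exists n b c, is_unit c /\ z = x * b + y ^+ n * c.
Proof.
move=> hz.
have [n [b [c ez]] hn1] : exists2 n, exists b c, z = x * b + y ^+ n * c &
    ~ exists b c, z = x * b + y ^+ n.+1 * c.
  apply: contrapT => h; apply: hz; apply: principal_closed.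
  elim=> [|n IH]; first by exists 0, z; ring.
  by apply: contrapT => h'; apply: h; exists n.
exists n, b, c; split=> //; apply: hu; rewrite hxy => /ideal_gen2P [c1 [c2 ec]]; apply: hn1.
by exists (b + y ^+ n * c1), c2; rewrite ez ec exprS; ring.
Qed.

(** The middle prime of a chain of length two is non-zero and does not contain m, so no power of y
    lies in (x). If yz were in (x) with z outside (x), writing z = xb + y^n c with c a unit would
    put y^(n+1) in (x). Thus x, y is a regular sequence. *)
Lemma regular_quasi_regular : has_krull_dim T 2 -> quasi_regular m x y.
Proof.
move=> [[Q [hQ hlt]] _].
have [Q01 [q Q1q Q0q]] : Q 0%N `<` Q 1%N /\ exists2 q, Q 1%N q & ~ Q 0%N q.
  split; first exact: hlt.
  by have [_ /existsNP [q /not_implyP [? ?]]] := hlt 0%N isT; exists q.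
have q0 : q <> 0.
  by move=> e; apply: Q0q; rewrite e; have [/ideal0] := hQ 0%N isT.
have mQ : ~ (m `<=` Q 1%N).
  move=> mQ; have [_ /existsNP [z /not_implyP [Q2z Q1z]]] := hlt 1%N isT.
  have [Q2I Q21 _] := hQ 2%N isT.
  by apply: Q1z; apply: mQ; apply: contrapT => /hu /(ideal_unit Q2I Q2z).
have hk k := power_notin_principal (k := k) (hQ 1%N isT) Q1q q0 mQ.
have QX i : Q 1%N (y ^+ i) -> Q 1%N y.
  have [_ Q11 QP] := hQ 1%N isT.
  by elim: i => [|i IH]; rewrite ?expr0 ?exprS => // /QP [].
have pI := principal_ideal x.
apply: regular_sequence_quasi_regular => // [z /domT [x0|//]|z].
  (* If x = 0, the non-zero q is a power of y up to a unit, so the middle prime contains y and with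
     it m = (y). *)
  have [|n [b [c [[u cu] eq]]]] := @principal_decomp q.
    by rewrite x0 => -[b _]; rewrite mul0r => /esym.
  rewrite x0 in eq.
  have [QI Q1 QP] := hQ 1%N isT.
  have /QX Qy : Q 1%N (y ^+ n).
    have -> : y ^+ n = q * u by rewrite eq mul0r add0r -mulrA cu mulr1.
    exact: ideal_mulr.
  case: mQ => w; rewrite hxy x0 => /ideal_gen2P [d [e ->]].
  by rewrite mulr0 add0r; exact: ideal_mull.
move=> hyz; apply: contrapT => hz.
have [n [b [c [[u cu] ez]]]] := principal_decomp hz.
apply: (hk n.+1).
have -> : y ^+ n.+1 = u * (y * z) + x * (- (u * y * b)).
  by rewrite ez exprS -[LHS]mulr1 -cu; ring.
by apply: (idealD pI); [exact: ideal_mull|exists (- (u * y * b))].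
Qed.

(** The intersection of the powers is contained in (x), and cancelling x stays inside the
    intersection by [quasi_regular_mulx]; so it is x times itself, and Nakayama's lemma kills it. *)
Lemma quasi_regular_separated a : quasi_regular m x y ->
  (forall n, ideal_exp m n a) -> a = 0.
Proof.
move=> qr; move: a; pose N : set T := [set a | forall n, ideal_exp m n a].
have NI : is_ideal N.
  split=> [n|a b ha hb n|a b hb n].
    exact: (ideal0 (mexp_ideal _ n)).
    exact: (idealD (mexp_ideal _ n)).
  exact: (ideal_mull _ (mexp_ideal _ n)).
have zI := set0_ideal T.
suff : N `<=` [set 0] by [].
apply: (@nakayama _ _ _ x) => // a Na.
have [b _ eb] : principal x a.
  apply: principal_closed => n; have [c ->] := (ideal_exp_formP n a hxy).1 (Na n).
  case: n => [|n]; first by exists 0, (binform x y 0 c); ring.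
  by exists (binform x y n c), (c n.+1); rewrite formS_l; ring.
exists 0, b; split=> //; last by rewrite add0r.
by move=> n; apply: (quasi_regular_mulx hxy qr); rewrite eb.
Qed.

End RegularLocalRing2.

Section ResidueField.
Variable T : comNzRingType.

Definition max_pred : {pred T} := fun a => `[< max_ideal T a >].

Lemma max_pred_closed : idealr_closed max_pred.
Proof.
have mI := max_ideal_ideal T.
split=> [||a u v /asboolP hu /asboolP hv]; first by apply/asboolP; exact: ideal0.
  by apply/negP => /asboolP; exact: max_ideal_not1.
by apply/asboolP; apply: (idealD mI) => //; exact: ideal_mull.
Qed.

HB.instance Definition _ := isIdealr.Build T max_pred max_pred_closed.

(** The quotient is a field only under [nonmax_unit], so the field structure is built inside the
    proof, with inverses obtained by choice, and only a surjection with kernel m is exported. *)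
Lemma residue_field_ex : nonmax_unit T ->
  exists (k : fieldType) (phi : {rmorphism T -> k}),
    (forall c, exists a, phi a = c) /\ (forall a, phi a = 0 <-> max_ideal T a).
Proof.
move=> hu; pose Q : comNzRingType := {ideal_quot max_pred}.
pose inv (z : Q) : Q := if z == 0 then 0 else xget 0 [set w | w * z = 1].
have pi0 a : \pi_Q%qT a = 0 <-> max_ideal T a.
  have <- : \pi_Q%qT (0 : T) = 0 by exact: rmorph0.
  split=> [/eqP|h]; first by rewrite -Quotient.idealrBE subr0 => /asboolP.
  by apply/eqP; rewrite -Quotient.idealrBE subr0; apply/asboolP.
have mulV z : z != 0 -> inv z * z = 1.
  move=> z0; rewrite /inv (negbTE z0).
  have [b hb] : is_unit (repr z).
    by apply: hu => /pi0; rewrite reprK; exact/eqP.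
  apply: (@xgetPex _ 0 [set w | w * z = 1]); exists (\pi_Q%qT b).
  rewrite /= -[z]reprK -rmorphM mulrC hb; exact: rmorph1.
have inv0 : inv 0 = 0 by rewrite /inv eqxx.
pose F := HB.pack_for fieldType {ideal_quot max_pred} (GRing.ComNzRing_isField.Build Q mulV inv0).
exists F, (\pi_Q%qT : {rmorphism T -> Q}); split; last exact: pi0.
by move=> c; exists (repr (c : Q)); exact: reprK.
Qed.

End ResidueField.

(** * Regular subrings of a field *)

Section Subring.
Variables (K : fieldType) (S : subring K).
Local Notation m := (max_ideal S).
Local Notation mexp := (ideal_exp (max_ideal S)).
Local Notation cl := (@gr_class S).
Implicit Types (a b c x y h : S).

Lemma subval0 : val (0 : S) = 0. Proof. exact: rmorph0. Qed.
Lemma subval1 : val (1 : S) = 1. Proof. exact: rmorph1. Qed.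
Lemma subvalM a b : val (a * b) = val a * val b. Proof. exact: rmorphM. Qed.
Lemma subvalD a b : val (a + b) = val a + val b. Proof. exact: rmorphD. Qed.
Lemma subvalN a : val (- a) = - val a. Proof. exact: rmorphN. Qed.
Lemma subvalB a b : val (a - b) = val a - val b. Proof. exact: rmorphB. Qed.
Lemma subvalX a n : val (a ^+ n) = val a ^+ n. Proof. exact: rmorphXn. Qed.
Lemma subval_sum n (F : 'I_n -> S) : val (\sum_(i < n) F i) = \sum_(i < n) val (F i).
Proof. exact: rmorph_sum. Qed.
Lemma subval_inj a b : val a = val b -> a = b.
Proof. exact: val_inj. Qed.
Lemma val_inj0 a : val a = 0 -> a = 0.
Proof. by rewrite -subval0; exact: val_inj. Qed.
Lemma val_neq0 a : a <> 0 -> val a != 0.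
Proof. by move=> ha; apply/eqP => /val_inj0. Qed.

Lemma subring_domain a b : a * b = 0 -> a = 0 \/ b = 0.
Proof.
move/(congr1 val); rewrite subvalM subval0 => /eqP; rewrite mulf_eq0.
by case/orP => /eqP /val_inj0; [left|right].
Qed.

Lemma subring_setE z : subring_set S z <-> exists a : S, val a = z.
Proof.
split=> [hz|[a <-]]; last by case: a => a /= /asboolP.
by have hz' : z \in subring_pred S := asboolT hz; exists (SubringElt hz').
Qed.

Definition regular_params x y := regular_parameters x y /\ quasi_regular m x y.

Lemma regular_paramsC x y : regular_params x y -> regular_params y x.
Proof.
move=> [hm qr]; split; last exact: quasi_regularC.
by rewrite /regular_parameters setUC.
Qed.

(** Separation gives every non-zero element an order; quasi-regular parameters make the graded ring
    polynomial in two variables over the residue field. *)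
Definition regular2 : Prop :=
  [/\ nonmax_unit S, forall a, (forall n, mexp n a) -> a = 0 &
      exists x y, regular_params x y].

Section Params.
Variables x y : S.
Hypothesis hxy : regular_parameters x y.
Lemma param_max : m x. Proof. by rewrite hxy; apply: sub_ideal_gen; left. Qed.
Lemma param_maxC : m y. Proof. by rewrite hxy; apply: sub_ideal_gen; right. Qed.
End Params.

Lemma quasi_regular_notin x y : regular_params x y -> ~ mexp 2 x.
Proof.
move=> [hm qr] h; apply: (@max_ideal_not1 S).
apply: (qr 1%N (fun i => if i is 0 then 1 else 0) _ 0%N) => //.
by rewrite /binform big_ord_recl big_ord1 /= mul1r mul0r addr0 mulr1.
Qed.

Lemma param_neq0 x : ~ mexp 2 x -> x <> 0.
Proof. by move=> h e; apply: h; rewrite e; exact: (ideal0 (mexp_ideal _ _)). Qed.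

Lemma regular_params_neq0 x y : regular_params x y -> x <> 0.
Proof. by move/quasi_regular_notin/param_neq0. Qed.

Section Slope.
Variables x y : S.
Hypotheses (hxy : regular_parameters x y) (x0 : x <> 0).
Let x0' : val x != 0 := val_neq0 x0.

Definition slope_eval (q : {poly S}) : K := (map_poly val q).[val y / val x].
Local Notation ev := slope_eval.

Lemma slope_evalM p q : ev (p * q) = ev p * ev q.
Proof. by rewrite /slope_eval rmorphM hornerM. Qed.
Lemma slope_evalB p q : ev (p - q) = ev p - ev q.
Proof. by rewrite /slope_eval rmorphB hornerD hornerN. Qed.
Lemma slope_evalC c : ev c%:P = val c.
Proof. by rewrite /slope_eval map_polyC hornerC. Qed.
Lemma slope_evalX n : ev 'X^n = (val y / val x) ^+ n.
Proof. by rewrite /slope_eval map_polyXn hornerXn. Qed.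

Lemma val_binform n (q : {poly S}) : (size q <= n.+1)%N ->
  val (binform x y n (fun i => q`_i)) = val x ^+ n * ev q.
Proof.
move=> sq; rewrite /slope_eval (@horner_coef_wide _ n.+1) ?(leq_trans (size_poly _ _))//.
rewrite mulr_sumr /binform subval_sum; apply: eq_bigr => i _.
rewrite !subvalM !subvalX coef_map /= expr_div_n.
have hi : (i <= n)%N by rewrite -ltnS.
have -> : val x ^+ n = val x ^+ (n - i) * val x ^+ i by rewrite -exprD subnK.
field.
by rewrite expf_neq0.
Qed.

Lemma mexp_slopeP n a : mexp n a <->
  exists2 q : {poly S}, (size q <= n.+1)%N & val a = val x ^+ n * ev q.
Proof.
rewrite (ideal_exp_formP _ _ hxy); split=> [[c ->]|[q sq e]]; last first.
  by exists (fun i => q`_i); apply: subval_inj; rewrite e -val_binform.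
exists (\poly_(i < n.+1) c i); first exact: size_poly.
rewrite -val_binform; last exact: size_poly.
by congr val; apply: eq_form => i hi; rewrite coef_poly ltnS hi.
Qed.

End Slope.

Section Dehomogenization.
Variables x y : S.
Hypotheses (hxy : regular_params x y).
Variables (k : fieldType) (phi : {rmorphism S -> k}).
Hypotheses (phi_surj : forall c : k, exists a, phi a = c).
Hypotheses (phi_ker : forall a, phi a = 0 <-> m a).
Local Notation ev := (slope_eval x y).
Implicit Types P Q : {poly k}.

Let hm : regular_parameters x y. Proof. by case: hxy. Qed.
Let qr : quasi_regular m x y. Proof. by case: hxy. Qed.
Let x0 : x <> 0. Proof. exact/param_neq0/(quasi_regular_notin hxy). Qed.

(* the initial form of degree n of a is Q, in the affine coordinate y/x *)
Definition dehom n a Q := exists q : {poly S},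
  [/\ (size q <= n.+1)%N, val a = val x ^+ n * ev q & Q = map_poly phi q].

Lemma dehom_mem n a Q : dehom n a Q -> mexp n a.
Proof. by move=> [q [sq e _]]; apply/(mexp_slopeP hm x0); exists q. Qed.

Lemma dehom_ex n a : mexp n a -> exists Q, dehom n a Q.
Proof. by move/(mexp_slopeP hm x0) => [q sq e]; exists (map_poly phi q), q. Qed.

Lemma dehom_size n a Q : dehom n a Q -> (size Q <= n.+1)%N.
Proof. by move=> [q [sq _ ->]]; rewrite (leq_trans (size_poly _ _)). Qed.

Lemma dehomM n l a b Q P : dehom n a Q -> dehom l b P -> dehom (n + l) (a * b) (Q * P).
Proof.
move=> [q [sq ea ->]] [p [sp eb ->]]; exists (q * p); split.
- by rewrite (leq_trans (size_polyMleq _ _))//; lia.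
- by rewrite subvalM ea eb slope_evalM exprD mulrACA.
- by rewrite rmorphM.
Qed.

Lemma dehomB n a b Q P : dehom n a Q -> dehom n b P -> dehom n (a - b) (Q - P).
Proof.
move=> [q [sq ea ->]] [p [sp eb ->]]; exists (q - p); split.
- by rewrite (leq_trans (size_polyD _ _))// size_polyN geq_max sq.
- by rewrite subvalB ea eb slope_evalB mulrBr.
- by rewrite rmorphB.
Qed.

Lemma dehom_lift n Q : (size Q <= n.+1)%N -> exists a, dehom n a Q.
Proof.
move=> sQ; have [g hg] := choice phi_surj.
pose q := \poly_(i < n.+1) g Q`_i.
have sq : (size q <= n.+1)%N by exact: size_poly.
exists (binform x y n (fun i => q`_i)), q; split=> //.
  by rewrite (val_binform y x0 sq).
apply/polyP => i; rewrite coef_map coef_poly /=; case: ltnP => hi.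
  by rewrite hg.
by rewrite rmorph0 nth_default // (leq_trans sQ).
Qed.

(** Quasi-regularity enters here: the reduced polynomial Q depends only on the class of a, although
    the polynomial q behind it may vary. *)
Lemma dehom_eq0 n a Q : dehom n a Q -> mexp n.+1 a <-> Q = 0.
Proof.
move=> [q [sq ea ->]]; have ea' : a = binform x y n (fun i => q`_i).
  by apply: subval_inj; rewrite ea -val_binform.
split=> [|Q0].
  rewrite ea' => /qr hq; apply/polyP => i; rewrite coef_map coef0 /=.
  apply/phi_ker; case: (leqP i n) => [/hq//|ni].
  by rewrite nth_default; [exact: (ideal0 (max_ideal_ideal _))|exact: leq_trans ni].
rewrite ea'; apply: form_mem => // i _; apply/phi_ker.
by rewrite -coef_map /= Q0 coef0.
Qed.

Lemma dehom_inj n a b Q : dehom n a Q -> dehom n b Q -> mexp n.+1 (a - b).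
Proof. by move=> ha /(dehomB ha); rewrite subrr => /dehom_eq0 ->. Qed.

Lemma dehom_x n : dehom n (x ^+ n) 1.
Proof.
exists 1; rewrite size_poly1 rmorph1 subvalX; split=> //.
by rewrite -polyC1 slope_evalC subval1 mulr1.
Qed.

Lemma dehom_cl n a b Q : dehom n a Q -> dehom n b Q -> cl n a = cl n b.
Proof.
move=> ha hb; apply/gr_class_eq; [exact: dehom_mem ha|exact: dehom_mem hb|].
exact: dehom_inj hb.
Qed.

End Dehomogenization.

End Subring.

(** * Homogeneous primes of height one *)

Section HomogeneousPrimes.
Variables (K : fieldType) (S : subring K).
Local Notation m := (max_ideal S).
Local Notation mexp := (ideal_exp (max_ideal S)).
Local Notation cl := (@gr_class S).

Section Affine.
Variables x y : S.
Hypotheses (hxy : regular_params x y).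
Variables (k : fieldType) (phi : {rmorphism S -> k}).
Hypotheses (phi_surj : forall c : k, exists a, phi a = c).
Hypotheses (phi_ker : forall a, phi a = 0 <-> m a).
Local Notation dehom := (dehom x y phi).

(** The condition [size H = d.+1] means that x does not divide the class of h. It bounds the degree
    of the cofactor of H in Q by n - d, so that the cofactor lifts to an element of m^(n-d). *)
Lemma dehom_principal d h H n a Q : dehom d h H -> size H = d.+1 -> dehom n a Q ->
  principal (cl d h) (cl n a) <-> H %| Q.
Proof.
move=> hH sH haQ; have hh := dehom_mem hxy hH; have ha := dehom_mem hxy haQ.
split=> [/(principal_class hh ha) [e [[dn|e0] he hae]]|/dvdpP [P']].
- have [P hP] := dehom_ex hxy phi he.
  have := dehomM hH hP; rewrite subnKC // => /(dehomB haQ) /(dehom_eq0 hxy phi_ker) [h0 _].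
  by move: (h0 hae) => /eqP; rewrite subr_eq0 => /eqP ->; exact: dvdp_mulr.
- by move: hae; rewrite e0 mulr0 subr0 => /(dehom_eq0 hxy phi_ker haQ) ->; exact: dvdp0.
move: (P' : {poly k}) => {P'} P eQ.
have [Q0|/eqP Q0] := pselect (Q = 0).
  have /(gr_class_eq0 ha) -> := (dehom_eq0 hxy phi_ker haQ).2 Q0.
  exact: (ideal0 (principal_ideal _)).
have H0 : H != 0 by rewrite -size_poly_eq0 sH.
have P0 : P != 0 by apply: contraNneq Q0 => P0; rewrite eQ P0 mul0r.
have sQ := dehom_size haQ.
move: (sQ); rewrite eQ size_mul // sH addnS /= => sP.
have P1 : (0 < size P)%N by rewrite lt0n size_poly_eq0.
have dn : (d <= n)%N by rewrite -ltnS (leq_trans _ sP) // -[X in (X < _)%N]add0n ltn_add2r.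
have [|e he] := dehom_lift hxy phi_surj (n := (n - d)%N) (Q := P); first by rewrite -subSn // leq_subRL ?(leqW dn) // addnC.
have := dehomM hH he; rewrite subnKC // [H * _]mulrC -eQ => /(dehom_cl hxy phi_ker haQ) ->.
by rewrite -{1}(subnKC dn); apply: principal_classM => //; exact: dehom_mem he.
Qed.

End Affine.

Section Regular.
Hypothesis hS : regular2 S.

Lemma regular2_dehom : exists (k : fieldType) (phi : {rmorphism S -> k}),
  (forall c, exists a, phi a = c) /\ (forall a, phi a = 0 <-> m a).
Proof. by case: hS => hu _ _; exact: residue_field_ex. Qed.

Lemma mexp_domain n k a b : mexp n a -> mexp k b -> mexp (n + k).+1 (a * b) ->
  mexp n.+1 a \/ mexp k.+1 b.
Proof.
have [F [phi [_ phi0]]] := regular2_dehom.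
have [_ _ [x [y hxy]]] := hS.
move=> /(dehom_ex hxy phi) [Q hQ] /(dehom_ex hxy phi) [P hP].
move/(dehom_eq0 hxy phi0 (dehomM hQ hP))/eqP; rewrite mulf_eq0.
by case/orP => /eqP h; [left|right]; apply/(dehom_eq0 hxy phi0); eassumption.
Qed.

Lemma gr_zero_prime : is_prime [set 0 : gr S].
Proof.
apply: homogeneous_prime; [exact: set0_ideal|exact: zero_homogeneous| |].
  by move=> /= /eqP; rewrite oner_eq0.
move=> n k a b ha hb /= /(gr_class_eq0 (ideal_expD ha hb)) /(mexp_domain ha hb).
by move=> [/(gr_class_eq0 ha)|/(gr_class_eq0 hb)]; [left|right].
Qed.

Lemma gr_domain (z w : gr S) : z * w = 0 -> z = 0 \/ w = 0.
Proof. by have [_ _] := gr_zero_prime; apply. Qed.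

(** In its own chart x becomes the constant 1; in the chart x/y it becomes the variable, of full
    degree, so that [dehom_principal] applies and divisibility by x is vanishing at 0. *)
Lemma dehom_param x y (k : fieldType) (phi : {rmorphism S -> k}) :
  regular_params x y -> dehom y x phi 1 x 'X.
Proof.
move=> hxy; have hyx := regular_paramsC hxy.
exists 'X; rewrite size_polyX map_polyX; split=> //.
rewrite -['X]expr1 slope_evalX expr1 mulrCA divff ?mulr1//.
exact/val_neq0/(regular_params_neq0 hyx).
Qed.

Lemma param_prime x y : regular_params x y -> is_prime (principal (cl 1 x)).
Proof.
move=> hxy; have hyx := regular_paramsC hxy.
have hx : mexp 1 x by apply/mexp1; case: hxy => /param_max.
have [F [phi [phiS phi0]]] := regular2_dehom.
have hX := dehom_param phi hxy.
apply: homogeneous_prime; [exact: principal_ideal|exact: principal_homogeneous| |].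
  rewrite -gr_class1 => /(principal_class hx (ideal_exp0 _ _)) [e [[//|->] _]].
  by rewrite mulr0 subr0 => /mexp1 /max_ideal_not1.
move=> n k a b ha hb.
have [[Q hQ] [P hP]] := (dehom_ex hyx phi ha, dehom_ex hyx phi hb).
move=> /(dehom_principal hyx phiS phi0 hX (size_polyX _) (dehomM hQ hP)).
rewrite -['X]subr0 -polyC0 dvdp_XsubCl rootM => /orP h.
case: h => h; [left|right].
  apply/(dehom_principal hyx phiS phi0 hX (size_polyX _) hQ).
  by rewrite -['X]subr0 -polyC0 dvdp_XsubCl.
apply/(dehom_principal hyx phiS phi0 hX (size_polyX _) hP).
by rewrite -['X]subr0 -polyC0 dvdp_XsubCl.
Qed.

Lemma param_class_notin x y : regular_params x y -> ~ principal (cl 1 x) (cl 1 y).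
Proof.
move=> hxy; have hyx := regular_paramsC hxy.
have [F [phi [phiS phi0]]] := regular2_dehom.
have hX := dehom_param phi hxy.
have := dehom_x y x phi 1; rewrite expr1 => hy.
move=> /(dehom_principal hyx phiS phi0 hX (size_polyX _) hy).
by rewrite dvdp1 size_polyX.
Qed.

Lemma param_class_neq0 x y : regular_params x y -> cl 1 x <> 0.
Proof.
move=> hxy /gr_class_eq0 h; apply: (quasi_regular_notin hxy); apply: h.
by apply/mexp1; case: hxy => /param_max.
Qed.

Lemma param_hom_prime x y : regular_params x y -> hom_primes S (principal (cl 1 x)).
Proof.
move=> hxy; have hx : mexp 1 x by apply/mexp1; case: hxy => /param_max.
have hp := param_prime hxy.
split=> //; first exact: principal_homogeneous.
split=> [|[//|[//|n]] Q [hQ hlt] en].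
  exists (fun i => if i is 0%N then [set 0] else principal (cl 1 x)) => //.
  split=> [[|[|//]] _ //|[|//] _]; first exact: gr_zero_prime.
  split=> [_ ->|/(_ _ (principal_self _))]; first exact: (ideal0 (principal_ideal _)).
  exact: (param_class_neq0 hxy).
have hn1 : Q n.+1 `<=` [set 0].
  by apply: (prime_sub_principal _ hx (hQ _ _)) => //; rewrite -en; exact: hlt.
have [_ []] := hlt n (leqW (leqnn _)).
move=> z /hn1 ->; have [QI _ _] := hQ n (leqW (leqW (leqnn _))); exact: ideal0.
Qed.

Variable p : set (gr S).
Hypothesis hp : hom_primes S p.

Let pI : is_ideal p. Proof. by case: hp => [[]]. Qed.
Let pP : is_prime p. Proof. by case: hp. Qed.
Let p_homog : is_homogeneous_ideal p. Proof. by case: hp. Qed.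

(** Otherwise 0, q, p would be a chain of length two ending at p. *)
Lemma hom_prime_min (q : set (gr S)) z : is_prime q -> q `<=` p -> q z -> z <> 0 -> q = p.
Proof.
move=> hq qp qz z0; apply/seteqP; split=> //; apply: contrapT => npq.
have [_ _ [_ hmax]] := hp.
suff : (2 <= 1)%N by [].
apply: (hmax 2%N (nth p [:: [set 0]; q])) => //.
split=> [[|[|[|//]]] _ //|[|[|//]] _]; first exact: gr_zero_prime.
  split=> [_ ->|/(_ _ qz) /z0//]; by case: hq => /ideal0.
by split.
Qed.

Lemma hom_prime_neq0 : exists n a, [/\ mexp n a, p (cl n a) & ~ mexp n.+1 a].
Proof.
have [_ _ [[Q [hQ hlt] e1] _]] := hp.
have [_ nsub] := hlt 0%N isT; rewrite e1 in nsub.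
apply: contrapT => h; apply: nsub => z pz.
suff -> : z = 0 by have [/ideal0] := hQ 0%N isT.
apply: gr_component_ext => n; rewrite gr_component0 gr_componentE.
apply/gr_class_eq0; first exact: gr_coefP.
apply: contrapT => hn; apply: h; exists n, (gr_coef n z); split=> //.
  exact: gr_coefP.
exact: (p_homog n pz).
Qed.

(** Justifies taking x outside p without loss of generality: if p contained the classes of both
    parameters, it would equal the prime generated by the class of x, which does not contain that of
    y. *)
Lemma hom_prime_class1 : exists x y, regular_params x y /\ ~ p (cl 1 x).
Proof.
have [_ _ [x [y hxy]]] := hS.
have [px|] := pselect (p (cl 1 x)); last by exists x, y.
have [py|] := pselect (p (cl 1 y)); last by exists y, x; split=> //; exact: regular_paramsC.
case: (param_class_notin hxy).
rewrite (@hom_prime_min (principal (cl 1 x)) (cl 1 x)) //.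
- exact: (param_prime hxy).
- exact: principal_sub.
- exact: principal_self.
- exact: (param_class_neq0 hxy).
Qed.

Lemma hom_prime_X n h : mexp 1 h -> p (cl n (h ^+ n)) -> p (cl 1 h).
Proof.
move=> hh; rewrite -{1}[n]mul1n gr_classX //; have [_ p1 pM] := pP.
by elim: n => [|n IH]; rewrite ?expr0 // exprS => /pM [].
Qed.

(** Euclidean division in k[y/x]: an element of p of least degree, among those whose polynomial has
    full degree, generates p, since a non-zero remainder would give a smaller one. *)
Lemma hom_prime_principal x y (k : fieldType) (phi : {rmorphism S -> k}) :
  regular_params x y -> ~ p (cl 1 x) ->
  (forall c : k, exists a, phi a = c) -> (forall a, phi a = 0 <-> m a) ->
  exists d h H, [/\ (0 < d)%N, dehom x y phi d h H, size H = d.+1 & p = principal (cl d h)].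
Proof.
move=> hxy px phiS phi0; have lift n Q := @dehom_lift _ _ _ _ hxy _ _ phiS n Q.
have hx : mexp 1 x by apply/mexp1; case: hxy => /param_max.
have [_ p1 pM] := pP.
(* As x is outside p, powers of x can be cancelled: a has the class of x^(n-s) b, where b has the
   same polynomial in its exact degree s. *)
have red n a Q : dehom x y phi n a Q -> p (cl n a) -> Q != 0 ->
    exists s b, [/\ dehom x y phi s b Q, size Q = s.+1 & p (cl s b)].
  move=> haQ pa Q0; pose s := (size Q).-1.
  have es : size Q = s.+1 by rewrite prednK // lt0n size_poly_eq0.
  have [|b hb] := lift s Q; first by rewrite es.
  exists s, b; split=> //.
  have sn : (s <= n)%N by have := dehom_size haQ; rewrite es.
  have := dehomM (dehom_x x y phi (n - s)) hb; rewrite subnK // mul1r.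
  move=> /(dehom_cl hxy phi0 haQ) e; move: pa; rewrite e -{1}(subnK sn).
  rewrite gr_classM; [|by have := ideal_expX (n - s) hx; rewrite mul1n|exact: dehom_mem hb].
  by case/pM => // /(hom_prime_X hx).
pose P s := `[< exists b Q, [/\ dehom x y phi s b Q, size Q = s.+1 & p (cl s b)] >].
have ex : exists s, P s.
  have [n [a [ha pa na]]] := hom_prime_neq0.
  have [Q hQ] := dehom_ex hxy phi ha.
  have [|s [b hb]] := red n a Q hQ pa; last by exists s; apply/asboolP; exists b, Q.
  by apply/eqP => Q0; apply: na; apply/(dehom_eq0 hxy phi0 hQ).
case: (ex_minnP ex) => d /asboolP [h [H [hH sH ph]]] dmin.
exists d, h, H; split=> //.
  rewrite lt0n; apply/eqP => d0; rewrite d0 in hH sH ph.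
  have [b hb] : is_unit h.
    have [hu _ _] := hS; apply: hu => /mexp1 /(dehom_eq0 hxy phi0 hH) H0.
    by move: sH; rewrite H0 size_poly0.
  apply: p1; rewrite -gr_class1 -hb -[0%N]addn0 gr_classM; try exact: ideal_exp0.
  exact: (ideal_mulr _ pI).
have hh := dehom_mem hxy hH.
apply/seteqP; split=> [z pz|]; last exact: principal_sub.
apply: homogeneous_ideal_mem => [|n]; first exact: principal_ideal.
have := p_homog n pz; rewrite gr_componentE.
move: (gr_coefP n z); move: (gr_coef n z) => a ha pa.
have [Q hQ] := dehom_ex hxy phi ha.
apply/(dehom_principal hxy phiS phi0 hH sH hQ).
have H0 : H != 0 by rewrite -size_poly_eq0 sH.
apply: contrapT => /negP ndvd.
(* The remainder is realized by a - h e with e a lift of the quotient; for n < d it is a itself. *)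
have [b [hb pb]] : exists b, dehom x y phi n b (Q %% H) /\ p (cl n b).
  have [dn|nd] := leqP d n; last first.
    exists a; rewrite modp_small // sH (leq_ltn_trans (dehom_size hQ))//.
  have [|e he] := lift (n - d)%N (Q %/ H).
    by rewrite size_divp // sH /= -subSn // leq_sub2r // (dehom_size hQ).
  have hhe := dehomM hH he; rewrite subnKC // in hhe.
  exists (a - h * e); split.
    have -> : Q %% H = Q - H * (Q %/ H) by rewrite {2}(divp_eq Q H) mulrC addrC addKr.
    exact: dehomB.
  rewrite gr_classB //; last exact: dehom_mem hhe.
  apply: (idealB pI) => //; rewrite -{1}(subnKC dn).
  rewrite gr_classM //; [exact: (ideal_mulr _ pI)|exact: dehom_mem he].
have [s [b' [hb' sb' pb']]] := red n b _ hb pb ndvd.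
have : (d <= s)%N by apply: dmin; apply/asboolP; exists b', (Q %% H).
by have := ltn_modpN0 Q H0; rewrite sH sb' ltnS ltnNge => /negbTE ->.
Qed.

End Regular.

End HomogeneousPrimes.

(** * Quadratic transforms *)

Section Transform.
Variables (K : fieldType) (S : subring K).
Local Notation mexp := (ideal_exp (max_ideal S)).
Local Notation cl := (@gr_class S).

(* the degree-zero part of the homogeneous localization of the Rees algebra
   away from p, an intrinsic description of the quadratic transform at p *)
Definition transform_set (p : set (gr S)) : set K :=
  [set z | exists n (a b : S),
     [/\ mexp n a, mexp n b, ~ p (cl n b) & z = val a / val b]].

Variable p : set (gr S).
Hypothesis pP : is_prime p.

Let pI : is_ideal p. Proof. by case: pP. Qed.

Lemma class_notin_neq0 n (b : S) : ~ p (cl n b) -> val b != 0.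
Proof.
move=> pb; apply: val_neq0 => b0; apply: pb.
by rewrite b0 gr_class0; exact: ideal0.
Qed.

Lemma class_notinM n k (a b : S) : mexp n a -> mexp k b -> ~ p (cl n a) ->
  ~ p (cl k b) -> ~ p (cl (n + k) (a * b)).
Proof. by move=> ha hb pa pb; rewrite gr_classM //; have [_ _ pM] := pP => /pM []. Qed.

Lemma class_inMl n k (a b : S) : mexp n a -> mexp k b -> p (cl n a) ->
  p (cl (n + k) (a * b)).
Proof. by move=> ha hb pa; rewrite gr_classM //; exact: ideal_mulr. Qed.

Lemma class_in_eq n (a b : S) : mexp n a -> mexp n b -> mexp n.+1 (a - b) ->
  p (cl n a) -> p (cl n b).
Proof. by move=> ha hb hab; rewrite (gr_class_eq ha hb).2. Qed.

Lemma class_notin1 : ~ p (cl 0 1).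
Proof. by rewrite gr_class1; case: pP. Qed.

Lemma class_notinX n (x : S) : mexp 1 x -> ~ p (cl 1 x) -> ~ p (cl n (x ^+ n)).
Proof.
move=> hx px; rewrite -{1}[n]mul1n gr_classX //; have [_ p1 pM] := pP.
by elim: n => [|n IH]; rewrite ?expr0 // exprS => /pM [].
Qed.

Lemma transform_subring : [/\ transform_set p 1,
  forall a b, transform_set p a -> transform_set p b -> transform_set p (a - b) &
  forall a b, transform_set p a -> transform_set p b -> transform_set p (a * b)].
Proof.
split=> [|_ _ [n [a [b [ha hb pb ->]]]] [k [c [e [hc he pe ->]]]]
         |_ _ [n [a [b [ha hb pb ->]]]] [k [c [e [hc he pe ->]]]]].
- exists 0%N, 1, 1; split=> //; first exact: class_notin1.
  by rewrite subval1 divr1.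
- exists (n + k)%N, (a * e - b * c), (b * e); split.
  + by apply: (idealB (mexp_ideal _ _)); exact: ideal_expD.
  + exact: ideal_expD.
  + exact: class_notinM.
  + rewrite subvalB !subvalM; field.
    by rewrite (class_notin_neq0 pb) (class_notin_neq0 pe).
- exists (n + k)%N, (a * c), (b * e); split; try exact: ideal_expD.
    exact: class_notinM.
  by rewrite !subvalM invfM mulrACA.
Qed.

Lemma adjoinP (x y : S) z : regular_parameters x y -> x <> 0 ->
  adjoin S (val y / val x) z <-> exists n a, mexp n a /\ z = val a / val x ^+ n.
Proof.
move=> hxy x0; have x0' := val_neq0 x0; split=> [[q _ <-]|[n [a [ha ->]]]].
  exists (size q), (binform x y (size q) (fun i => q`_i)).
  rewrite (val_binform y x0) // mulrAC divff ?expf_neq0 // mul1r; split=> //.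
  by apply/(ideal_exp_formP _ _ hxy); eexists.
have /(mexp_slopeP hxy x0) [q sq ->] := ha.
by exists q => //; rewrite mulrAC divff ?expf_neq0 // mul1r.
Qed.

(** The right-hand side mentions neither x, y nor h, which makes the transform independent of them.
    The point is that b/x^n lies in (x, h/x^d) exactly when the class of b is in p. *)
Lemma localize_transform (x y h : S) d : regular_parameters x y -> ~ p (cl 1 x) ->
  mexp d h -> p = principal (cl d h) ->
  localize_at (adjoin S (val y / val x)) (val x) (val h / val x ^+ d) = transform_set p.
Proof.
move=> hxy px hh ph; have hx : mexp 1 x by apply/mexp1; exact: param_max hxy.
have x0 : x <> 0 by move=> e; apply: px; rewrite e gr_class0; exact: ideal0.
have x0' := val_neq0 x0.
have hX n : mexp n (x ^+ n) by have := ideal_expX n hx; rewrite mul1n.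
have adjP z := adjoinP z hxy x0.
have mI n := mexp_ideal S n.
apply/seteqP; split=> z.
- move=> [A [B [/adjP [n [a [ha ->]]] /adjP [k [b [hb ->]]] nB ->]]].
  exists (n + k)%N, (a * x ^+ k), (x ^+ n * b); split; try exact: ideal_expD.
    move=> pb; apply: nB; move: pb; rewrite ph.
    have hxb := ideal_expD (hX n) hb.
    (* Writing x^n b = h e + r, with r in the next power of m, exhibits the denominator as an
       element of (x, h/x^d). *)
    move=> /(principal_class hh hxb) [e [he1 he hr]].
    set r := _ - _ in hr.
    have er : val x ^+ n * val b = val h * val e + val r.
      by rewrite -subvalX -!subvalM -subvalD /r addrC subrK.
    exists (val r / val x ^+ (n + k).+1), (val e / val x ^+ (n + k - d)); split.
    + by apply/adjP; exists (n + k).+1, r.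
    + by apply/adjP; exists (n + k - d)%N, e.
    have -> : val b / val x ^+ k = (val x ^+ n * val b) / val x ^+ (n + k).
      by rewrite exprD; field; rewrite !expf_neq0.
    rewrite er; case: he1 => [dnk|->].
      have e1 : val x ^+ (n + k) = val x ^+ d * val x ^+ (n + k - d).
        by rewrite -exprD subnKC.
      by rewrite exprS e1; field; rewrite x0' !expf_neq0.
    rewrite subval0 !mul0r !mulr0 add0r addr0 exprS; field.
    by rewrite x0' expf_neq0.
  (* For b = 0 both sides are 0, the inverse of 0 being 0. *)
  rewrite !subvalM !subvalX; have [->|b0] := eqVneq (val b) 0.
    by rewrite mulr0 mul0r !invr0 !mulr0.
  by field; rewrite b0 !expf_neq0.
- move=> [n [a [b [ha hb pb ->]]]].
  exists (val a / val x ^+ n), (val b / val x ^+ n); split.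
  + by apply/adjP; exists n, a.
  + by apply/adjP; exists n, b.
  + move=> [_ [_ [/adjP [i [c [hc ->]]] /adjP [j [e [he ->]]] eb]]].
    (* Clearing denominators, b times a power of x is a multiple of h plus a term of higher order,
       so its class is in p. *)
    have {}eb : b * x ^+ (d + i + j) = c * x ^+ (n + d + j).+1 + h * (e * x ^+ (n + i)).
      apply: val_inj; rewrite subvalD !subvalM !subvalX.
      have -> : val b = val x ^+ n * (val b / val x ^+ n) by field; rewrite expf_neq0.
      rewrite eb exprS !exprD; field.
      by rewrite !expf_neq0.
    apply: (class_notinM hb (hX (d + i + j)%N) pb); first exact: class_notinX.
    rewrite eb; have eN : (n + (d + i + j) = d + (j + (n + i)))%N by lia.
    have h1 : mexp (j + (n + i)) (e * x ^+ (n + i)) by exact: ideal_expD.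
    have h2 : mexp (n + (d + i + j)).+1 (c * x ^+ (n + d + j).+1).
      have -> : (n + (d + i + j)).+1 = (i + (n + d + j).+1)%N by lia.
      exact: ideal_expD.
    have h3 : mexp (n + (d + i + j)) (h * (e * x ^+ (n + i))).
      by rewrite eN; exact: ideal_expD.
    apply: (class_in_eq h3).
    + by apply: (idealD (mI _)) => //; exact: ideal_expW h2.
    + by rewrite opprD addrCA subrr addr0; exact: (idealN (mI _)).
    + by rewrite eN ph; exact: principal_classM.
  + by field; rewrite (class_notin_neq0 pb) expf_neq0.
Qed.

End Transform.

Section QuadraticTransform.
Variables (K : fieldType) (S : subring K).
Local Notation mexp := (ideal_exp (max_ideal S)).
Local Notation cl := (@gr_class S).
Hypothesis hS : regular2 S.
Variable p : set (gr S).
Hypothesis hp : hom_primes S p.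

Let pP : is_prime p. Proof. by case: hp. Qed.
Let pI : is_ideal p. Proof. by case: pP. Qed.

(** [is_quadratic_transform] only asks that x and y generate m. If x were in m^2, the class of y
    alone would span degree one of the graded ring, which has two independent classes. *)
Lemma regular_parameters_notin (x y : S) : regular_parameters x y -> ~ mexp 2 x.
Proof.
move=> hxy x2; have [hu _ [x0 [y0 h0]]] := hS.
have h2 := mexp_ideal S 2.
have my : mexp 1 y by apply/mexp1; exact: param_maxC hxy.
have gen z : max_ideal S z -> exists b, cl 1 z = cl 0 b * cl 1 y.
  rewrite {1}hxy => /ideal_gen2P [a [b ez]]; exists b.
  rewrite -gr_classM // ez; apply/gr_class_eq.
  - apply: (idealD (mexp_ideal S 1)); apply: (ideal_mull _ (mexp_ideal S 1)) => //.
    exact: ideal_expW.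
  - exact: (ideal_mull _ (mexp_ideal S 1)).
  - by rewrite addrK; exact: (ideal_mull _ h2).
have [b eb] := gen _ (param_max h0.1).
have [d ed] := gen _ (param_maxC h0.1).
have [mb|/hu [b' bb']] := pselect (max_ideal S b).
  apply: (param_class_neq0 h0); rewrite eb.
  by rewrite (gr_class_eq0 (ideal_exp0 _ _)).2 ?mul0r//; apply/mexp1.
have e1 : cl 0 b * cl 0 b' = 1.
  by rewrite -(gr_classM (ideal_exp0 _ b) (ideal_exp0 _ b')) bb' gr_class1.
apply: (param_class_notin hS h0); exists (cl 0 b' * cl 0 d) => //.
by rewrite ed eb -[RHS]mul1r -e1; ring.
Qed.

Lemma hom_prime_class_neq0 d (h : S) : p = principal (cl d h) -> cl d h <> 0.
Proof.
move=> ph h0; have [n [a [ha]]] := hom_prime_neq0 hp.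
by rewrite ph h0 => -[z _]; rewrite mul0r => /esym /(gr_class_eq0 ha).
Qed.

Lemma hom_prime_gen_unit (h : S) : p <> principal (cl 0 h).
Proof.
move=> ph; have [b hb] : is_unit h.
  have [hu _ _] := hS; apply: hu => mh; apply: (hom_prime_class_neq0 ph).
  by apply/gr_class_eq0 => //; apply/mexp1.
have [_ p1 _] := pP; apply: p1; rewrite -gr_class1 -hb -[0%N]addn0 gr_classM //.
by rewrite ph; exists (cl 0 b).
Qed.

(** If the class of x were that of h times e, then d = 1 because p is proper, and e would be a unit
    because x is not in m^2; so the class of x would divide that of h. *)
Lemma transform_data_class (x y h : S) d : regular_parameters x y -> mexp d h ->
  p = principal (cl d h) -> ~ principal (cl 1 x) (cl d h) -> ~ p (cl 1 x).
Proof.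
move=> hxy hh ph nxh; have x2 := regular_parameters_notin hxy.
have hx : mexp 1 x by apply/mexp1; exact: param_max hxy.
rewrite {1}ph => /(principal_class hh hx) [e [hde he hr]].
have [hu _ _] := hS.
have e0 : e <> 0 by move=> e0; apply: x2; rewrite e0 mulr0 subr0 in hr.
case: hde => // d1; case: d d1 hh ph nxh he => [|[|//]] _ hh ph nxh he.
  exact: (hom_prime_gen_unit ph).
have [me|/hu [e' ee']] := pselect (max_ideal S e).
  apply: x2; apply: (idealBr (mexp_ideal _ _) hr); rewrite mulrC.
  exact: ideal_expMS.
apply: nxh; exists (cl 0 e') => //; rewrite -gr_classM // addn0.
apply/gr_class_eq => //; first exact: (ideal_mulr _ (mexp_ideal S 1)).
have -> : x * e' - h = (x - h * e) * e' by rewrite mulrBl -mulrA ee' mulr1.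
exact: (ideal_mulr _ (mexp_ideal S 2)).
Qed.

Lemma hom_prime_notin_principal (x y h : S) d : regular_params x y -> ~ p (cl 1 x) ->
  p = principal (cl d h) -> ~ principal (cl 1 x) (cl d h).
Proof.
move=> hxy px ph [w _ ew].
have : p (cl 1 x * w) by rewrite ew ph; exact: principal_self.
have [_ _ pM] := pP; case/pM => //; rewrite {1}ph => -[v _ ev].
have : cl d h * (1 - cl 1 x * v) = 0.
  by rewrite mulrBr mulr1 mulrCA ev ew subrr.
case/(gr_domain hS) => [|/eqP]; first exact: hom_prime_class_neq0.
rewrite subr_eq0 => /eqP e1; have [_ n1 _] := param_prime hS hxy.
by apply: n1; rewrite {1}e1; exists v.
Qed.

(** Every candidate for [xget] has the same underlying set, and a generator of p together with a
    parameter outside p provides one. *)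
Lemma quadratic_transformE : subring_set (quadratic_transform p) = transform_set p.
Proof.
have uniq T : is_quadratic_transform p T -> subring_set T = transform_set p.
  move=> [x [y [h [d [hxy hh ph nxh ->]]]]].
  exact: (localize_transform pP hxy (transform_data_class hxy hh ph nxh) hh ph).
rewrite /quadratic_transform; case: xgetP => [T _ /uniq //|h]; exfalso.
have [x [y [hxy px]]] := hom_prime_class1 hS hp.
have [k [phi [phiS phi0]]] := regular2_dehom hS.
have [d [f [F [_ hF _ pf]]]] := hom_prime_principal hS hp hxy px phiS phi0.
have hf := dehom_mem hxy hF.
apply: (h (Subring (transform_subring pP))).
exists x, y, f, d; split=> //; first by case: hxy.
  exact: (hom_prime_notin_principal hxy px pf).
exact/esym/(localize_transform pP hxy.1 px hf pf).
Qed.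

End QuadraticTransform.

Section TransformRing.
Variables (K : fieldType) (S T : subring K).
Local Notation mexp := (ideal_exp (max_ideal S)).
Local Notation cl := (@gr_class S).
Hypothesis hS : regular2 S.
Variable p : set (gr S).
Hypothesis hp : hom_primes S p.
Hypothesis hT : subring_set T = transform_set p.

Let pP : is_prime p. Proof. by case: hp. Qed.
Let pI : is_ideal p. Proof. by case: pP. Qed.
Let mI n : is_ideal (mexp n). Proof. exact: mexp_ideal. Qed.

Lemma transform_elt n (a b : S) : mexp n a -> mexp n b -> ~ p (cl n b) ->
  exists t : T, val t = val a / val b.
Proof. by move=> ha hb pb; apply/subring_setE; rewrite hT; exists n, a, b. Qed.

Lemma transform_repr (t : T) : exists n (a b : S),
  [/\ mexp n a, mexp n b, ~ p (cl n b) & val t = val a / val b].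
Proof. by have : subring_set T (val t) by [apply/subring_setE; exists t]; rewrite hT. Qed.

Lemma transform_incl (c : S) : exists t : T, val t = val c.
Proof.
have [t et] := transform_elt (ideal_exp0 _ c) (ideal_exp0 _ 1) (class_notin1 pP).
by exists t; rewrite et subval1 divr1.
Qed.

Definition transform_max_set : set T := [set t | exists n (a b : S),
  [/\ mexp n a, mexp n b, ~ p (cl n b), p (cl n a) & val t = val a / val b]].

Lemma transform_fracE n k (a b c e : S) : ~ p (cl n b) -> ~ p (cl k e) ->
  val a / val b = val c / val e -> a * e = c * b.
Proof.
move=> pb pe /eqP; rewrite eqr_div ?(class_notin_neq0 pP pb) ?(class_notin_neq0 pP pe)//.
by move/eqP => h; apply: subval_inj; rewrite !subvalM.
Qed.

(** Membership in the maximal ideal can be read off any fraction representing t, because p is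
    prime. *)
Lemma transform_max_class n (a b : S) (t : T) : mexp n a -> mexp n b ->
  ~ p (cl n b) -> val t = val a / val b -> transform_max_set t -> p (cl n a).
Proof.
move=> ha hb pb et [k [c [e [hc he pe pc]]]]; rewrite et => h.
have /(transform_fracE pb pe) h' := h.
have : p (cl (n + k) (a * e)).
  by rewrite h' addnC; exact: class_inMl.
by rewrite gr_classM //; have [_ _ pM] := pP => /pM [].
Qed.

Lemma transform_max_ideal : is_ideal transform_max_set.
Proof.
split.
- exists 0%N, 0, 1; split; [exact: ideal_exp0|exact: ideal_exp0|exact: class_notin1| |].
    by rewrite gr_class0; exact: ideal0.
  by rewrite !subval0 mul0r.
- move=> s t [n [a [b [ha hb pb pa es]]]] [k [c [e [hc he pe pc et]]]].
  exists (n + k)%N, (a * e + c * b), (b * e); split.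
  + apply: (idealD (mI _)); first exact: ideal_expD.
    by rewrite addnC; exact: ideal_expD.
  + exact: ideal_expD.
  + exact: class_notinM.
  + rewrite gr_classD; [|exact: ideal_expD|by rewrite addnC; exact: ideal_expD].
    apply: (idealD pI); first exact: class_inMl.
    by rewrite addnC; exact: class_inMl.
  + rewrite subvalD es et subvalD !subvalM; field.
    by rewrite (class_notin_neq0 pP pb) (class_notin_neq0 pP pe).
- move=> s t [n [a [b [ha hb pb pa es]]]].
  have [k [c [e [hc he pe et]]]] := transform_repr s.
  exists (n + k)%N, (a * c), (b * e); split; try exact: ideal_expD.
  + exact: class_notinM.
  + exact: class_inMl.
  + by rewrite subvalM es et !subvalM invfM mulrC mulrACA.
Qed.

Lemma transform_max_unit (t : T) : ~ transform_max_set t -> is_unit t.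
Proof.
move=> nt; have [n [a [b [ha hb pb et]]]] := transform_repr t.
have pa : ~ p (cl n a) by move=> pa; apply: nt; exists n, a, b.
have [s es] := transform_elt hb ha pa; exists s; apply: subval_inj.
rewrite subvalM et es subval1 mulrA divfK ?divff//.
  exact: class_notin_neq0 pa.
exact: class_notin_neq0 pb.
Qed.

Lemma transform_maxE : max_ideal T = transform_max_set.
Proof.
apply: max_idealE => [|[n [a [b [ha hb pb pa]]]]|t].
- exact: transform_max_ideal.
- rewrite subval1 => e; apply: (pb); suff <- : a = b by [].
  apply: subval_inj; rewrite -[LHS](divfK (class_notin_neq0 pP pb)) -e mul1r //.
- exact: transform_max_unit.
Qed.

End TransformRing.

Section TransformParams.
Variables (K : fieldType) (S T : subring K).
Local Notation mexp := (ideal_exp (max_ideal S)).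
Local Notation cl := (@gr_class S).
Hypothesis hS : regular2 S.
Variable p : set (gr S).
Hypothesis hp : hom_primes S p.
Hypothesis hT : subring_set T = transform_set p.

Let pP : is_prime p. Proof. by case: hp. Qed.
Let pI : is_ideal p. Proof. by case: pP. Qed.
Let mI n : is_ideal (mexp n). Proof. exact: mexp_ideal. Qed.
Let mE : max_ideal T = @transform_max_set K S T p. Proof. exact: transform_maxE. Qed.

Lemma transform_nonmax_unit : nonmax_unit T.
Proof. by move=> t; rewrite mE => /(transform_max_unit hp hT). Qed.

Variables (x y h : S) (d : nat).
Hypothesis hxy : regular_params x y.
Hypothesis px : ~ p (cl 1 x).
Hypothesis hh : mexp d h.
Hypothesis ph : p = principal (cl d h).

Let hx : mexp 1 x. Proof. by apply/mexp1; case: hxy => /param_max. Qed.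
Let hX n : mexp n (x ^+ n). Proof. by have := ideal_expX n hx; rewrite mul1n. Qed.
Let pX n : ~ p (cl n (x ^+ n)). Proof. exact: class_notinX. Qed.
Let x0 : val x != 0. Proof. exact: class_notin_neq0 px. Qed.

Variables (X H : T).
Hypothesis eX : val X = val x.
Hypothesis eH : val H = val h / val x ^+ d.

(** When the class of a is in p, a = h e + r with r in the next power, and a/b = (r/(xb)) x + (x^d
    e/b) (h/x^d). *)
Lemma transform_parameters : regular_parameters X H.
Proof.
have gI := ideal_gen_ideal [set X; H].
have tI := max_ideal_ideal T.
rewrite /regular_parameters; apply/seteqP; split; last first.
  apply: ideal_gen_min => // _ [->|->]; rewrite mE.
    exists 1%N, (x * x), x; have hxx : mexp 2 (x * x) by exact: (hX 2).
    split=> //; first exact: ideal_expW hxx.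
      by rewrite (gr_class_eq0 (ideal_expW hxx)).2 //; exact: ideal0.
    by rewrite eX subvalM mulfK.
  exists d, h, (x ^+ d); rewrite subvalX; split=> //.
  by rewrite ph; exact: principal_self.
move=> t; rewrite mE => -[n [a [b [ha hb pb pa et]]]].
move: pa; rewrite ph => /(principal_class hh ha) [e [hde he hr]].
have [r er] : exists r : T, val r = val (a - h * e) / val (x * b).
  apply: (transform_elt hT hr (ideal_expD hx hb)).
  exact: (class_notinM pP hx hb).
have [s es] : exists s : T, val s = val (x ^+ d * e) / val b.
  apply: (transform_elt hT _ hb pb); case: hde => [dn|->].
    by rewrite -{1}(subnKC dn); exact: ideal_expD.
  by rewrite mulr0; exact: ideal0.
suff -> : t = r * X + s * H.
  apply: (idealD gI); apply: (ideal_mull _ gI); apply: sub_ideal_gen; [by left|by right].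
apply: subval_inj; rewrite subvalD !subvalM et er es eX eH subvalB !subvalM subvalX.
by field; rewrite x0 (class_notin_neq0 pP pb) expf_neq0.
Qed.

Lemma transform_mulX_eq0 (z : T) : X * z = 0 -> z = 0.
Proof. by case/subring_domain => // X0; move: x0; rewrite -eX X0 subval0 eqxx. Qed.

Lemma transform_principalX n (a b : S) (z : T) : mexp n a -> mexp n b ->
  ~ p (cl n b) -> val z = val a / val b -> mexp n.+1 a -> principal X z.
Proof.
move=> ha hb pb ez ha1.
have [w ew] := transform_elt hT ha1 (ideal_expD hx hb) (class_notinM pP hx hb px pb).
exists w => //; apply: subval_inj; rewrite subvalM eX ew ez subvalM.
by field; rewrite x0 (class_notin_neq0 pP pb).
Qed.

(** X divides a/b as soon as a has order above n. If X divides H (a/b), then h a e has order above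
    its expected degree for some e outside p; the graded ring is a domain, so the excess can only
    come from a. *)
Lemma transform_quasi_regular : quasi_regular (max_ideal T) X H.
Proof.
apply: regular_sequence_quasi_regular.
- exact: transform_parameters.
- exact: transform_mulX_eq0.
move=> z [w _ ew].
have [n [a [b [ha hb pb ez]]]] := transform_repr hT z.
have [k [c [e [hc he pe ew']]]] := transform_repr hT w.
apply: (transform_principalX ha hb pb ez).
have eq : h * (a * e) = x * (x ^+ d * (b * c)).
  apply: subval_inj; rewrite !subvalM subvalX.
  have b0 := class_notin_neq0 pP pb; have e0 := class_notin_neq0 pP pe.
  have -> : val c = val w * val e by rewrite ew' divfK.
  have -> : val a = val z * val b by rewrite ez divfK.
  have -> : val h = val H * val x ^+ d by rewrite eH divfK // expf_neq0.
  have e1 : val x * val w = val H * val z by rewrite -eX -!subvalM ew.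
  transitivity (val H * val z * (val x ^+ d * val b * val e)); first by ring.
  by rewrite -e1; ring.
have : mexp (d + (n + k)).+1 (h * (a * e)).
  rewrite eq; apply: (ideal_expD hx (n := (d + (n + k))%N)).
  by apply: ideal_expD => //; exact: ideal_expD.
move/(mexp_domain hS hh (ideal_expD ha he)) => [|].
  by move/(gr_class_eq0 hh) => h0; case: (hom_prime_class_neq0 hp ph).
case/(mexp_domain hS ha he) => // /(gr_class_eq0 he) e0.
by case: pe; rewrite e0; exact: ideal0.
Qed.

Lemma transform_params : regular_params X H.
Proof. by split; [exact: transform_parameters|exact: transform_quasi_regular]. Qed.

Lemma initial_div_power n (a : S) : (0 < d)%N -> mexp n a -> ~ mexp n.+1 a ->
  exists c g, [/\ (c * d <= n)%N, mexp (n - c * d) g, ~ p (cl (n - c * d) g) &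
    mexp n.+1 (a - h ^+ c * g)].
Proof.
move=> d0; elim/ltn_ind: n a => n IH a ha na.
have [|pa] := pselect (p (cl n a)); last first.
  exists 0%N, a; rewrite mul0n subn0; split=> //.
  by rewrite expr0 mul1r subrr; exact: ideal0.
rewrite {1}ph => /(principal_class hh ha) [e [hde he hr]].
have ne (dn : (d <= n)%N) : ~ mexp (n - d).+1 e.
  move=> he1; apply: na; apply: (idealBr (mI _) hr).
  by rewrite -{1}(subnKC dn) -addnS; exact: ideal_expD.
case: hde => [dn|e0]; last by case: na; move: hr; rewrite e0 mulr0 subr0.
have lt : (n - d < n)%N by lia.
have [c [g [cd hg pg hr']]] := IH _ lt e he (ne dn).
have ed : (n - c.+1 * d = n - d - c * d)%N by rewrite mulSn subnDA.
exists c.+1, g; rewrite ed; split=> //; first by rewrite mulSn; lia.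
have -> : a - h ^+ c.+1 * g = (a - h * e) + h * (e - h ^+ c * g).
  by rewrite exprS; ring.
apply: (idealD (mI _)) => //.
by rewrite -{1}(subnKC dn) -addnS; exact: ideal_expD.
Qed.

(* the equation of the strict transform near the exceptional curve X = 0 *)
Lemma transform_strict_equation n c (a g : S) : (c * d <= n)%N -> mexp n a ->
  mexp (n - c * d) g -> ~ p (cl (n - c * d) g) -> mexp n.+1 (a - h ^+ c * g) ->
  exists F u r : T, [/\ val F = val a / val x ^+ n, is_unit u & F = u * H ^+ c + X * r].
Proof.
move=> cd ha hg pg hr.
have [F eF] := transform_elt hT ha (hX n) (pX (n := n)).
have [u eu] := transform_elt hT hg (hX _) (pX (n := (n - c * d)%N)).
have [r er] := transform_elt hT hr (hX _) (pX (n := n.+1)).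
rewrite subvalX in eF; exists F, u, r; split=> //.
  apply: transform_nonmax_unit; rewrite mE => mu.
  by apply: pg; apply: (transform_max_class hp hg _ _ eu mu).
apply: subval_inj; rewrite subvalD !subvalM subvalX eF eu er eX eH subvalB subvalM !subvalX.
have e1 : val x ^+ n = (val x ^+ d) ^+ c * val x ^+ (n - c * d).
  by rewrite -exprM -exprD mulnC subnKC.
rewrite exprS e1 expr_div_n; field.
by rewrite x0 !expf_neq0.
Qed.

(** For t = a/b and N the order of a, F = a/x^N has order at most c by [quasi_regular_last], so X^N
    F, a multiple of t, is not in the power N + c + 1. *)
Lemma transform_separated t : (0 < d)%N ->
  (forall n, ideal_exp (max_ideal T) n t) -> t = 0.
Proof.
move=> d0 ht; have [n [a [b [ha hb pb et]]]] := transform_repr hT t.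
have [|a0] := pselect (a = 0).
  by move=> a0; apply: val_inj0; rewrite et a0 subval0 mul0r.
have [_ sep _] := hS.
have [N [hN nN]] : exists N, mexp N a /\ ~ mexp N.+1 a.
  apply: contrapT => nex; apply: a0; apply: sep.
  elim=> [|i IH]; first exact: ideal_exp0.
  by apply: contrapT => ni; apply: nex; exists i.
have [c [g [cd hg pg hr]]] := initial_div_power d0 hN nN.
have [F [u [r [eF uu eF']]]] := transform_strict_equation cd hN hg pg hr.
have [B eB] := transform_incl hp hT b.
have eXF : X ^+ N * F = t * B.
  apply: subval_inj; rewrite !subvalM subvalX eF eB et eX divfK.
    by rewrite mulrC divfK // expf_neq0.
  exact: class_notin_neq0 pb.
have : ideal_exp (max_ideal T) (N + c.+1) (X ^+ N * F).
  by rewrite eXF; apply: ideal_mulr => //; exact: mexp_ideal.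
have hXH := transform_parameters; have qr := transform_quasi_regular.
have {}hF : forall i, ideal_exp (max_ideal T) (i + c.+1) (X ^+ i * F) ->
    ideal_exp (max_ideal T) c.+1 F.
  elim=> [|i IH]; first by rewrite expr0 mul1r.
  by rewrite exprS -mulrA addSn => /(quasi_regular_mulx hXH qr) /IH.
move/hF; rewrite eF' => /(quasi_regular_last hXH qr) mu.
by case: (nonunit_max mu).
Qed.

End TransformParams.

Section TransformRegular.
Variables (K : fieldType) (S T : subring K).
Local Notation cl := (@gr_class S).

Lemma transform_param_elts (p : set (gr S)) (x h : S) d :
  hom_primes S p -> subring_set T = transform_set p ->
  ideal_exp (max_ideal S) 1 x -> ~ p (cl 1 x) -> ideal_exp (max_ideal S) d h ->
  exists X H : T, val X = val x /\ val H = val h / val x ^+ d.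
Proof.
move=> hp hT hx px hh; have [X eX] := transform_incl hp hT x; exists X.
have hX : ideal_exp (max_ideal S) d (x ^+ d) by have := ideal_expX d hx; rewrite mul1n.
have pX : ~ p (cl d (x ^+ d)) by apply: class_notinX => //; case: hp.
by have [H eH] := transform_elt hT hh hX pX; exists H; rewrite eH subvalX.
Qed.

Lemma transform_regular2 (p : set (gr S)) : regular2 S -> hom_primes S p ->
  subring_set T = transform_set p -> regular2 T.
Proof.
move=> hS hp hT.
have [x [y [hxy px]]] := hom_prime_class1 hS hp.
have hx : ideal_exp (max_ideal S) 1 x by apply/mexp1; case: hxy => /param_max.
have [k [phi [phiS phi0]]] := regular2_dehom hS.
have [d [h [F [d0 hF _ ph]]]] := hom_prime_principal hS hp hxy px phiS phi0.
have hh := dehom_mem hxy hF.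
have [X [H [eX eH]]] := transform_param_elts hp hT hx px hh.
split; first exact: (transform_nonmax_unit hp hT).
  by move=> a; exact: (transform_separated hS hp hT hxy px hh ph eX eH d0).
by exists X, H; exact: (transform_params hS hp hT hxy px hh ph eX eH).
Qed.

End TransformRegular.

(** * Residue degrees *)

Section ResidueDegree.
Variable K : fieldType.

(** The two families express each other modulo the maximal ideal, and freeness of b' makes the
    product of the coefficient matrices over the residue field the identity of size d', which
    factors through size d. *)
Lemma residue_basis_le (R S : subring K) (d d' : nat) (b : 'I_d -> S) (b' : 'I_d' -> S) :
  nonmax_unit R -> (forall c : R, exists t : S, val t = val c) ->
  residue_basis R b -> residue_basis R b' -> (d' <= d)%N.
Proof.
move=> hu incl [gen _] [gen' free'].
have [k [phi [_ phi0]]] := residue_field_ex hu.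
have tI := max_ideal_ideal S.
have [A hA] := choice (fun j : 'I_d' => gen (b' j)).
have [B hB] := choice (fun i : 'I_d => gen' (b i)).
apply: (@mulmx1_min k d' d (\matrix_(j, i) phi (A j i)) (\matrix_(i, l) phi (B i l))).
have [t ht] := choice hA; have [t' ht'] := choice hB.
have [iA hiA] : exists iA : 'I_d' -> 'I_d -> S, forall j i, val (iA j i) = val (A j i).
  by have [iA hiA] := choice (fun ji : 'I_d' * 'I_d => incl (A ji.1 ji.2));
    exists (fun j i => iA (j, i)) => j i; rewrite hiA.
apply/matrixP => j l; rewrite !mxE.
pose C l := \sum_i A j i * B i l - (j == l)%:R.
suff /phi0 : max_ideal R (C l).
  rewrite rmorphB rmorph_sum rmorph_nat => /eqP; rewrite subr_eq0 => /eqP <-.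
  by apply: eq_bigr => i _; rewrite !mxE rmorphM.
(* [w] collects the error terms of both expansions, so that the combination of the b' with
   coefficients [C] is exactly w. *)
pose w := - (t j + \sum_i iA j i * t' i).
apply: (free' C w).
  apply: (idealN tI); apply: (idealD tI); first by case: (ht j).
  by apply: ideal_sum => // i _; apply: (ideal_mull _ tI); case: (ht' i).
rewrite /w subvalN subvalD subval_sum /C.
have -> : \sum_i val (\sum_i0 A j i0 * B i0 i - (j == i)%:R) * val (b' i) =
    \sum_i val (A j i) * (\sum_l val (B i l) * val (b' l)) - val (b' j).
  under eq_bigr do rewrite subvalB subval_sum mulrBl.
  rewrite sumrB; congr (_ - _).
    under [RHS]eq_bigr do rewrite mulr_sumr.
    rewrite exchange_big /=; apply: eq_bigr => i _; rewrite mulr_suml.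
    by apply: eq_bigr => i' _; rewrite mulrA.
  rewrite (bigD1 j) //= eqxx big1 => [|i ij].
    by rewrite subval1 mul1r addr0.
  by rewrite eq_sym (negbTE ij) subval0 mul0r.
have [_ ->] := ht j.
have -> : \sum_i val (A j i) * (\sum_l val (B i l) * val (b' l)) =
    \sum_i val (A j i) * val (b i) - \sum_i val (iA j i * t' i).
  rewrite -sumrB; apply: eq_bigr => i _; rewrite subvalM hiA.
  by have [_ ->] := ht' i; rewrite mulrDr addrK.
by rewrite opprD addrAC -!addrA; ring.
Qed.

Variables (S T : subring K).
Local Notation mexp := (ideal_exp (max_ideal S)).
Local Notation cl := (@gr_class S).
Hypothesis hS : regular2 S.
Variable p : set (gr S).
Hypothesis hp : hom_primes S p.
Hypothesis hT : subring_set T = transform_set p.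

Let pP : is_prime p. Proof. by case: hp. Qed.

(** Two generators of p divide each other, so they have the same degree. *)
Lemma deg_eq d (h : S) : mexp d h -> p = principal (cl d h) -> deg p = d.
Proof.
move=> hh ph; apply: xget_unique; first by exists h.
have le n l (g f : S) : mexp n g -> mexp l f -> p = principal (cl n g) ->
    p = principal (cl l f) -> (n <= l)%N.
  move=> hg hf pg pf; apply: (principal_degree_le hg hf (hom_prime_class_neq0 hp pf)).
  by rewrite -pg pf; exact: principal_self.
move=> n [g hg pg]; apply/eqP; rewrite eqn_leq.
by rewrite (le _ _ _ _ hh hg) // (le _ _ _ _ hg hh).
Qed.

(** The residue field of T is k[Y]/(F) with Y = y/x and F the dehomogenized generator of p; a basis
    is 1, Y, ..., Y^(d-1). *)
Lemma residue_basis_transform : exists b : 'I_(deg p) -> T, residue_basis S b.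
Proof.
have [x [y [hxy px]]] := hom_prime_class1 hS hp.
have hx : mexp 1 x by apply/mexp1; case: hxy => /param_max.
have hy : mexp 1 y by apply/mexp1; case: hxy => /param_maxC.
have hX n : mexp n (x ^+ n) by have := ideal_expX n hx; rewrite mul1n.
have pX n : ~ p (cl n (x ^+ n)) by exact: class_notinX.
have x0 : val x != 0 by exact: class_notin_neq0 px.
have [k [phi [phiS phi0]]] := regular2_dehom hS.
have [d [h [F [d0 hF sF ph]]]] := hom_prime_principal hS hp hxy px phiS phi0.
have hh := dehom_mem hxy hF.
rewrite (deg_eq hh ph).
have pdvd n a Q : dehom x y phi n a Q -> p (cl n a) <-> F %| Q.
  by move=> hQ; rewrite ph; exact: (dehom_principal hxy phiS phi0 hF sF hQ).
have F0 : F != 0 by rewrite -size_poly_eq0 sF.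
have Fprime P Q : F %| P * Q -> F %| P \/ F %| Q.
  have [a ha] := dehom_lift hxy phiS (leqnSn (size P)).
  have [b hb] := dehom_lift hxy phiS (leqnSn (size Q)).
  move/(pdvd _ _ _ (dehomM ha hb)).
  rewrite gr_classM; [|exact: dehom_mem ha|exact: dehom_mem hb].
  have [_ _ pM] := pP.
  by case/pM => [/(pdvd _ _ _ ha)|/(pdvd _ _ _ hb)]; [left|right].
have Fcop Q : ~~ (F %| Q) -> coprimep F Q.
  move=> nQ; have /dvdpP [G eG] := dvdp_gcdl F Q.
  have [] := Fprime G (gcdp F Q); first by rewrite -eG.
    move=> FG; have G0 : G != 0 by apply: contraNneq F0 => G0; rewrite eG G0 mul0r.
    have g0 : gcdp F Q != 0 by apply: contraNneq F0 => g0; rewrite eG g0 mulr0.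
    have := dvdp_leq G0 FG; rewrite {1}eG size_mul // coprimep_def.
    by move: g0 G0; rewrite -!size_poly_eq0; lia.
  by move/dvdp_trans => /(_ _ (dvdp_gcdr F Q)) FQ; rewrite FQ in nQ.
have [Y eY] := transform_elt hT hy hx px.
(* [oapp c 0 (insub i)] extends c by 0 past d; the combination of the powers of Y becomes an element
   of m^d divided by x^d. *)
have sigma (c : 'I_d -> S) : exists a : S, dehom x y phi d a (map_poly phi (\poly_(i < d) oapp c 0 (insub i))) /\
    val a / val x ^+ d = \sum_(i < d) val (c i) * val (Y ^+ i).
  set q := \poly_(i < d) _; have sq : (size q <= d.+1)%N.
    by rewrite (leq_trans (size_poly _ _)).
  have hxn := regular_params_neq0 hxy.
  exists (binform x y d (fun i => q`_i)); split.
    by exists q; split=> //; rewrite (val_binform y hxn sq).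
  rewrite (val_binform y hxn sq) mulrAC divff ?mul1r ?expf_neq0//.
  rewrite /slope_eval (@horner_coef_wide _ d) ?(leq_trans (size_poly _ _)) ?size_poly//.
  apply: eq_bigr => i _; rewrite coef_map /= coef_poly ltn_ord valK /= subvalX eY.
  by [].
exists (fun i => Y ^+ i); split.
- move=> z; have [n [a [b [ha hb pb ez]]]] := transform_repr hT z.
  have [Q hQ] := dehom_ex hxy phi ha; have [B hB] := dehom_ex hxy phi hb.
  (* Bezout's identity v F + u B = 1 inverts the denominator modulo F, so a/b is congruent to the
     remainder s of Q u. *)
  have /Fcop /Bezout_eq1_coprimepP [[v u] /= euv] : ~~ (F %| B).
    by apply/negP => /(pdvd _ _ _ hB).
  pose s := (Q * u) %% F.
  have ss : (size s <= d)%N by rewrite -ltnS -sF ltn_modp.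
  have [g hg] := choice phiS.
  have [w [hw ew]] := sigma (fun i => g s`_i).
  have es : map_poly phi (\poly_(i < d) oapp (fun i : 'I_d => g s`_i) 0 (insub i)) = s.
    apply/polyP => i; rewrite coef_map coef_poly /=; case: ltnP => hi.
      by rewrite insubT /= hg.
    by rewrite rmorph0 nth_default // (leq_trans ss).
  rewrite es in hw.
  have hN := dehomB (dehomM hQ (dehom_x x y phi d)) (eq_rect _ (fun N => dehom x y phi N (w * b) _) (dehomM hw hB) _ (addnC d n)).
  have mN := dehom_mem hxy hN.
  have [t et] := transform_elt hT mN (ideal_expD hb (hX d)) (class_notinM pP hb (hX d) pb (pX d)).
  exists (fun i => g s`_i), t; split.
    rewrite (transform_maxE hp hT); exists (n + d)%N, (a * x ^+ d - w * b), (b * x ^+ d).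
    split=> //; [exact: ideal_expD|exact: class_notinM|].
    apply/(pdvd _ _ _ hN); rewrite mulr1.
    have -> : Q - s * B = F * (Q * v + (Q * u %/ F) * B).
      have e2 : s = Q * u - (Q * u %/ F) * F by apply/eqP; rewrite eq_sym subr_eq addrC -divp_eq.
      by rewrite e2 -{1}[Q]mulr1 -euv; ring.
    exact: dvdp_mulr.
  rewrite -ew et ez subvalB !subvalM subvalX; field.
  by rewrite (class_notin_neq0 pP pb) expf_neq0.
- move=> a t mt et i; have [w [hw ew]] := sigma a.
  have hw' := dehom_mem hxy hw.
  have /(pdvd _ _ _ hw) : p (cl d w).
    have et' : val t = val w / val (x ^+ d) by rewrite subvalX ew.
    apply: (transform_max_class hp hw' (hX d) (pX d) et').
    by rewrite -(transform_maxE hp hT).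
  set q := map_poly _ _ => dq.
  have q0 : q = 0.
    apply: contrapT => /eqP q0; have := dvdp_leq q0 dq; rewrite sF leqNgt ltnS.
    by rewrite (leq_trans (size_poly _ _)) // size_poly.
  apply/phi0; have := congr1 (fun r : {poly k} => r`_i) q0.
  by rewrite /q coef0 coef_map coef_poly ltn_ord /= valK.
Qed.

Lemma residue_degree_transform : residue_degree S T = deg p.
Proof.
have [b hb] := residue_basis_transform.
apply: xget_unique; first by exists b.
have [hu _ _] := hS; have incl := transform_incl hp hT.
move=> d [b' hb']; apply/eqP; rewrite eqn_leq.
by rewrite (residue_basis_le hu incl hb hb') (residue_basis_le hu incl hb' hb).
Qed.

End ResidueDegree.

(** * Chains of quadratic transforms *)

Section Domination.
Variable K : fieldType.
Implicit Types R S T : subring K.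

Definition dominated S T : Prop :=
  subring_set S `<=` subring_set T /\
  forall (s : S) (t : T), val s = val t -> max_ideal S s -> max_ideal T t.

Lemma dominated_refl S : dominated S S.
Proof. by split=> // s t /subval_inj ->. Qed.

Lemma dominated_trans S T U : dominated S T -> dominated T U -> dominated S U.
Proof.
move=> [ST mST] [TU mTU]; split=> [|s t st ms]; first exact: subset_trans TU.
have /subring_setE [r er] : subring_set T (val s) by apply: ST; apply/subring_setE; exists s.
by apply: (mTU r); [rewrite er|exact: (mST s)].
Qed.

Lemma quadratic_step_spec S T : regular2 S -> quadratic_step S T ->
  exists p, [/\ hom_primes S p, T = quadratic_transform p & subring_set T = transform_set p].
Proof. by move=> hS [p hp ->]; exists p; rewrite quadratic_transformE. Qed.

Lemma quadratic_step_regular2 S T : regular2 S -> quadratic_step S T -> regular2 T.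
Proof.
move=> hS /(quadratic_step_spec hS) [p [hp _ hT]]; exact: transform_regular2 hp hT.
Qed.

Lemma transform_dominated S T p : regular2 S -> hom_primes S p ->
  subring_set T = transform_set p -> dominated S T.
Proof.
move=> hS hp hT; split=> [z /subring_setE [s <-]|s t st ms].
  by apply/subring_setE; have [t et] := transform_incl hp hT s; exists t.
have [x [y [[hxy _] px]]] := hom_prime_class1 hS hp.
have hx : ideal_exp (max_ideal S) 1 x by apply/mexp1; exact: param_max hxy.
have hsx : ideal_exp (max_ideal S) 2 (s * x).
  by apply: ideal_expMS.
have [[pI _ _] _ _] := hp.
rewrite (transform_maxE hp hT); exists 1%N, (s * x), x; split=> //.
- exact: ideal_expW.
- by rewrite (gr_class_eq0 (ideal_expW hsx)).2 //; exact: ideal0.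
- by rewrite -st subvalM mulfK //; apply: class_notin_neq0 px; case: hp.
Qed.

Lemma quadratic_step_dominated S T : regular2 S -> quadratic_step S T -> dominated S T.
Proof.
by move=> hS /(quadratic_step_spec hS) [p [hp _ hT]]; exact: transform_dominated hp hT.
Qed.

(** Were y/x in S, the class of x would divide that of y. *)
Lemma quadratic_step_proper S T : regular2 S -> quadratic_step S T ->
  ~ (subring_set T `<=` subring_set S).
Proof.
move=> hS /(quadratic_step_spec hS) [p [hp _ hT]] TS.
have [x [y [hxy px]]] := hom_prime_class1 hS hp.
have [hm _] := hxy.
have hx : ideal_exp (max_ideal S) 1 x by apply/mexp1; exact: param_max hm.
have hy : ideal_exp (max_ideal S) 1 y by apply/mexp1; exact: param_maxC hm.
have [t et] := transform_elt hT hy hx px.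
have /subring_setE [s es] : subring_set S (val t) by apply: TS; apply/subring_setE; exists t.
apply: (param_class_notin hS hxy); exists (gr_class 0 s) => //.
rewrite -gr_classM ?addn0 //; congr (gr_class _ _); apply: subval_inj.
rewrite subvalM es et mulrC divfK //; apply: class_notin_neq0 px; by case: hp.
Qed.

(* If a is in p but not in q then a/b and b/a, for b outside p, lie in the two
   transforms, the former in the maximal ideal. *)
Lemma transform_dominated_sub S T1 T2 T p q : regular2 S -> hom_primes S p ->
  hom_primes S q -> subring_set T1 = transform_set p -> subring_set T2 = transform_set q ->
  dominated T1 T -> dominated T2 T -> p `<=` q.
Proof.
move=> hS hp hq hT1 hT2 [T1T m1] [T2T _] z pz.
have [[pI _ _] phom _] := hp; have [[qI _ _] qhom _] := hq.
apply: homogeneous_ideal_mem => // n.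
have := phom n z pz; rewrite gr_componentE; move: (gr_coefP n z).
move: (gr_coef n z) => a ha pa; apply: contrapT => qa.
have [x [y [[hxy _] px]]] := hom_prime_class1 hS hp.
have hx : ideal_exp (max_ideal S) 1 x by apply/mexp1; exact: param_max hxy.
have hX : ideal_exp (max_ideal S) n (x ^+ n) by have := ideal_expX n hx; rewrite mul1n.
have pX : ~ p (gr_class n (x ^+ n)) by apply: class_notinX => //; case: hp.
have [t1 e1] := transform_elt hT1 ha hX pX.
have [t2 e2] := transform_elt hT2 hX ha qa.
have /subring_setE [s1 es1] : subring_set T (val t1) by apply: T1T; apply/subring_setE; exists t1.
have /subring_setE [s2 es2] : subring_set T (val t2) by apply: T2T; apply/subring_setE; exists t2.
have ms1 : max_ideal T s1.
  apply: (m1 t1) => //; rewrite (transform_maxE hp hT1).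
  by exists n, a, (x ^+ n).
apply: (nonunit_max ms1); exists s2; apply: subval_inj.
rewrite subvalM es1 es2 e1 e2 subval1 mulrA divfK ?divff //.
  by apply: class_notin_neq0 qa; case: hq.
by apply: class_notin_neq0 pX; case: hp.
Qed.

Lemma quadratic_step_dominated_inj S T1 T2 T : regular2 S -> quadratic_step S T1 ->
  quadratic_step S T2 -> dominated T1 T -> dominated T2 T -> T1 = T2.
Proof.
move=> hS /(quadratic_step_spec hS) [p [hp -> hT1]].
move=> /(quadratic_step_spec hS) [q [hq -> hT2]] d1 d2.
suff -> : p = q by [].
apply/seteqP; split; first exact: (transform_dominated_sub hS hp hq hT1 hT2 d1 d2).
exact: (transform_dominated_sub hS hq hp hT2 hT1 d2 d1).
Qed.

(** A chain of length k is a function on [nat] with arbitrary values past k, so that dropping its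
    first ring is a composition with [succn]. *)
Definition step_sequence (u : nat -> subring K) k :=
  forall i, (i < k)%N -> quadratic_step (u i) (u i.+1).

Lemma step_sequence_regular2 u k i : step_sequence u k -> regular2 (u 0%N) ->
  (i <= k)%N -> regular2 (u i).
Proof.
move=> hu h0; elim: i => // i IH ik.
exact: quadratic_step_regular2 (IH (ltnW ik)) (hu i ik).
Qed.

Lemma step_sequence_dominated u k i j : step_sequence u k -> regular2 (u 0%N) ->
  (i <= j <= k)%N -> dominated (u i) (u j).
Proof.
move=> hu h0 /andP [/subnK <-]; elim: (j - i)%N => [|l IH] lk; first exact: dominated_refl.
rewrite addSn in lk *; apply: dominated_trans (IH (ltnW lk)) _.
apply: quadratic_step_dominated; last exact: hu.
exact: (step_sequence_regular2 hu h0 (ltnW lk)).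
Qed.

Lemma step_sequence_loop u k : step_sequence u k -> regular2 (u 0%N) -> u k = u 0%N -> k = 0%N.
Proof.
case: k => // k hu h0 e; case: (quadratic_step_proper h0 (hu 0%N isT)).
have [h _] := step_sequence_dominated (i := 1%N) (j := k.+1) hu h0 (leqnn _).
by rewrite e in h.
Qed.

(** The first transforms of both chains are dominated by the common last ring, hence equal;
    strictness of the steps excludes different lengths. This makes [strict_transform] well
    defined. *)
Lemma step_sequence_uniq u v k l : regular2 (u 0%N) -> u 0%N = v 0%N ->
  step_sequence u k -> step_sequence v l -> u k = v l ->
  k = l /\ forall i, (i <= k)%N -> u i = v i.
Proof.
elim: k l u v => [|k IH] l u v h0 e0 hu hv e.
  have l0 : l = 0%N by apply: (step_sequence_loop hv); rewrite -?e0 // -e.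
  by split=> // i; rewrite leqn0 => /eqP ->.
case: l hv e => [|l] hv e.
  by have := step_sequence_loop hu h0; rewrite e e0 => /(_ erefl).
have h0' : regular2 (v 0%N) by rewrite -e0.
have e1 : u 1%N = v 1%N.
  apply: (quadratic_step_dominated_inj h0 (hu 0%N isT)).
  - by rewrite e0; exact: hv.
  - exact: (step_sequence_dominated (i := 1%N) (j := k.+1) hu h0 (leqnn _)).
  - rewrite e; exact: (step_sequence_dominated (i := 1%N) (j := l.+1) hv h0' (leqnn _)).
have [] := IH l (u \o succn) (v \o succn).
- exact: (quadratic_step_regular2 h0 (hu 0%N isT)).
- exact: e1.
- by move=> i; exact: (hu i.+1).
- by move=> i; exact: (hv i.+1).
- exact: e.
move=> -> h; split=> // -[|i] // hi; exact: h.
Qed.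

Fixpoint iter_strict_transform (J : set K) (u : nat -> subring K) i : set K :=
  if i is i'.+1 then strict_transform_step (u i') (u i) (iter_strict_transform J u i')
  else J.

Lemma eq_iter_strict_transform J u v k : (forall i, (i <= k)%N -> u i = v i) ->
  iter_strict_transform J u k = iter_strict_transform J v k.
Proof.
elim: k => //= k IH h; rewrite IH => [|i ik]; last by rewrite h // leqW.
by rewrite !h.
Qed.

Lemma strict_transform_chain_sequence R J T J' : strict_transform_chain R J T J' ->
  exists u k, [/\ u 0%N = R, u k = T, step_sequence u k & J' = iter_strict_transform J u k].
Proof.
elim=> [|S T0 J0 _ [u [k [u0 uk hu eJ]]] hST].
  by exists (fun=> R), 0%N.
exists (fun i => if (i <= k)%N then u i else T0), k.+1; rewrite ltnn; split=> //.
  move=> i; rewrite ltnS => ik; rewrite ik; case: ltngtP ik => // [ik|ik] _.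
    exact: hu.
  by rewrite ik uk.
rewrite /= leqnn ltnn uk eJ; congr (strict_transform_step _ _ _).
by apply: eq_iter_strict_transform => i ->.
Qed.

Lemma strict_transform_sequence R (f : R) u i : regular2 R -> u 0%N = R ->
  (forall i, quadratic_step (u i) (u i.+1)) ->
  strict_transform f (u i) = iter_strict_transform (fractional_principal R (val f)) u i.
Proof.
move=> hR u0 hu; apply: xget_unique.
  elim: i => [|i IH]; first by rewrite u0; exact: StrictTransformRefl.
  exact: StrictTransformStep.
move=> J /strict_transform_chain_sequence [v [k [v0 vk hv ->]]].
have h0 : regular2 (v 0%N) by rewrite v0.
have e0 : v 0%N = u 0%N by rewrite v0 u0.
have [<- h] := step_sequence_uniq h0 e0 hv (fun j (_ : (j < i)%N) => hu j) vk.
exact: eq_iter_strict_transform.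
Qed.

Lemma neighbourhood_dominated S i T : regular2 S -> neighbourhood S i T ->
  regular2 T /\ dominated S T.
Proof.
move=> hS; elim: i T => [T /= ->|i IH T /= [U /IH [hU dU] hT]].
  by split=> //; exact: dominated_refl.
split; first exact: quadratic_step_regular2 hT.
by apply: dominated_trans dU _; exact: quadratic_step_dominated.
Qed.

End Domination.

(** * The order valuation *)

Section Order.
Variable K : fieldType.
Variable S : subring K.
Local Notation mexp := (ideal_exp (max_ideal S)).

Lemma ord_eq n (a : S) : mexp n a -> ~ mexp n.+1 a -> ord a = n.
Proof.
move=> ha na; apply: xget_unique => // l [hl nl]; apply/eqP; rewrite eqn_leq.
have le i j : mexp i a -> ~ mexp j.+1 a -> (i <= j)%N.
  by move=> hi nj; rewrite leqNgt; apply/negP => ji; apply: nj; exact: ideal_exp_le hi.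
by rewrite (le _ _ hl na) (le _ _ ha nl).
Qed.

Lemma ord_unit (a : S) : ~ max_ideal S a -> ord a = 0%N.
Proof. by move=> ma; apply: ord_eq => // /mexp1. Qed.

Hypothesis hS : regular2 S.

Lemma ord_spec (a : S) : a <> 0 -> mexp (ord a) a /\ ~ mexp (ord a).+1 a.
Proof.
move=> a0; have [_ sep _] := hS.
have [n [hn nn]] : exists n, mexp n a /\ ~ mexp n.+1 a.
  apply: contrapT => nex; apply: a0; apply: sep.
  elim=> [|i IH]; first exact: ideal_exp0.
  by apply: contrapT => ni; apply: nex; exists i.
by rewrite (ord_eq hn nn).
Qed.

Lemma ord_ge n (a : S) : a <> 0 -> mexp n a <-> (n <= ord a)%N.
Proof.
move=> a0; have [ha na] := ord_spec a0; split=> h; last exact: ideal_exp_le h ha.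
by rewrite leqNgt; apply/negP => l; apply: na; exact: ideal_exp_le h.
Qed.

Lemma mul_neq0 (a b : S) : a <> 0 -> b <> 0 -> a * b <> 0.
Proof. by move=> a0 b0 /subring_domain []. Qed.

Lemma ordM (a b : S) : a <> 0 -> b <> 0 -> ord (a * b) = (ord a + ord b)%N.
Proof.
move=> a0 b0; have [ha na] := ord_spec a0; have [hb nb] := ord_spec b0.
by apply: ord_eq; [exact: ideal_expD|move/(mexp_domain hS ha hb) => []].
Qed.

Lemma unit_notin_max (a : S) : is_unit a -> ~ max_ideal S a.
Proof. by move=> ua /nonunit_max. Qed.

Lemma fractional_principal_self z : fractional_principal S z z.
Proof. by exists 1 => //; rewrite subval1 mulr1. Qed.

Lemma fractional_principal_unit z (e : S) : is_unit e ->
  fractional_principal S (z * val e) = fractional_principal S z.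
Proof.
move=> [e' ee']; apply/seteqP; split=> _ [t _ <-].
  by exists (e * t) => //; rewrite subvalM mulrA.
exists (e' * t) => //; rewrite subvalM -mulrA [val e * _]mulrA.
by rewrite -subvalM ee' subval1 mul1r.
Qed.

Lemma fractional_principal_eq (a b : S) : a <> 0 ->
  fractional_principal S (val a) = fractional_principal S (val b) ->
  exists2 e, is_unit e & b = a * e.
Proof.
move=> a0 e; have : fractional_principal S (val a) (val b).
  by rewrite e; exact: fractional_principal_self.
have : fractional_principal S (val b) (val a).
  by rewrite -e; exact: fractional_principal_self.
move=> [c _ ec] [d _ ed].
have eb : b = a * d by apply: subval_inj; rewrite subvalM.
exists d => //; exists c.
have : a * (d * c - 1) = 0.
  rewrite mulrBr mulr1 mulrA -eb; apply/eqP; rewrite subr_eq0; apply/eqP.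
  by apply: subval_inj; rewrite subvalM.
by case/subring_domain => // /eqP; rewrite subr_eq0 => /eqP.
Qed.

Lemma principal_eq (a b : S) : a <> 0 -> principal a = principal b ->
  exists2 e, is_unit e & b = a * e.
Proof.
move=> a0 e; have : principal a b by rewrite e; exact: principal_self.
have : principal b a by rewrite -e; exact: principal_self.
move=> [c _ ec] [d _ ed]; exists d => //; exists c.
have : a * (d * c - 1) = 0 by rewrite mulrBr mulr1 mulrA ed ec subrr.
by case/subring_domain => // /eqP; rewrite subr_eq0 => /eqP.
Qed.

Lemma ord_at_fractional_principal (a : S) : a <> 0 ->
  ord_at S (fractional_principal S (val a)) = ord a.
Proof.
move=> a0; have mem : fractional_principal S (val a) (val a) by exact: fractional_principal_self.
have ge (b : S) : fractional_principal S (val a) (val b) -> b <> 0 -> (ord a <= ord b)%N.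
  move=> [t _ et] b0; have eb : b = a * t by apply: subval_inj; rewrite subvalM.
  rewrite eb ordM ?leq_addr// => t0; apply: b0; by rewrite eb t0 mulr0.
apply: xget_unique; first by split=> //; exists a.
move=> n [[b [hb b0 <-]] hmin]; apply/eqP; rewrite eqn_leq.
by rewrite (ge b) // (hmin a).
Qed.

End Order.

Section OrderValuation.
Variables (K : fieldType) (R : subring K).
Hypothesis hR : regular2 R.
Local Notation V := (order_valuation_ring R).

Definition order_valuation_max : set K := [set z | z = 0 \/ exists a b : R,
  [/\ a <> 0, b <> 0, z = val a / val b & (ord b < ord a)%N]].
Local Notation VM := order_valuation_max.

Lemma valuation_frac n (a b : R) : b <> 0 -> ord b = n ->
  ideal_exp (max_ideal R) n a -> V (val a / val b).
Proof.
move=> b0 eb ha; have [->|a0] := pselect (a = 0).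
  by left; rewrite subval0 mul0r.
by right; exists a, b; split=> //; rewrite eb; apply/(ord_ge hR).
Qed.

Lemma valuationM z w : V z -> V w -> V (z * w).
Proof.
move=> [->|[a [b [a0 b0 -> hab]]]]; first by rewrite mul0r; left.
move=> [->|[c [d [c0 d0 -> hcd]]]]; first by rewrite mulr0; left.
right; exists (a * c), (b * d); split; try exact: mul_neq0.
  by rewrite !subvalM invfM mulrACA.
by rewrite !(ordM hR) // leq_add.
Qed.

Lemma valuation_maxM z w : V z -> VM w -> VM (z * w).
Proof.
move=> [->|[a [b [a0 b0 -> hab]]]]; first by rewrite mul0r; left.
move=> [->|[c [d [c0 d0 -> hcd]]]]; first by rewrite mulr0; left.
right; exists (a * c), (b * d); split; try exact: mul_neq0.
  by rewrite !subvalM invfM mulrACA.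
by rewrite !(ordM hR) // -addnS leq_add.
Qed.

Lemma valuation_maxB z w : VM z -> VM w -> VM (z - w).
Proof.
move=> [->|[a [b [a0 b0 -> hab]]]] [->|[c [d [c0 d0 -> hcd]]]].
- by left; rewrite subr0.
- right; exists (- c), d; split=> //; first by move/eqP; rewrite oppr_eq0 => /eqP.
    by rewrite sub0r subvalN mulNr.
  by rewrite -mulN1r (ordM hR) // ?(ltn_addl) // => /eqP; rewrite oppr_eq0 oner_eq0.
- by right; exists a, b; rewrite subr0.
have e : val a / val b - val c / val d = val (a * d - c * b) / val (b * d).
  by rewrite subvalB !subvalM; field; rewrite !val_neq0.
rewrite e; have [->|n0] := pselect (a * d - c * b = 0).
  by left; rewrite subval0 mul0r.
right; exists (a * d - c * b), (b * d); split=> //; first exact: mul_neq0.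
have bd0 := mul_neq0 b0 d0.
apply/(ord_ge hR) => //; rewrite (ordM hR) //.
apply: (idealB (mexp_ideal _ _)); apply/(ord_ge hR); try exact: mul_neq0.
  by rewrite (ordM hR) // -addSn leq_add.
by rewrite (ordM hR) // addnC -addSn leq_add.
Qed.

Lemma valuation_max_not1 : ~ VM 1.
Proof.
move=> [/eqP|[a [b [a0 b0 e]]]]; first by rewrite oner_eq0.
suff -> : a = b by rewrite ltnn.
by apply: subval_inj; rewrite -[LHS](divfK (val_neq0 b0)) -e mul1r.
Qed.

Lemma valuation_invert z : V z -> ~ VM z -> V z^-1.
Proof.
move=> [->|[a [b [a0 b0 -> hab]]]] nz; first by case: nz; left.
right; exists b, a; split=> //; first by rewrite invf_div.
rewrite leqNgt; apply/negP => lt; apply: nz; right; by exists a, b.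
Qed.

Lemma valuation_notin_max z w : VM z -> V w -> z * w <> 1.
Proof. by move=> hz hw e; apply: valuation_max_not1; rewrite -e mulrC; exact: valuation_maxM. Qed.

End OrderValuation.

(** * Strict transforms *)

Section StrictTransformStep.
Variables (K : fieldType) (S T : subring K).
Local Notation mexp := (ideal_exp (max_ideal S)).
Local Notation cl := (@gr_class S).
Hypothesis hS : regular2 S.
Variable p : set (gr S).
Hypothesis hp : hom_primes S p.
Hypothesis hT : subring_set T = transform_set p.
Variables (x : S) (X : T).
Hypothesis mx : max_ideal S x.
Hypothesis px : ~ p (cl 1 x).
Hypothesis eX : val X = val x.

Let pP : is_prime p. Proof. by case: hp. Qed.
Let hx : mexp 1 x. Proof. exact/mexp1. Qed.
Let x0 : val x != 0. Proof. exact: class_notin_neq0 px. Qed.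
Let X0 : X <> 0. Proof. by move=> e; move: x0; rewrite -eX e subval0 eqxx. Qed.

(** For a in m the fraction a/x belongs to T, because the class of x is outside p. *)
Lemma ideal_extension_max : @ideal_extension K S T (max_ideal S) = principal X.
Proof.
apply/seteqP; split.
  apply: ideal_gen_min; first exact: principal_ideal.
  move=> t [a ma et]; have ha : mexp 1 a by apply/mexp1.
  have [s es] := transform_elt hT ha hx px; exists s => //.
  by apply: subval_inj; rewrite subvalM eX es et mulrC divfK.
apply: principal_sub; first exact: ideal_gen_ideal.
by apply: sub_ideal_gen; exists x.
Qed.

(** [strict_transform_step] is a union over all generators g and all equations of the exceptional
    curve; two choices differ by units of T, so all of them give the same ideal. *)
Lemma strict_transform_step_principal (g : S) : g <> 0 ->
  strict_transform_step S T (fractional_principal S (val g)) =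
  fractional_principal T (val g / val x ^+ ord g).
Proof.
move=> g0; have rE (g' : S) (X' : T) :
    fractional_principal S (val g) = fractional_principal S (val g') ->
    @ideal_extension K S T (max_ideal S) = principal X' ->
    fractional_principal T (val X' ^- ord g' * val g') =
    fractional_principal T (val g / val x ^+ ord g).
  move=> /(fractional_principal_eq g0) [e ue ->].
  rewrite ideal_extension_max => /(principal_eq X0) [d [d' dd'] ->].
  have e0 : e <> 0.
    by move=> e0; apply: (unit_notin_max ue); rewrite e0; exact: (ideal0 (max_ideal_ideal S)).
  have -> : ord (g * e) = ord g.
    by rewrite (ordM hS) // (ord_unit (unit_notin_max ue)) addn0.
  have [E eE] := transform_incl hp hT e; have [c ec] := ue.
  have [C eC] := transform_incl hp hT c.
  have d1 : val d * val d' = 1 by rewrite -subvalM dd' subval1.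
  have d0 : val d != 0 by apply: contra_eq_neq d1 => ->; rewrite mul0r eq_sym oner_neq0.
  have ud : is_unit (d' ^+ ord g * E).
    exists (d ^+ ord g * C); apply: subval_inj.
    rewrite !subvalM !subvalX eE eC subval1 mulrACA -exprMn mulrC [val d' * _]mulrC d1 expr1n mulr1.
    by rewrite -subvalM ec subval1.
  rewrite -(fractional_principal_unit (val g / val x ^+ ord g) ud); congr fractional_principal.
  rewrite !subvalM subvalX eE eX; have -> : val d' = (val d)^-1.
    by apply: (mulfI d0); rewrite d1 divff.
  by rewrite exprMn invfM exprVn mulrACA [_ * val g]mulrC.
apply/seteqP; split=> z; first by move=> [g' [X' [h1 h2]]]; rewrite (rE _ _ h1 h2).
rewrite -(rE g X erefl ideal_extension_max) => hz.
by exists g, X; split=> //; exact: ideal_extension_max.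
Qed.

End StrictTransformStep.

Section Stages.
Variables (K : fieldType) (R : subring K).
Hypothesis hR : regular2 R.
Local Notation V := (order_valuation_ring R).
Local Notation VM := (order_valuation_max R).

(* X is an equation at S of the exceptional curve of the first quadratic
   transform, and W a parameter along it *)
Definition stage (S : subring K) (X W : S) : Prop :=
  [/\ regular2 S, regular_params X W, subring_set S `<=` V, VM (val X) & V (val W)^-1].
Arguments stage : clear implicits.

(** A denominator b of degree n with class outside p has order exactly n, so the fractions have
    non-negative value; likewise h has order d, so h/x^d has value 0. *)
Lemma first_stage (T : subring K) (p : set (gr R)) (x y h : R) d (X H : T) :
  hom_primes R p -> subring_set T = transform_set p -> regular_params x y ->
  ~ p (gr_class 1 x) -> ideal_exp (max_ideal R) d h -> p = principal (gr_class d h) ->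
  val X = val x -> val H = val h / val x ^+ d -> stage T X H.
Proof.
move=> hp hT hxy px hh ph eX eH.
have hx : ideal_exp (max_ideal R) 1 x by apply/mexp1; case: hxy => /param_max.
have hX : ideal_exp (max_ideal R) d (x ^+ d) by have := ideal_expX d hx; rewrite mul1n.
have pP : is_prime p by case: hp.
have pI : is_ideal p by case: pP.
have nb n (b : R) : ideal_exp (max_ideal R) n b -> gr_class n b <> 0 -> b <> 0 /\ ord b = n.
  move=> hb b0; split; first by move=> e; apply: b0; rewrite e gr_class0.
  by apply: ord_eq => // /(gr_class_eq0 hb).
have p0 n (b : R) : ~ p (gr_class n b) -> gr_class n b <> 0.
  by move=> pb e; apply: pb; rewrite e; exact: ideal0.
split.
- exact: transform_regular2 hT.
- exact: (transform_params hR hp hT hxy px hh ph eX eH).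
- move=> z; rewrite hT => -[n [a [b [ha hb /p0 /(nb _ _ hb) [b0 ob] ->]]]].
  exact: (valuation_frac hR b0 ob).
- have [x0 ox] := nb _ _ hx (p0 _ _ px).
  right; exists x, 1; split=> //; first by apply/eqP; exact: oner_neq0.
    by rewrite eX subval1 divr1.
  by rewrite ox ord_unit //; exact: max_ideal_not1.
- rewrite eH invf_div -subvalX.
  have [h0 oh] := nb _ _ hh (hom_prime_class_neq0 hp ph).
  exact: (valuation_frac hR h0 oh).
Qed.

Section NextStage.
Variables (S : subring K) (X W : S).
Hypothesis hst : stage S X W.

Let hS : regular2 S. Proof. by case: hst. Qed.
Let hXW : regular_params X W. Proof. by case: hst. Qed.
Let hWX : regular_params W X. Proof. exact: regular_paramsC. Qed.
Let SV : subring_set S `<=` V. Proof. by case: hst. Qed.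
Let Xm : VM (val X). Proof. by case: hst. Qed.
Let Wv : V (val W)^-1. Proof. by case: hst. Qed.
Let p := principal (gr_class 1 X).
Let hp : hom_primes S p. Proof. exact: (param_hom_prime hS hXW). Qed.
Let pW : ~ p (gr_class 1 W). Proof. exact: (param_class_notin hS hXW). Qed.
Let W0 : val W != 0. Proof. exact/val_neq0/(regular_params_neq0 hWX). Qed.
Let X0 : val X != 0. Proof. exact/val_neq0/(regular_params_neq0 hXW). Qed.
Let hX : ideal_exp (max_ideal S) 1 X. Proof. by apply/mexp1; exact: param_max hXW.1. Qed.
Let hW : ideal_exp (max_ideal S) 1 W. Proof. by apply/mexp1; exact: param_max hWX.1. Qed.

Lemma stage_val (a : S) : V (val a).
Proof. by apply: SV; apply/subring_setE; exists a. Qed.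

(** Modulo the maximal ideal of V, which contains X, b reduces to its W^n term, whose coefficient is
    a unit since the class of b is outside (X); and W is a unit of V. Thus the denominators of the
    next transform are invertible in V. *)
Lemma stage_class_unit n (b : S) : ideal_exp (max_ideal S) n b ->
  ~ p (gr_class n b) -> ~ VM (val b).
Proof.
move=> hb pb mb; have [c eb] := (ideal_exp_formP n b hXW.1).1 hb.
have [e [ee ce]] : exists e, b = X * e + c n * W ^+ n /\ (ideal_exp (max_ideal S) n (X * e)
    /\ p (gr_class n (X * e))).
  case: n hb pb eb => [|n] hb pb eb.
    exists 0; rewrite mulr0 add0r gr_class0; split; last first.
      by split; [exact: ideal_exp0|case: hp => -[/ideal0]].
    by rewrite eb /binform big_ord1 !expr0 mul1r.
  have he : ideal_exp (max_ideal S) n (binform X W n c).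
    by apply/(ideal_exp_formP _ _ hXW.1); exists c.
  exists (binform X W n c); rewrite eb formS_l; split=> //.
  by split; [exact: ideal_expMS (param_max hXW.1) he|exact: (principal_classM hX he)].
have hWn : ideal_exp (max_ideal S) n (W ^+ n) by have := ideal_expX n hW; rewrite mul1n.
have cu : is_unit (c n).
  have [hu _ _] := hS; apply: hu => mc; apply: pb; case: ce => hXe pXe.
  have [[pI _ _] _ _] := hp.
  rewrite ee gr_classD //; last exact: (ideal_mull _ (mexp_ideal _ _)).
  apply: (idealD pI) => //; rewrite (gr_class_eq0 _).2; first exact: ideal0.
    exact: (ideal_mull _ (mexp_ideal _ _)).
  exact: ideal_expMS.
have [c' cc'] := cu.
apply: (valuation_notin_max hR (z := val (c n * W ^+ n)) (w := val c' * (val W)^-1 ^+ n)).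
- have -> : val (c n * W ^+ n) = val b - val X * val e.
    by rewrite -subvalM -subvalB ee addrC addKr.
  by apply: (valuation_maxB hR) => //; rewrite mulrC; apply: (valuation_maxM hR) => //; exact: stage_val.
- apply: (valuationM hR); first exact: stage_val.
  elim: (n) => [|i IH]; last by rewrite exprS; exact: (valuationM hR).
  by rewrite expr0 -(subval1 S); exact: stage_val.
- by rewrite subvalM subvalX mulrACA -subvalM cc' subval1 mul1r -exprMn divff // expr1n.
Qed.

Variable T : subring K.
Hypothesis hT : subring_set T = transform_set p.

Lemma next_stage : exists X' W' : T,
  [/\ val X' = val X / val W, val W' = val W & stage T X' W'].
Proof.
have [W' [X' [eW eX]]] := transform_param_elts hp hT hW pW hX.
rewrite expr1 in eX; exists X', W'; split=> //; split.
- exact: transform_regular2 hT.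
- apply: regular_paramsC.
  by apply: (transform_params hS hp hT hWX pW hX (erefl p) eW); rewrite expr1.
- move=> z; rewrite hT => -[n [a [b [ha hb pb ->]]]].
  apply: (valuationM hR); first exact: stage_val.
  by apply: valuation_invert; [exact: stage_val|exact: stage_class_unit pb].
- by rewrite eX mulrC; exact: (valuation_maxM hR).
- by rewrite eW.
Qed.

(** The order o of F is at most c because a is a unit. Dividing by W^o is harmless for the second
    term: X r = (X/W) (r W), and r W is divisible by W^o in T since r has order at least o - 1. *)
Lemma strict_transform_next (F a r : S) c : F <> 0 -> is_unit a ->
  F = a * W ^+ c + X * r ->
  [/\ (ord F <= c)%N, c = 0%N -> ord F = 0%N, (0 < c)%N -> (0 < ord F)%N &
   forall X' W' : T, val X' = val X / val W -> val W' = val W ->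
   exists F' a' r' : T, [/\ val F' = val F / val W ^+ ord F, is_unit a' &
     F' = a' * W' ^+ (c - ord F) + X' * r']].
Proof.
move=> F0 ua eF; have mI := max_ideal_ideal S; have am := unit_notin_max ua.
have mX : max_ideal S X by exact: param_max hXW.1.
have mW : max_ideal S W by exact: param_max hWX.1.
have hWc n : ideal_exp (max_ideal S) n (W ^+ n) by have := ideal_expX n hW; rewrite mul1n.
have oc : (ord F <= c)%N.
  rewrite leqNgt; apply/negP => /(ord_ge hS _ F0); rewrite eF.
  by move/(quasi_regular_last hXW.1 hXW.2).
split=> // [c0|c0|X' W' eX eW].
- apply: ord_unit => mF; apply: am; move: mF; rewrite eF c0 expr0 mulr1.
  by move/(idealDr mI); apply; exact: ideal_mulr.
- apply/(ord_ge hS) => //; apply/mexp1; rewrite eF.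
  apply: (idealD mI); last exact: ideal_mulr.
  by apply: (ideal_mull _ mI); case: (c) c0 => // i _; rewrite exprS; exact: ideal_mulr.
have [hF _] := ord_spec hS F0; set o := ord F in oc hF *.
have pWn n : ~ p (gr_class n (W ^+ n)) by apply: class_notinX => //; case: hp.
have [F' eF'] := transform_elt hT hF (hWc o) (pWn o).
have [a' ea'] := transform_incl hp hT a.
have ua' : is_unit a'.
  have [b ab] := ua; have [b' eb'] := transform_incl hp hT b.
  by exists b'; apply: subval_inj; rewrite subvalM ea' eb' -subvalM ab !subval1.
(* For o = 0 nothing has to be divided and r W itself is taken; otherwise X r = F - a W^c is in m^o,
   which bounds the order of r. *)
have [r' er'] : exists r' : T, val r' = val r * val W / val W ^+ o.
  case: o oc hF {eF'} => [|o] oc hF.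
    have [r' er'] := transform_incl hp hT (r * W).
    by exists r'; rewrite er' subvalM expr0 divr1.
  have hr : ideal_exp (max_ideal S) o r.
    apply: (quasi_regular_mulx hXW.1 hXW.2).
    rewrite -[X * r](addKr (a * W ^+ c)) -eF addrC.
    apply: (idealB (mexp_ideal _ _)) => //.
    by apply: (ideal_mull _ (mexp_ideal _ _)); exact: ideal_exp_le (hWc c).
  have [r' er'] := transform_elt hT hr (hWc o) (pWn o).
  by exists r'; rewrite er' subvalX exprS; field; rewrite W0 expf_neq0.
exists F', a', r'; split=> //; first by rewrite eF' subvalX.
apply: subval_inj; rewrite subvalD !subvalM subvalX ea' eW eX er' eF' subvalX eF.
rewrite subvalD !subvalM subvalX.
have -> : val W ^+ c = val W ^+ (c - o) * val W ^+ o by rewrite -exprD subnK.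
move: (val W ^+ (c - o)) (val W ^+ o) (expf_neq0 o W0) => v z z0.
by field; rewrite W0 z0.
Qed.

Lemma stage_step_uniq U : quadratic_step S U -> subring_set U `<=` V ->
  U = quadratic_transform p.
Proof.
move=> /(quadratic_step_spec hS) [q [hq -> hU]] UV.
suff -> : p = q by [].
have [qX|qX] := pselect (q (gr_class 1 X)).
  apply: (hom_prime_min hS hq (z := gr_class 1 X)).
  - by case: hp.
  - by apply: principal_sub => //; case: hq => -[].
  - exact: principal_self.
  - exact: (param_class_neq0 hXW).
have [t et] := transform_elt hU hW hX qX.
have Vt : V (val t) by apply: UV; apply/subring_setE; exists t.
case: (valuation_notin_max hR Xm (valuationM hR Vt Wv)).
by rewrite et; field; rewrite W0 X0.
Qed.

End NextStage.

End Stages.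

(** * Multiplicities along a quadratic sequence *)

Section Multiplicity.
Variables (K : fieldType) (R : subring K).
Hypothesis hR : regular2 R.
Local Notation V := (order_valuation_ring R).

Lemma stage_quadratic_step (S : subring K) (X W : S) : stage R X W ->
  quadratic_step S (quadratic_transform (principal (gr_class 1 X))).
Proof.
by move=> [hS hXW _ _ _]; exists (principal (gr_class 1 X)) => //; exact: (param_hom_prime hS hXW).
Qed.

Lemma stage_transform (S : subring K) (X W : S) : stage R X W ->
  subring_set (quadratic_transform (principal (gr_class 1 X))) =
  transform_set (principal (gr_class 1 X)).
Proof.
by move=> [hS hXW _ _ _]; apply: quadratic_transformE => //; exact: (param_hom_prime hS hXW).
Qed.

(** Characterized through V alone, since the equation X of a stage is not canonical; this lets the
    sequence be an [iter] on rings. *)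
Definition next_in_valuation (S : subring K) : subring K :=
  xget S [set U | quadratic_step S U /\ subring_set U `<=` V].

Lemma next_in_valuationE (S : subring K) (X W : S) : stage R X W ->
  next_in_valuation S = quadratic_transform (principal (gr_class 1 X)).
Proof.
move=> hst; apply: xget_unique => [|U [hU UV]].
  split; first exact: stage_quadratic_step hst.
  by have [X' [W' [_ _ []]]] := next_stage hR hst (stage_transform hst).
exact: (stage_step_uniq hR hst hU UV).
Qed.

Variable f : R.
Hypothesis f0 : f <> 0.
Variable p : set (gr R).
Hypothesis hp : hom_primes R p.
Variables (d c : nat) (h g : R).
Local Notation N := (ord f).
Hypothesis hh : ideal_exp (max_ideal R) d h.
Hypothesis ph : p = principal (gr_class d h).
Hypothesis cd : (c * d <= N)%N.
Hypothesis hg : ideal_exp (max_ideal R) (N - c * d) g.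
Hypothesis pg : ~ p (gr_class (N - c * d) g).
Hypothesis hfg : ideal_exp (max_ideal R) N.+1 (f - h ^+ c * g).

(** [w] starts at the first transform and [u] at R: [w i] is [u i.+1], and the strict transform at
    [w i] is [J i.+1]. *)
Let w i : subring K := iter i next_in_valuation (quadratic_transform p).
Let u i : subring K := if i is i'.+1 then w i' else R.
Let J i := iter_strict_transform (fractional_principal R (val f)) u i.
Let o (T : subring K) : nat := ord_at T (strict_transform f T).

(** k is the exponent still to be accounted for by the orders from [w i] on. *)
Definition strict_stage i k := exists X W F : w i,
  [/\ stage R X W, J i.+1 = fractional_principal (w i) (val F), F <> 0 &
      exists a r : w i, is_unit a /\ F = a * W ^+ k + X * r].

Let hT : subring_set (quadratic_transform p) = transform_set p.
Proof. exact: quadratic_transformE. Qed.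

Lemma strict_stage0 : strict_stage 0 c.
Proof.
have [x [y [hxy px]]] := hom_prime_class1 hR hp.
have mx : max_ideal R x by exact: param_max hxy.1.
have hx : ideal_exp (max_ideal R) 1 x by apply/mexp1.
have [X [H [eX eH]]] := transform_param_elts hp hT hx px hh.
have [hf _] := ord_spec hR f0.
have [F [a [r [eF ua eFa]]]] :=
  transform_strict_equation hp hT hxy px eX eH cd hf hg pg hfg.
have x0 := val_neq0 (regular_params_neq0 hxy).
exists X, H, F; split.
- exact: (first_stage hR hp hT hxy px hh ph eX eH).
- rewrite /J /= (strict_transform_step_principal hR hp hT mx px eX f0) ?eF //.
- move=> F0; case/eqP: (val_neq0 f0).
  rewrite -(divfK (expf_neq0 N x0) (val f)) -eF F0 subval0 mul0r //.
- by exists a, r.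
Qed.

Lemma strict_stage_sequence i k : strict_stage i k ->
  [/\ quadratic_step (w i) (w i.+1), subring_set (w i) `<=` V &
      forall U, quadratic_step (w i) U -> subring_set U `<=` V -> U = w i.+1].
Proof.
move=> [X [W [F [hst _ _ _]]]]; rewrite [w i.+1]/= -/(w i) (next_in_valuationE hst).
split; first exact: stage_quadratic_step hst.
  by case: hst.
by move=> U hU UV; exact: (stage_step_uniq hR hst hU UV).
Qed.

Lemma strict_stage_next i k : strict_stage i k -> exists l,
  [/\ (l <= k)%N, k = 0%N -> l = 0%N, (0 < k)%N -> (0 < l)%N,
      ord_at (w i) (J i.+1) = l & strict_stage i.+1 (k - l)].
Proof.
move=> [X [W [F [hst eJ F0 [a [r [ua eF]]]]]]]; exists (ord F).
have hT' := stage_transform hst; have e := next_in_valuationE hst.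
have [hS hXW _ _ _] := hst; have hWX := regular_paramsC hXW.
have [l1 l2 l3 hnext] := strict_transform_next hst hT' F0 ua eF.
split=> //; first by rewrite eJ ord_at_fractional_principal.
have [X' [W' [eX eW hst']]] := next_stage hR hst hT'.
have [F' [a' [r' [eF' ua' eFF']]]] := hnext X' W' eX eW.
have hp' := param_hom_prime hS hXW.
have W0 := val_neq0 (regular_params_neq0 hWX).
have eJ' : strict_transform_step (w i) (quadratic_transform (principal (gr_class 1 X))) (J i.+1) =
    fractional_principal (quadratic_transform (principal (gr_class 1 X))) (val F').
  rewrite eJ eF'; apply: (strict_transform_step_principal hS hp' hT' _ _ eW F0).
    by exact: param_max hWX.1.
  exact: (param_class_notin hS hXW).
have F0' : F' <> 0.
  move=> F'0; case/eqP: (val_neq0 F0).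
  by rewrite -(divfK (expf_neq0 (ord F) W0) (val F)) -eF' F'0 subval0 mul0r.
have eJ2 : J i.+2 = strict_transform_step (w i) (w i.+1) (J i.+1) by [].
have ew : w i.+1 = quadratic_transform (principal (gr_class 1 X)) by rewrite -e.
rewrite /strict_stage eJ2 ew.
by exists X', W', F'; split=> //; exists a', r'.
Qed.

Lemma strict_stage_ex i : exists k, strict_stage i k.
Proof.
elim: i => [|i [k /strict_stage_next [l [_ _ _ _ hl]]]]; first by exists c; exact: strict_stage0.
by exists (k - l)%N.
Qed.

Lemma canonical_step i : quadratic_step (u i) (u i.+1).
Proof.
case: i => [|i]; first by exists p.
by have [k /strict_stage_sequence []] := strict_stage_ex i.
Qed.

Lemma canonical_ord i : o (w i) = ord_at (w i) (J i.+1).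
Proof. by have e := @strict_transform_sequence _ R f u i.+1 hR erefl canonical_step;
  rewrite /o -[w i]/(u i.+1) e. Qed.

(** Each order is subtracted from the exponent and is positive until the exponent is 0, so M steps
    exhaust any k <= M. The induction is on the bound M because one step may lower the exponent by
    more than one. *)
Lemma strict_stage_sum M i k : strict_stage i k -> (k <= M)%N ->
  \sum_(l < M) o (w (i + l)) = k /\ forall l, (M <= l)%N -> o (w (i + l)) = 0%N.
Proof.
elim: M i k => [|M IH] i k hk kM.
  rewrite big_ord0; move: kM; rewrite leqn0 => /eqP k0; rewrite k0 in hk *; split=> // l _.
  elim: l i hk => [|l IHl] i /strict_stage_next [q [_ /(_ erefl) q0 _ eo hi]].
    by rewrite addn0 canonical_ord eo.
  by rewrite addnS -addSn; apply: IHl; rewrite q0 in hi.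
have [q [qk q0 qp eo hi]] := strict_stage_next hk.
have [|hs hz] := IH _ _ hi.
  by case: k {hk hi} kM qk qp q0 => [|k] kM qk qp q0; [lia|have := qp isT; lia].
split=> [|[|l] // lM]; last by rewrite addnS -addSn; exact: hz.
rewrite big_ord_recl addn0 canonical_ord eo.
under eq_bigr do rewrite /= /bump add1n addnS -addSn.
by rewrite hs; exact: subnKC.
Qed.

(** A repeated ring would be reached from R by chains of different lengths. Injectivity turns the
    sum over rings into a sum over indices. *)
Lemma canonical_inj : injective w.
Proof.
move=> i j e.
have [] := @step_sequence_uniq _ u u i.+1 j.+1 hR erefl; last by case.
- by move=> l _; exact: canonical_step.
- by move=> l _; exact: canonical_step.
- exact: e.
Qed.

Lemma canonical_valuation i : subring_set (u i) `<=` V.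
Proof.
case: i => [|i]; last by have [k /strict_stage_sequence []] := strict_stage_ex i.
move=> z /subring_setE [a <-]; have [->|a0] := pselect (a = 0).
  by left; rewrite subval0.
right; exists a, 1; split=> //; first by apply/eqP; exact: oner_neq0.
  by rewrite subval1 divr1.
by rewrite (ord_unit (@max_ideal_not1 R)).
Qed.

Lemma canonical_sequence : is_quadratic_sequence p u.
Proof.
split=> // i; [exact: canonical_step| |exact: canonical_valuation].
have hi := step_sequence_regular2 (u := u) (k := i) (i := i) (fun l _ => canonical_step l) hR (leqnn _).
by case: (quadratic_step_dominated hi (canonical_step i)).
Qed.

Lemma quadratic_sequence_uniq v : is_quadratic_sequence p v -> forall i, v i = u i.
Proof.
move=> [v0 v1 vs _ vV] [//|i]; elim: i => [//|i IH].
have [k /strict_stage_sequence [_ _]] := strict_stage_ex i; apply; last exact: vV.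
by rewrite -[w i]/(u i.+1) -IH; exact: vs.
Qed.

Let A : set (subring K) :=
  [set T | infinitely_near (quadratic_transform p) T /\ quadratic_sequence p T].

Lemma quadratic_sequence_points : A = range w.
Proof.
apply/seteqP; split=> [T [[k _ hk] [v [i [hv eT]]]]|_ [i _ <-]].
  (* Index 0, the ring R, is excluded: every ring infinitely near to the first transform contains
     it, and R does not. *)
  move: hk; rewrite eT (quadratic_sequence_uniq hv); case: i {eT} => [|i] hk; last by exists i.
  have h1 := canonical_step 0.
  have r1 := quadratic_step_regular2 hR h1.
  have [_ [sub _]] := neighbourhood_dominated r1 hk.
  by case: (quadratic_step_proper hR h1).
split; last by exists u, i.+1; split=> //; exact: canonical_sequence.
exists i => //; elim: i => [//|i IH] /=; exists (w i) => //.
exact: (canonical_step i.+1).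
Qed.

(** A sum over [\in] is 0 by convention when infinitely many terms are non-zero, so finiteness of
    the support is established along with the value: only the first c rings can contribute. *)
Lemma multiplicity_sum : finite_set (A `&` [set T | o T <> 0%N]) /\
  c = \big[addn/0%N]_(T \in A) o T.
Proof.
have [hs hz] := strict_stage_sum strict_stage0 (leqnn c).
split.
  apply: (@sub_finite_set _ _ (w @` `I_c)); last exact/finite_image/finite_II.
  move=> T; rewrite quadratic_sequence_points => -[[i _ <-]] oi; exists i => //=.
  by rewrite ltnNge; apply/negP => /hz.
rewrite (reindex_fsbig w [set: nat] A); last first.
  split; first by move=> i _; rewrite quadratic_sequence_points; exists i.
    by move=> i j _ _; exact: canonical_inj.
  by move=> T; rewrite quadratic_sequence_points.
rewrite -(@fsbig_widen _ _ _ _ `I_c) //; last first.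
  by move=> i [_ /= /negP]; rewrite -leqNgt => /hz.
by rewrite -fsbig_ord -{1}hs.
Qed.

End Multiplicity.

(** * Factorisation of the initial form *)

Section PrincipalProducts.
Variable T : comNzRingType.

Lemma principal_setT : [set: T] = principal 1.
Proof. by apply/seteqP; split=> // a _; exists a => //; rewrite mul1r. Qed.

Lemma ideal_mul_principal (a b : T) :
  ideal_mul (principal a) (principal b) = principal (a * b).
Proof.
apply/seteqP; split.
  apply: ideal_gen_min; first exact: principal_ideal.
  by move=> _ [_ [_ [[c _ <-] [e _ <-] ->]]]; exists (c * e) => //; rewrite mulrACA.
apply: principal_sub; first exact: ideal_gen_ideal.
by apply: sub_ideal_gen; exists a, b; split=> //; exact: principal_self.
Qed.

Lemma ideal_exp_principal (a : T) n : ideal_exp (principal a) n = principal (a ^+ n).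
Proof.
elim: n => [|n IH]; first exact: principal_setT.
by rewrite exprS -ideal_mul_principal -IH.
Qed.

Lemma prod_ideal_principal s (a : 'I_s -> T) :
  \big[@ideal_mul T/setT]_(i < s) principal (a i) = principal (\prod_(i < s) a i).
Proof.
apply: (big_rec2 (fun I z => I = principal z)); first exact: principal_setT.
by move=> i I z _ ->; exact: ideal_mul_principal.
Qed.

End PrincipalProducts.

Lemma regular_local_ring2_regular2 (K : fieldType) (R : subring K) :
  regular_local_ring2 R -> regular2 R.
Proof.
move=> [hl hn hdim [x [y hxy]]].
have dom := @subring_domain K R; have hu := local_nonmax_unit hl.
have qr := regular_quasi_regular dom hu hn hxy hdim.
split=> //; last by exists x, y.
by move=> a; exact: (quasi_regular_separated hu hn hxy qr).
Qed.

Section InitialForm.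
Variables (K : fieldType) (R : subring K).
Hypothesis hR : regular2 R.
Local Notation mexp := (ideal_exp (max_ideal R)).
Local Notation cl := (@gr_class R).

Lemma hom_prime_deg (p : set (gr R)) : hom_primes R p ->
  exists h, mexp (deg p) h /\ p = principal (cl (deg p) h).
Proof.
move=> hp; have [x [y [hxy px]]] := hom_prime_class1 hR hp.
have [k [phi [phiS phi0]]] := regular2_dehom hR.
have [d [h [F [_ hF _ ph]]]] := hom_prime_principal hR hp hxy px phiS phi0.
by have hh := dehom_mem hxy hF; rewrite (deg_eq hp hh ph); exists h.
Qed.

Lemma prod_class (s : nat) (d n : 'I_s -> nat) (h : 'I_s -> R) (P : pred 'I_s) :
  (forall i, mexp (d i) (h i)) ->
  exists g, mexp (\sum_(i < s | P i) d i * n i) g /\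
    \prod_(i < s | P i) cl (d i) (h i) ^+ n i = cl (\sum_(i < s | P i) d i * n i) g.
Proof.
move=> hh; apply: (big_rec2 (fun z D => exists g, mexp D g /\ z = cl D g)).
  by exists 1; rewrite gr_class1.
move=> i z D _ [g [hg ->]]; have hn := ideal_expX (n i) (hh i).
by exists (h i ^+ n i * g); rewrite gr_classM // gr_classX //; split=> //; exact: ideal_expD.
Qed.

Variables (f : R) (s : nat) (p : 'I_s -> set (gr R)) (n : 'I_s -> nat).
Hypothesis f0 : f <> 0.
Hypothesis hp : forall i, hom_primes R (p i).
Hypothesis p_inj : injective p.
Hypothesis hf : principal (initial_form f) =
  \big[@ideal_mul (gr R)/setT]_(i < s) ideal_exp (p i) (n i).
Variable h : 'I_s -> R.
Hypothesis hh : forall i, mexp (deg (p i)) (h i).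
Hypothesis ph : forall i, p i = principal (cl (deg (p i)) (h i)).
Local Notation z := (\prod_(i < s) cl (deg (p i)) (h i) ^+ n i).
Local Notation N := (ord f).

Let fN : mexp N f. Proof. by case: (ord_spec hR f0). Qed.
Let clf0 : cl N f <> 0.
Proof. by move/(gr_class_eq0 fN); case: (ord_spec hR f0). Qed.

Lemma principal_initial_form : principal (cl N f) = principal z.
Proof.
rewrite -[cl N f]/(initial_form f) hf -prod_ideal_principal.
by apply: eq_bigr => i _; rewrite {1}ph ideal_exp_principal.
Qed.

(** The initial form and the product of the generators are homogeneous, non-zero and divide each
    other, so their degrees agree. *)
Lemma ord_sum_deg : ord f = (\sum_(j < s) deg (p j) * n j)%N.
Proof.
have [g [hg ez]] := prod_class n predT hh.
have e := principal_initial_form; rewrite ez in e.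
have g0 : cl (\sum_(j < s) deg (p j) * n j) g <> 0.
  move=> g0; apply: clf0; have : principal (cl N f) (cl N f) by exact: principal_self.
  by rewrite e g0 => -[w _ <-]; rewrite mul0r.
apply/eqP; rewrite eqn_leq (principal_degree_le fN hg g0); last first.
  by rewrite e; exact: principal_self.
by rewrite (principal_degree_le hg fN clf0) // -e; exact: principal_self.
Qed.

Lemma hom_prime_gen_notin i j : i != j -> ~ p j (cl (deg (p i)) (h i)).
Proof.
move=> ij pij; case/eqP: ij; apply: p_inj.
apply: (hom_prime_min hR (hp j) (z := cl (deg (p i)) (h i))).
- by case: (hp i).
- by rewrite {1}ph; apply: principal_sub => //; case: (hp j) => -[].
- by rewrite {1}ph; exact: principal_self.
- exact: (hom_prime_class_neq0 (hp i) (ph i)).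
Qed.

(** The cofactor v of the j-th power in the initial form is the product of the other generators with
    e1, a unit of the graded ring because the initial form and the full product divide each other;
    so v is outside p_j. *)
Lemma initial_form_factor j : exists g,
  [/\ (n j * deg (p j) <= N)%N, mexp (N - n j * deg (p j)) g,
      ~ p j (cl (N - n j * deg (p j)) g) & mexp N.+1 (f - h j ^+ n j * g)].
Proof.
have [pP _ _] := hp j; have [pI p1 pM] := pP.
have e := principal_initial_form.
have [e1 _ ef] : principal z (cl N f) by rewrite -e; exact: principal_self.
have [e2 _ ez] : principal (cl N f) z by rewrite e; exact: principal_self.
have ue1 : ~ p j e1.
  move=> pe1; have : cl N f * (1 - e1 * e2) = 0.
    by rewrite mulrBr mulr1 [e1 * _]mulrC mulrA ez ef subrr.
  case/(gr_domain hR) => // /eqP; rewrite subr_eq0 => /eqP e12.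
  by apply: p1; rewrite e12; exact: ideal_mulr.
pose v := \prod_(i < s | i != j) cl (deg (p i)) (h i) ^+ n i * e1.
have pv : ~ p j v.
  move/pM => [|//]; apply: (big_ind (fun w => ~ p j w)) => //.
    by move=> a b pa pb /pM [].
  move=> i ij; elim: (n i) => [|m IH]; first by rewrite expr0.
  by rewrite exprS => /pM [/(hom_prime_gen_notin ij)|].
have hhn : mexp (n j * deg (p j)) (h j ^+ n j).
  by rewrite mulnC; exact: ideal_expX.
have ehn : cl (n j * deg (p j)) (h j ^+ n j) = cl (deg (p j)) (h j) ^+ n j.
  by rewrite mulnC gr_classX.
have efv : cl N f = cl (n j * deg (p j)) (h j ^+ n j) * v.
  by rewrite -ef (bigD1 j) //= -mulrA ehn.
have := gr_component_class N fN; rewrite eqxx {1}efv gr_component_mul //.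
case: leqP => [dN ec|_ /esym //].
have hg := gr_coefP (N - n j * deg (p j)) v.
exists (gr_coef (N - n j * deg (p j)) v); split=> //.
  (* v is homogeneous: its difference with its component of the expected degree is killed by the
     class of [h j ^+ n j], which is non-zero in a domain. *)
  suff <- : v = cl (N - n j * deg (p j)) (gr_coef (N - n j * deg (p j)) v) by [].
  have : cl (n j * deg (p j)) (h j ^+ n j) *
      (v - cl (N - n j * deg (p j)) (gr_coef (N - n j * deg (p j)) v)) = 0.
    by rewrite mulrBr -efv -gr_componentE ec subrr.
  case/(gr_domain hR) => [h0|/eqP]; last by rewrite subr_eq0 => /eqP.
  by case: clf0; rewrite efv h0 mul0r.
have hm := ideal_expD hhn hg; have em := gr_classM hhn hg; rewrite subnKC // in hm em.
by apply/gr_class_eq => //; rewrite em -gr_componentE ec.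
Qed.

End InitialForm.

Theorem proposition2p27 (K : fieldType) (R : subring K) (f : R)
    (s : nat) (p : 'I_s -> set (gr R)) (n : 'I_s -> nat) :
  regular_local_ring2 R -> has_quotient_field R ->
  f <> 0 -> ~ is_unit f ->
  (forall i, hom_primes R (p i)) -> injective p ->
  principal (initial_form f) = \big[@ideal_mul (gr R)/setT]_(i < s) ideal_exp (p i) (n i) ->
  let S (j : 'I_s) : subring K := quadratic_transform (p j) in
  let d (j : 'I_s) : nat := residue_degree R (S j) in
  let A (j : 'I_s) : set (subring K) :=
    [set T | infinitely_near (S j) T /\ quadratic_sequence (p j) T] in
  let o (T : subring K) : nat := ord_at T (strict_transform f T) in
  [/\ forall j, d j = deg (p j),
      forall j, finite_set (A j `&` [set T | o T <> 0%N]),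
      ord f = (\sum_(j < s) d j * \big[addn/0]_(T \in A j) o T)%N &
      forall j, n j = (\big[addn/0]_(T \in A j) o T)%N].
Proof.
move=> hreg _ f0 _ hp p_inj hf S d A o.
have hR := regular_local_ring2_regular2 hreg.
have [h hhp] := choice (fun i => hom_prime_deg hR (hp i)).
have hh i := (hhp i).1; have ph i := (hhp i).2.
have main j : finite_set (A j `&` [set T | o T <> 0%N]) /\
    n j = \big[addn/0%N]_(T \in A j) o T.
  have [g [cd hg pg hfg]] := initial_form_factor hR f0 hp p_inj hf hh ph j.
  exact: (multiplicity_sum hR f0 (hp j) (hh j) (ph j) cd hg pg hfg).
have hd j : d j = deg (p j).
  exact: (residue_degree_transform hR (hp j) (quadratic_transformE hR (hp j))).
split=> [//|j||j]; try by case: (main j).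
rewrite (ord_sum_deg hR f0 hf hh ph); apply: eq_bigr => j _.
by rewrite hd -(main j).2.
Qed.
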